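(* Let $G=\mathrm{Aut}(\mathbf{K})$. Every universal completion flow of $G$ is a strong completion flow; in particular, every completion flow of $G$ is a strong completion flow.
   Context: $\mathcal{L}=\{U_i:i<k^{\mathsf{u}}\}\cup\{R_i:i<k\}$ is a finite relational language ($U_i$ unary, $R_i$ binary) with conventions: each vertex satisfies exactly one $U_i$; $R_i(a,a)$ never; distinct $a,b$ satisfy exactly one $R_i(a,b)$ (write $R(a,b)=i$); an involution $\mathrm{Flip}$ of $k$ fixing $0$ with $R_i(a,b)\iff R_{\mathrm{Flip}(i)}(b,a)$; $R=0$ means ''no relation''. A structure is irreducible if $R(a,b)\neq0$ for all distinct $a,b$. $\mathcal{F}$ is a finite set of finite irreducible $\mathcal{L}$-structures, $\mathcal{K}=\mathrm{Forb}(\mathcal{F})$, and $\mathbf{K}$ is a Fra\''iss\'e limit of $\mathcal{K}$. $G$ has the pointwise convergence topology. A $G$-flow is a compact Hausdorff space $X$ with a continuous right $G$-action; the action extends continuously to an action of the semigroup $\mathrm{Emb}(\mathbf{K},\mathbf{K})$ (the left completion of $G$, with the pointwise convergence topology), written $x\cdot\eta$. A point $x_0\in X$ is a completion point if $x_0\cdot\eta$ has dense $G$-orbit for every $\eta\in\mathrm{Emb}(\mathbf{K},\mathbf{K})$; $X$ is a completion flow if it has a completion point. A universal completion flow is a completion flow admitting a continuous surjective $G$-equivariant map onto every completion flow. A point $x_0$ is a strong completion point if it has dense orbit and for every $\eta\in\mathrm{Emb}(\mathbf{K},\mathbf{K})$ there is $\theta\in\mathrm{Emb}(\mathbf{K},\mathbf{K})$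 with $x_0\cdot\eta\cdot\theta=x_0$; $X$ is a strong completion flow if it contains a strong completion point. *)

(* Defs.v *)
From HB Require Import structures.
From mathcomp Require Import all_boot all_order all_algebra.
From mathcomp Require Import all_classical all_reals all_analysis.

Set Implicit Arguments.
Unset Strict Implicit.
Unset Printing Implicit Defensive.

Local Open Scope classical_set_scope.

Record language := Language {
  nunary : nat;
  nbinary_pred : nat;
  Flip : 'I_nbinary_pred.+1 -> 'I_nbinary_pred.+1;
  Flip_involutive : involutive Flip;
  Flip0 : Flip ord0 = ord0 }.

Notation unary_idx L := 'I_(nunary L).
Notation binary_idx L := 'I_(nbinary_pred L).+1.

Record lstructure (L : language) (T : Type) := LStructure {
  Urel : unary_idx L -> T -> Prop;
  Rrel : binary_idx L -> T -> T -> Prop;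
  Urel_unique : forall a, exists! i, Urel i a;
  Rrel_irrefl : forall i a, ~ Rrel i a a;
  Rrel_unique : forall a b, a <> b -> exists! i, Rrel i a b;
  Rrel_Flip : forall i a b, Rrel i a b <-> Rrel (Flip i) b a }.

Definition irreducible (L : language) (T : Type) (A : lstructure L T) :=
  forall a b : T, a <> b -> ~ Rrel A ord0 a b.

(* The restriction of f to the induced substructure of A on D is an embedding
   into B. *)
Definition embedding_on (L : language) (S T : Type) (A : lstructure L S)
    (B : lstructure L T) (D : set S) (f : S -> T) :=
  [/\ forall a b, D a -> D b -> f a = f b -> a = b,
      forall i a, D a -> (Urel A i a <-> Urel B i (f a)) &
      forall i a b, D a -> D b -> (Rrel A i a b <-> Rrel B i (f a) (f b))].

Definition embedding (L : language) (S T : Type) (A : lstructure L S)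
    (B : lstructure L T) (f : S -> T) := embedding_on A B [set: S] f.

Definition automorphism (L : language) (T : Type) (K : lstructure L T)
    (f : T -> T) := embedding K K f /\ bijective f.

(* Finite structures, up to isomorphism. *)
Record fin_structure (L : language) := FinStructure {
  fin_card : nat;
  fin_struct :> lstructure L 'I_fin_card }.

Definition embeds (L : language) (S T : Type) (A : lstructure L S)
    (B : lstructure L T) := exists f : S -> T, embedding A B f.

Definition Forb (L : language) (F : set (fin_structure L)) :
    set (fin_structure L) :=
  [set B : fin_structure L |
    forall A : fin_structure L, F A -> ~ embeds A B].

Definition ultrahomogeneous (L : language) (T : Type) (K : lstructure L T) :=
  forall (D : set T) (f : T -> T), finite_set D -> embedding_on K K D f ->
    exists2 g : T -> T, automorphism K g & forall a, D a -> g a = f a.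

(* Countability of the carrier is part of T : countType. *)
Definition fraisse_limit (L : language) (T : countType) (K : lstructure L T)
    (C : set (fin_structure L)) :=
  ultrahomogeneous K /\ forall B : fin_structure L, embeds B K <-> C B.

Lemma nbhs_pointwiseP (T : choiceType)
    (S : set {ptws T -> discrete_topology T}) (e : set_type S)
    (U : set (set_type S)) :
  nbhs e U <->
  exists D : seq T, forall e' : set_type S, {in D, val e' =1 val e} -> U e'.
Proof.
split=> [Ue|[D DU]].
- pose F : set_system (set_type S) := filter_from [set: seq T]
    (fun D => [set e' : set_type S | {in D, val e' =1 val e}]).
  have FF : Filter F.
    apply: filter_from_filter; first by exists [::].
    move=> D1 D2 _ _; exists (D1 ++ D2) => // f Df; split=> a aD /=.
    + by apply: Df; rewrite mem_cat aD.
    + by apply: Df; rewrite mem_cat aD orbT.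
  have Fval : (val : set_type S -> {ptws T -> discrete_topology T}) @ F
      --> (val e : {ptws T -> discrete_topology T}).
    apply/cvg_sup => a V [W [[B Bo <-] Be] WV].
    exists [:: a] => // f fe; apply: WV => /=.
    by rewrite /= in Be *; rewrite fe ?inE.
  suff : F --> e by move=> /(_ _ Ue) [D _ DU]; exists D.
  move=> V; rewrite nbhsE => -[W [[B Bo BW] We] WV].
  have /Fval FB : nbhs (val e : {ptws T -> discrete_topology T}) B.
    by apply: open_nbhs_nbhs; split=> //; move: We; rewrite -BW.
  by apply: (filterS _ (FB : F _)) => f /= Bf; apply: WV; rewrite -BW.
- apply: (@filterS _ (nbhs e) _
    [set e' : set_type S | {in D, val e' =1 val e}]) => //.
  elim: D {DU} => [|a D IH]; first by apply: filterS filterT.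
  have Ha : nbhs e [set e' : set_type S | val e' a = val e a].
    have c1 := @initial_continuous _ _ (@set_val _ S).
    have c2 : continuous (fun f : {ptws T -> discrete_topology T} => f a).
      exact: (@proj_continuous T (fun=> discrete_topology T) a).
    have := c2 (set_val e) [set set_val e a] (discrete_set1 _).
    by move=> /(c1 e).
  apply: filterS2 IH Ha => f Df fa b.
  by rewrite inE => /orP[/eqP->//|]; exact: Df.
Qed.

Section Transformations.
Context (L : language) (T : countType) (K : lstructure L T).

Definition Emb_set : set {ptws T -> discrete_topology T} :=
  [set f | embedding K K f].
Definition Aut_set : set {ptws T -> discrete_topology T} :=
  [set f | automorphism K f].

Definition Emb : Type := set_type Emb_set.
Definition Aut : Type := set_type Aut_set.

(* As subspaces of T -> T, both carry the topology of pointwise convergence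
   for the discrete topology on T. *)
HB.instance Definition _ := Topological.copy Emb (set_type Emb_set).
HB.instance Definition _ := Topological.copy Aut (set_type Aut_set).

Definition emb_fun (e : Emb) : T -> T := val e.
Definition aut_fun (g : Aut) : T -> T := val g.

Lemma emb_funP (e : Emb) : embedding K K (emb_fun e).
Proof. exact: (set_valP e). Qed.

Lemma aut_funP (g : Aut) : automorphism K (aut_fun g).
Proof. exact: (set_valP g). Qed.

Definition mk_emb f (Hf : embedding K K f) : Emb :=
  SigSub (mem_set Hf : f \in Emb_set).
Definition mk_aut f (Hf : automorphism K f) : Aut :=
  SigSub (mem_set Hf : f \in Aut_set).

Lemma emb_ext (e f : Emb) : emb_fun e =1 emb_fun f -> e = f.
Proof. by move=> H; apply: val_inj; apply: funext. Qed.

Lemma aut_ext (e f : Aut) : aut_fun e =1 aut_fun f -> e = f.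
Proof. by move=> H; apply: val_inj; apply: funext. Qed.

Lemma embedding_id : embedding K K id.
Proof. by split. Qed.

Lemma embedding_comp f g :
  embedding K K f -> embedding K K g -> embedding K K (f \o g).
Proof.
move=> [fi fU fR] [gi gU gR]; split=> /=.
- by move=> a b Da Db /fi /gi; apply.
- by move=> i a Da; rewrite gU// fU.
- by move=> i a b Da Db; rewrite gR// fR.
Qed.

Lemma automorphism_id : automorphism K id.
Proof. by split; [exact: embedding_id | exists id]. Qed.

Lemma automorphism_comp f g :
  automorphism K f -> automorphism K g -> automorphism K (f \o g).
Proof.
by move=> [? ?] [? ?]; split; [exact: embedding_comp | exact: bij_comp].
Qed.

Lemma aut_inv_subproof (g : Aut) :
  exists h, automorphism K h /\ cancel (aut_fun g) h /\ cancel h (aut_fun g).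
Proof.
have [[gi gU gR] [h gK hK]] := aut_funP g.
exists h; split=> //; split; last by exists (aut_fun g).
split.
- by move=> a b _ _ /(congr1 (aut_fun g)); rewrite !hK.
- by move=> i a _; rewrite -{1}[a]hK -gU.
- by move=> i a b _ _; rewrite -{1}[a]hK -{1}[b]hK -gR.
Qed.

Definition emb_one : Emb := mk_emb embedding_id.
Definition emb_mul (e f : Emb) : Emb :=
  mk_emb (embedding_comp (emb_funP e) (emb_funP f)).

Definition aut_one : Aut := mk_aut automorphism_id.
Definition aut_mul (g h : Aut) : Aut :=
  mk_aut (automorphism_comp (aut_funP g) (aut_funP h)).
Definition aut_inv (g : Aut) : Aut :=
  mk_aut (projT2 (cid (aut_inv_subproof g))).1.

Lemma emb_mulA : associative emb_mul.
Proof. by move=> *; apply: emb_ext. Qed.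
Lemma emb_mul1g : left_id emb_one emb_mul.
Proof. by move=> *; apply: emb_ext. Qed.
Lemma emb_mulg1 : right_id emb_one emb_mul.
Proof. by move=> *; apply: emb_ext. Qed.

HB.instance Definition _ := isMonoid.Build Emb emb_mulA emb_mul1g emb_mulg1.

Lemma aut_mulA : associative aut_mul.
Proof. by move=> *; apply: aut_ext. Qed.
Lemma aut_mul1g : left_id aut_one aut_mul.
Proof. by move=> *; apply: aut_ext. Qed.
Lemma aut_mulg1 : right_id aut_one aut_mul.
Proof. by move=> *; apply: aut_ext. Qed.
Lemma aut_mulVg : left_inverse aut_one aut_inv aut_mul.
Proof.
move=> g; apply: aut_ext => a; rewrite /aut_inv/=.
by case: cid => h [? [gK hK]]/=; exact: gK.
Qed.
Lemma aut_mulgV : right_inverse aut_one aut_inv aut_mul.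
Proof.
move=> g; apply: aut_ext => a; rewrite /aut_inv/=.
by case: cid => h [? [gK hK]]/=; exact: hK.
Qed.

HB.instance Definition _ :=
  isGroup.Build Aut aut_mulA aut_mul1g aut_mulg1 aut_mulVg aut_mulgV.

Definition aut_emb (g : Aut) : Emb := mk_emb (aut_funP g).1.

Record flow := Flow {
  flow_space :> topologicalType;
  flow_act : flow_space -> Aut -> flow_space;
  flow_compact : compact [set: flow_space];
  flow_hausdorff : hausdorff_space flow_space;
  flow_act1 : forall x, flow_act x 1%g = x;
  flow_actM : forall x g h, flow_act x (g * h)%g = flow_act (flow_act x g) h;
  flow_act_continuous :
    continuous (fun p : flow_space * Aut => flow_act p.1 p.2) }.

(* The trace on Aut of the neighbourhoods of e in Emb. *)
Definition aut_near (e : Emb) : set_system Aut :=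
  filter_from (nbhs e) (fun U => aut_emb @^-1` U).

(* x . e is the limit of x . g as g in Aut tends to e in Emb; over an
   ultrahomogeneous K this limit exists, so that the default value x of xget
   is not used (emb_act_cvg), and emb_act is the continuous extension of the
   action to Emb (emb_act_continuous, emb_act_aut, emb_actM). *)
Definition emb_act (X : flow) (x : X) (e : Emb) : X :=
  xget x [set y | flow_act x g @[g --> aut_near e] --> y].

Definition dense_orbit (X : flow) (x : X) := dense (range (flow_act x)).

Definition completion_point (X : flow) (x0 : X) :=
  forall e : Emb, dense_orbit (emb_act x0 e).

Definition completion_flow (X : flow) := exists x0 : X, completion_point x0.

Definition flow_hom (X Y : flow) (f : X -> Y) :=
  continuous f /\
  forall x g, f (flow_act x g) = flow_act (f x) g.

Definition universal_completion_flow (X : flow) :=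
  completion_flow X /\
  forall Y : flow, completion_flow Y ->
    exists2 f : X -> Y, flow_hom f & set_surj [set: X] [set: Y] f.

Definition strong_completion_point (X : flow) (x0 : X) :=
  dense_orbit x0 /\
  forall e : Emb, exists e' : Emb, emb_act (emb_act x0 e) e' = x0.

Definition strong_completion_flow (X : flow) :=
  exists x0 : X, strong_completion_point x0.

End Transformations.

Section Extension.
Context (L : language) (T : countType) (K : lstructure L T).

Lemma nbhs_EmbP (e : Emb K) (U : set (Emb K)) : nbhs e U <->
  exists D : seq T, forall e', {in D, emb_fun e' =1 emb_fun e} -> U e'.
Proof. exact: nbhs_pointwiseP. Qed.

Lemma nbhs_AutP (g : Aut K) (U : set (Aut K)) : nbhs g U <->
  exists D : seq T, forall h, {in D, aut_fun h =1 aut_fun g} -> U h.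
Proof. exact: nbhs_pointwiseP. Qed.

Lemma aut_nearP (e : Emb K) (U : set (Aut K)) : aut_near e U <->
  exists D : seq T, forall h, {in D, aut_fun h =1 emb_fun e} -> U h.
Proof.
split=> [[V /nbhs_EmbP[D DV] VU]|[D DU]].
  by exists D => h hD; apply: VU; apply: DV.
exists [set e' | {in D, emb_fun e' =1 emb_fun e}] => //=.
by apply/nbhs_EmbP; exists D.
Qed.

Lemma aut_near_aut (g : Aut K) : aut_near (aut_emb g) = nbhs g.
Proof.
by apply/predeqP => U; split=> [/aut_nearP ?|/nbhs_AutP ?];
  [apply/nbhs_AutP | apply/aut_nearP].
Qed.

Hypothesis uK : ultrahomogeneous K.

Lemma aut_approx (e : Emb K) (D : seq T) :
  exists g : Aut K, {in D, aut_fun g =1 emb_fun e}.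
Proof.
have [ei eU eR] := emb_funP e.
have [||g gA gD] := uK (D := [set` D]) (f := emb_fun e).
- exact: finite_seq.
- by split=> *; [apply: ei | apply: eU | apply: eR].
by exists (mk_aut gA) => a aD; exact: gD.
Qed.

Lemma aut_near_proper (e : Emb K) : ProperFilter (aut_near e).
Proof.
apply: filter_from_proper.
  apply: filter_from_filter; first by exists setT; exact: filterT.
  by move=> A B nA nB; exists (A `&` B) => //; exact: filterI.
move=> U /nbhs_EmbP[D DU]; have [g gD] := aut_approx e D.
by exists g; apply: DU.
Qed.

Variable X : flow K.

Lemma flow_act_continuousl (g : Aut K) :
  continuous (fun x : X => flow_act x g).
Proof.
move=> x W xW; have [[V N] [/= xV gN] VN] :=
  @flow_act_continuous _ _ _ X (x, g) W xW.
apply: filterS xV => z Vz; apply: (VN (z, g)); split=> //=.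
exact: nbhs_singleton gN.
Qed.

Lemma flow_act_continuousr (x : X) :
  continuous (fun g : Aut K => flow_act x g).
Proof.
move=> g W xW; have [[V N] [/= xV gN] VN] :=
  @flow_act_continuous _ _ _ X (x, g) W xW.
apply: filterS gN => h Nh; apply: (VN (x, h)); split=> //=.
exact: nbhs_singleton xV.
Qed.

Lemma flow_act_near1 (y : X) (W : set X) : nbhs y W ->
  exists2 V : set X, nbhs y V & exists D : seq T, forall z h,
    V z -> {in D, aut_fun h =1 id} -> W (flow_act z h).
Proof.
move=> yW; have := @flow_act_continuous _ _ _ X (y, 1%g) W.
rewrite /= flow_act1 => /(_ yW) [[V N] [/= yV /nbhs_AutP[D DN]] VNW].
exists V => //; exists D => z h zV hD.
by apply: (VNW (z, h)); split=> //; apply: DN.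
Qed.

Lemma flow_act_shift (x : X) (g h : Aut K) (D : seq T) :
  {in D, aut_fun h =1 aut_fun g} ->
  exists2 u : Aut K, {in D, aut_fun u =1 id} &
    forall x : X, flow_act x h = flow_act (flow_act x g) u.
Proof.
move=> hg; exists (g^-1 * h)%g; last first.
  by move=> z; rewrite -flow_actM mulgA mulgV mul1g.
move=> a aD; rewrite [LHS](_ : _ = aut_fun (g^-1)%g (aut_fun h a))// hg//.
by rewrite -[LHS]/(aut_fun (g^-1 * g)%g a) mulVg.
Qed.

Lemma flow_regular (y : X) (W : set X) : nbhs y W ->
  exists2 V : set X, nbhs y V & closed V /\ V `<=` W.
Proof.
move=> yW.
have [V yV VW] := compact_regular (@flow_hausdorff _ _ _ X)
  (@flow_compact _ _ _ X) filterT yW.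
exists (closure V); first by apply: filterS yV; exact: subset_closure.
by split=> //; exact: closed_closure.
Qed.

Lemma emb_act_ex (x : X) (e : Emb K) :
  exists y : X, flow_act x g @[g --> aut_near e] --> y.
Proof.
have FF := aut_near_proper e.
have [y [_ yc]] := @flow_compact _ _ _ X
  (flow_act x g @[g --> aut_near e]) _ filterT.
exists y => W yW; have [V yV [D DW]] := flow_act_near1 yW.
have near_D : aut_near e [set h | {in D, aut_fun h =1 emb_fun e}].
  by apply/aut_nearP; exists D.
have [|_ [[g gD <-] gV]] :=
    yc (flow_act x @` [set h | {in D, aut_fun h =1 emb_fun e}]) V _ yV.
  by apply: filterS near_D => h hD; exists h.
apply: filterS near_D => h hD /=.
have [|u uD ->] := @flow_act_shift x g h D.
  by move=> a aD; rewrite hD// gD.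
exact: DW.
Qed.

Lemma emb_act_cvg (x : X) (e : Emb K) :
  flow_act x g @[g --> aut_near e] --> emb_act x e.
Proof.
exact: (xgetPex x (emb_act_ex x e)).
Qed.

Lemma emb_act_eq (x y : X) (e : Emb K) :
  flow_act x g @[g --> aut_near e] --> y -> emb_act x e = y.
Proof.
have FF := aut_near_proper e; move=> xy.
have PF : ProperFilter (flow_act x g @[g --> aut_near e]).
  exact: fmap_proper_filter.
exact: (@cvg_unique _ (@flow_hausdorff _ _ _ X) _ PF _ _ (@emb_act_cvg x e) xy).
Qed.

Lemma emb_act_aut (x : X) (g : Aut K) : emb_act x (aut_emb g) = flow_act x g.
Proof.
apply: emb_act_eq; rewrite aut_near_aut.
exact: flow_act_continuousr.
Qed.

Lemma emb_act_continuous :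
  continuous (fun p : X * Emb K => emb_act p.1 p.2).
Proof.
move=> [x e] W /= xeW.
have [W' yW' [cW' W'W]] := flow_regular xeW.
have [V yV [D DW]] := flow_act_near1 yW'.
have FF := aut_near_proper e.
have near_D : aut_near e [set h | {in D, aut_fun h =1 emb_fun e}].
  by apply/aut_nearP; exists D.
have near_V : aut_near e [set h | interior V (flow_act x h)].
  exact: (@emb_act_cvg x e _ (nbhs_interior yV)).
have [g [gD gV]] := filter_ex (filterI near_D near_V).
have xN : nbhs x [set x' | V (flow_act x' g)].
  by apply: flow_act_continuousl.
exists ([set x' | V (flow_act x' g)],
        [set e' | {in D, emb_fun e' =1 emb_fun e}]).
  by split=> //=; apply/nbhs_EmbP; exists D.
move=> [x' e'] [/= Vx' e'D]; apply: W'W.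
have FF' := aut_near_proper e'.
apply: (closed_cvg _ cW' _ _ (@emb_act_cvg x' e')).
apply/aut_nearP; exists D => h hD.
have [|u uD ->] := @flow_act_shift x g h D.
  by move=> a aD; rewrite hD// e'D// gD.
exact: DW.
Qed.

Lemma emb_actM (x : X) (e e' : Emb K) :
  emb_act x (e * e')%g = emb_act (emb_act x e) e'.
Proof.
have emb_actMg (g : Aut K) :
    flow_act (emb_act x e) g = emb_act x (e * aut_emb g)%g.
  have FF := aut_near_proper e.
  have PF : ProperFilter (flow_act x (h * g)%g @[h --> aut_near e]).
    exact: fmap_proper_filter.
  apply: (@cvg_unique _ (@flow_hausdorff _ _ _ X) _ PF) => W yW.
    have nW : aut_near e [set h | W (flow_act (flow_act x h) g)].
      exact: (@emb_act_cvg x e _ (flow_act_continuousl yW)).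
    by apply: (filterS _ nW) => h /=; rewrite flow_actM.
  have /aut_nearP[D DW] := @emb_act_cvg x (e * aut_emb g)%g W yW.
  apply/aut_nearP; exists (map (aut_fun g) D) => h hD; apply: DW => a aD.
  by apply: hD; exact: map_f.
apply/esym/emb_act_eq => W yW.
have [[V N] [/= xV /nbhs_EmbP[D DN]] VN] :=
  emb_act_continuous (x := (x, (e * e')%g)) yW.
apply/aut_nearP; exists D => h hD /=; rewrite emb_actMg.
apply: (VN (x, _)); split=> /=; first exact: nbhs_singleton xV.
by apply: DN => a aD; rewrite -[LHS]/(emb_fun e (aut_fun h a)) hD.
Qed.

End Extension.

(* Main.v *)
(* Strong Ramsey property. There are r and a finite colouring χ of the r-tuples of
   K such that every finite colouring of m-tuples becomes, after a self-embedding of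
   K, a function of the χ-colours of the reindexed r-tuples (emb_ramsey). To see
   this, code vertices by words in a finitely branching tree, in which patterns of
   F are killed when they can no longer be completed. The tree carries an F-free
   structure, which embeds in K, and K embeds in it in such a way that splittings and
   kills never occur at a vertex; so the similarity type of a tuple is determined by
   boundedly many entries at a time. A Halpern-Lauchli theorem with kills, proved by
   Harrington's method with a maximal coherent set in place of a generic filter,
   and a fusion give a self-map of the tree on which the colour only depends on the
   similarity type.

   Dynamics. Given a completion point x0, let y be a limit of the points x0 . η along
   an ultrafilter of Ramsey embeddings η. Then y . ζ depends only on the effect of ζ
   on χ-colours, and every y . e has dense orbit. Among the canonical e (those that
   induce a map of colours), take one with the fewest colours in its image. For every
   θ some f = e θ η is canonical and permutes these colours, hence a power f^k acts
   on them trivially and (y . e) . (θ η f^(k-1) e) = y . (f^k e) = y . e. *)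
Require Import Defs.
From mathcomp Require Import all_boot all_order all_algebra.
From mathcomp Require Import all_classical all_reals all_analysis.
From mathcomp Require Import zify.
From Stdlib Require List.

Set Implicit Arguments.
Unset Strict Implicit.
Unset Printing Implicit Defensive.

Local Open Scope classical_set_scope.

(** * Partition theorems for natural numbers *)

(** Everything in the tree rests on one consequence of irreducibility. Two points of a member of F
    always carry a nonzero label, so a word continued by blanks (label zero, nothing killed) takes
    part in no new kill ([Dead_blank]). Padding by blanks is therefore always safe. It amalgamates
    the conditions of the Halpern-Lauchli argument, and it lets a self-map of the tree wait for a
    position that codes the vertex it has to hit. Kills are written into the words because forbidden
    copies arise gradually: a self-map must create no kill of its own, or it would leave the F-free
    part of the tree, and a similarity type must record where each kill happens. Even positions
    never carry vertices, which leaves room for splittings and kills away from vertices; code words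
    recur at arbitrarily large positions, so waiting always succeeds. *)

Lemma no_injective_powerset (A : Type) (f : set A -> A) : ~ injective f.
Proof.
move=> fi; pose D : set A := [set a | exists2 B, a = f B & ~ B a].
have [DD|nD] := pselect (D (f D)).
- by case: (DD) => B /fi <-.
- by apply: (nD); exists D.
Qed.

(** Otherwise every fibre is finite, and the value of [g] together with an index inside its fibre
    injects the power set of [Z * nat] into [Z * nat]. *)
Lemma infinite_fibre (Z : Type) (g : set (Z * nat) -> Z) :
  exists z, exists h : nat -> set (Z * nat), injective h /\ forall n, g (h n) = z.
Proof.
apply: contrapT => H.
have cnt z : exists k : set (Z * nat) -> nat,
    forall W W', g W = z -> g W' = z -> k W = k W' -> W = W'.
  have : countable [set W | g W = z].
    apply: finite_set_countable; apply: contrapT => /(infiniteP _).1 /pcard_leP[h].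
    apply: H; exists z, h; split => [n n' hh|n].
      by apply: (@inj _ _ setT h); rewrite ?in_setT.
    by have := @funS _ _ _ _ h n I.
  move=> /countable_injP[k ki]; exists k => W W' gW gW' kk.
  by apply: ki; rewrite ?inE.
have [k kP] := choice cnt.
apply: (@no_injective_powerset _ (fun W => (g W, k (g W) W))) => W W' [gg kk].
by apply: (kP (g W)) => //; rewrite kk gg.
Qed.

(** The new coordinate ranges over [set (Z * nat)], where [Z] is the set of colourings of the old
    product. Infinitely many of its values induce the same colouring [z] of the old product, to
    which the induction hypothesis applies. *)
Lemma polarized d : exists X : Type, forall f : ('I_d -> X) -> nat,
  exists K : 'I_d -> nat -> X, (forall i, injective (K i)) /\
  exists c, forall n : 'I_d -> nat, f (fun i => K i (n i)) = c.
Proof.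
elim: d => [|d [X IH]].
  exists unit => f; exists (fun _ _ => tt); split; first by case.
  by exists (f (fun=> tt)) => n; congr f; apply: funext => -[].
pose Z := ('I_d -> X) -> nat; exists (X + set (Z * nat))%type => f.
pose mk (W : set (Z * nat)) (a : 'I_d -> X) (i : 'I_d.+1) : X + set (Z * nat) :=
  if unlift ord0 i is Some j then inl (a j) else inr W.
have [z [h [hi hz]]] := infinite_fibre (fun W a => f (mk W a)).
have [K [Ki [c Kc]]] := IH z.
exists (fun i n => if unlift ord0 i is Some j then inl (K j n) else inr (h n)).
split=> [i n n' /=|].
  by case: unliftP => [j _|_]; [move=> [/Ki] | move=> [/hi]].
exists c => n; rewrite -(Kc (fun j => n (lift ord0 j))) -(hz (n ord0)).
by congr f; apply: funext => i; rewrite /mk; case: unliftP => [j ->|->].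
Qed.

Lemma homo_ltn_mono (h : nat -> nat) :
  {homo h : i j / i < j} -> {mono h : i j / i < j}.
Proof.
move=> hh i j; apply/idP/idP => [|/hh//].
case: (ltngtP i j) => // [/hh ji|->]; last by rewrite ltnn.
by rewrite ltnNge (ltnW ji).
Qed.

Lemma homo_ltn_inj (h : nat -> nat) :
  {homo h : i j / i < j} -> injective h.
Proof.
by move=> hh i j hij; case: (ltngtP i j) => // /hh; rewrite hij ltnn.
Qed.

Lemma ramsey (r : nat) (C : finType) (f : seq nat -> C) :
  exists h : nat -> nat, {homo h : i j / i < j} /\
   exists c, forall s, sorted ltn s -> size s = r -> f (map h s) = c.
Proof.
elim: r C f => [|r IH] C f.
  by exists id; split=> //; exists (f [::]) => -[].
have step (h : nat -> nat) : exists kc : (nat -> nat) * C, {homo kc.1 : i j / i < j} /\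
   forall s, sorted ltn s -> size s = r -> f (h 0 :: map (fun n => h (kc.1 n).+1) s) = kc.2.
  have [k [kh [c kc]]] := IH _ (fun s => f (h 0 :: map (fun n => h n.+1) s)).
  exists (k, c); split=> // s ss sr /=; rewrite -(kc s ss sr); congr (f (_ :: _)).
  by rewrite -map_comp.
have [st stP] := choice step.
(* [H n] is the n-th thinning and [a n] its first element. The colour of a set with minimum [a n]
   and its other elements among the later [a m] is [cc n]. *)
pose nxt h := fun n => h ((st h).1 n).+1.
pose H n := iter n nxt id.
have Hinc n : {homo H n : i j / i < j}.
  elim: n => [//|n ihn] i j ij /=; apply: ihn; rewrite ltnS.
  exact: (stP (H n)).1.
have Hle n m : exists2 k : nat -> nat, {homo k : i j / i < j} & H (n + m) = H n \o k.
  elim: m => [|m [k kh Hk]]; first by exists id; rewrite ?addn0.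
  exists (fun x => k ((st (H (n + m))).1 x).+1).
    by move=> i j ij; apply: kh; rewrite ltnS; apply: (stP _).1.
  by rewrite addnS -[H (n + m).+1]/(fun x => H (n + m) _) {1}Hk.
pose a n := H n 0.
have aS n m : n < m -> exists x, a m = nxt (H n) x.
  move=> nm; have [k _ Hk] := Hle n.+1 (m - n.+1).
  by exists (k 0); rewrite /a -[in LHS](subnKC nm) Hk.
have ainc : {homo a : i j / i < j}.
  by move=> n m /aS[x ->]; apply: Hinc.
pose cc n := (st (H n)).2.
have acc n s : sorted ltn (n :: s) -> size s = r -> f (map a (n :: s)) = cc n.
  move=> /= ns sr.
  have [x xP] : exists x, forall m, m \in s -> a m = nxt (H n) (x m).
    have : forall m, exists x, m \in s -> a m = nxt (H n) x.
      move=> m; have [ms|ms] := boolP (m \in s); last by exists 0.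
      have nm : n < m by apply: (allP (order_path_min ltn_trans ns)).
      by have [x xx] := aS _ _ nm; exists x.
    by move=> /choice[x xP]; exists x.
  have -> : map a s = map (nxt (H n)) (map x s).
    by rewrite -map_comp; apply/eq_in_map => m ms /=; apply: xP.
  rewrite [a n]/(H n 0) -[map (nxt (H n)) _]/(map (fun m => H n ((st (H n)).1 m).+1) _).
  apply: (stP (H n)).2; last by rewrite size_map.
  have : sorted ltn (map a s).
    by apply: (homo_sorted ainc); apply: path_sorted ns.
  have -> : map a s = map (nxt (H n)) (map x s).
    by rewrite -map_comp; apply/eq_in_map => m ms /=; apply: xP.
  rewrite [sorted ltn [seq nxt (H n) i | i <- _]]sorted_map; apply: sub_sorted => i j /=.
  rewrite homo_ltn_mono // => {}i {}j ij; apply: (Hinc n).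
  by rewrite ltnS; apply: (stP _).1.
have [v [g [gh gv]]] : exists v, exists g : nat -> nat,
    {homo g : i j / i < j} /\ forall n, cc (g n) = v.
  have [v vI] : exists v, infinite_set [set n | cc n = v].
    apply: contrapT => /forallNP nI; apply: infinite_nat.
    rewrite (_ : setT = \bigcup_(v in [set: C]) [set n | cc n = v]).
      apply: bigcup_finite => [|v _]; first exact: finite_finset.
      by apply: contrapT => /nI.
    by apply/seteqP; split=> // n _; exists (cc n).
  have nx n : exists m, n < m /\ cc m = v.
    apply: contrapT => H0; apply: vI; apply: (@sub_finite_set _ _ `I_n.+1).
      move=> m mv /=; rewrite ltnS leqNgt; apply/negP => nm.
      by apply: H0; exists m.
    exact: finite_II.
  have [u uP] := choice nx.
  exists v, (fun n => iter n.+1 u 0); split=> [i j ij|n]; last first.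
    by rewrite iterS (uP _).2.
  elim: j ij => // j ihj; rewrite ltnS leq_eqVlt => /orP[/eqP ->|/ihj ij].
    by rewrite [iter j.+2 _ _]iterS (uP _).1.
  by apply: (ltn_trans ij); rewrite [iter j.+2 _ _]iterS (uP _).1.
exists (a \o g); split=> [i j ij|]; first exact/ainc/gh.
exists v => -[//|n s] ss [sr].
rewrite map_comp /= -(gv n) -(@acc (g n) (map g s)) ?size_map //.
by rewrite -[_ :: _]/(map g (n :: s)); apply: (homo_sorted gh).
Qed.

Definition oiso (I : Type) (u u' : I -> nat) :=
  forall i j, (u i < u j) = (u' i < u' j).

Lemma oiso_eq (I : Type) (u u' : I -> nat) i j :
  oiso u u' -> u i = u j -> u' i = u' j.
Proof.
move=> uu ij; apply/eqP; rewrite eqn_leq (leqNgt (u' i)) (leqNgt (u' j)) -!uu ij.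
by rewrite ltnn.
Qed.

(** One index is kept for each value of [u], the one of least rank. Since [u] and [u'] have the same
    order and the same ties, one list serves both. *)
Lemma oiso_enum (I : finType) (u u' : I -> nat) : oiso u u' ->
  exists rs : seq I, [/\ sorted ltn (map u rs), sorted ltn (map u' rs), uniq rs &
   forall i, exists j, [/\ j \in rs, u j = u i & u' j = u' i]].
Proof.
move=> uu.
pose rep (w : I -> nat) i := [forall j, (w i == w j) ==> (enum_rank i <= enum_rank j)].
have eqE i j : (u i == u j) = (u' i == u' j).
  by rewrite !eqn_leq (leqNgt (u i)) (leqNgt (u j)) (leqNgt (u' i)) (leqNgt (u' j)) !uu.
pose rs w := sort (fun i j => w i <= w j) [seq i <- enum I | rep w i].
have rsE : rs u = rs u'.
  rewrite /rs (@eq_filter _ (rep u) (rep u')).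
    congr (sort _ _); apply: funext => i; apply: funext => j.
    by rewrite leqNgt uu -leqNgt.
  by move=> i; apply: eq_forallb => j; rewrite eqE.
have srt w : sorted ltn (map w (rs w)).
  have si : {in rs w &, injective w}.
    move=> i j; rewrite !mem_sort !mem_filter => /andP[/forallP ri _] /andP[/forallP rj _] ij.
    apply: enum_rank_inj; apply/val_inj/eqP; rewrite eqn_leq.
    by rewrite (implyP (ri j)) ?(implyP (rj i)) ?ij.
  rewrite ltn_sorted_uniq_leq map_inj_in_uniq //.
  rewrite sort_uniq filter_uniq ?enum_uniq //= sorted_map.
  by apply: sort_sorted => i j; exact: leq_total.
exists (rs u); split=> //; first by rewrite rsE.
  by rewrite sort_uniq filter_uniq ?enum_uniq.
move=> i; pose j := [arg min_(j < i | u j == u i) enum_rank j].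
exists j; rewrite /j; case: arg_minnP => // j' /eqP ji jm; split=> //.
  rewrite mem_sort mem_filter mem_enum andbT; apply/forallP => k.
  by apply/implyP => /eqP jk; apply: jm; rewrite -jk ji.
exact: (oiso_eq uu ji).
Qed.

(** Ramsey's theorem for sets of size [#|I|], the colour of a set being the values of [f] at all
    maps of [I] into it. *)
Lemma ramsey_family (I C : finType) (f : (I -> nat) -> C) :
  exists h : nat -> nat, {homo h : i j / i < j} /\
    forall u u', oiso u u' -> f (h \o u) = f (h \o u').
Proof.
have [h [hh [c hc]]] := @ramsey #|I| _
  (fun s => [ffun a : {ffun I -> 'I_#|I|} => f (fun i => nth 0 s (a i))]).
exists h; split=> // u u' /oiso_enum[rs [su su' uq rsP]].
have rs_sz : size rs <= #|I| by rewrite -(card_uniqP uq) max_card.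
have ix i : exists a : 'I_#|I|, exists j, [/\ onth rs a = Some j, u j = u i & u' j = u' i].
  have [j [jrs ju ju']] := rsP i.
  have jI : index j rs < #|I| by apply: leq_trans rs_sz; rewrite index_mem.
  by exists (Ordinal jI), j; rewrite /= onthE (nth_map j) ?index_mem ?nth_index.
have [a aP] := choice ix.
(* A map with repeated values has fewer than [#|I|] values; larger numbers fill up the set. *)
pose pad (w : I -> nat) := iota (\max_i w i).+1 (#|I| - size rs).
pose S w := map w rs ++ pad w.
have szS w : size (S w) = #|I| by rewrite size_cat size_map size_iota subnKC.
have srtS w : sorted ltn (map w rs) -> sorted ltn (S w).
  move=> sw; rewrite (sorted_pairwise ltn_trans) pairwise_cat -!(sorted_pairwise ltn_trans).
  rewrite sw iota_ltn_sorted !andbT; apply/allrelP => _ y /mapP[i _ ->].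
  by rewrite mem_iota => /andP[+ _]; apply: leq_trans; rewrite ltnS; apply: leq_bigmax.
have fE w : (forall i j, onth rs (a i) = Some j -> w j = w i) ->
    f (h \o w) = [ffun a : {ffun I -> 'I_#|I|} => f (fun i => nth 0 (map h (S w)) (a i))] (finfun a).
  move=> wP; rewrite ffunE; congr f; apply: funext => i /=; rewrite ffunE.
  have [j [ja _ _]] := aP i.
  have ai : a i < size rs by rewrite -onthTE ja.
  rewrite (nth_map 0) ?szS // nth_cat size_map ai (nth_map j) //.
  by rewrite (onth_nth _ _ _ _ ja) (wP _ _ ja).
rewrite !fE.
- by rewrite (hc (S u)) ?szS ?srtS // -(hc (S u')) ?szS ?srtS.
- by move=> i j ja; have [j' []] := aP i; rewrite ja => -[<-].
- by move=> i j ja; have [j' []] := aP i; rewrite ja => -[<-].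
Qed.

(** * The Halpern-Lauchli theorem with kills *)

(** Coordinate i lives in the interval from i * B to (i + 1) * B, which fixes the order between
    different coordinates. *)
Lemma oiso_block (I : Type) d B (s s' : 'I_d * I -> nat) :
  (forall u, s u < B) -> (forall u, s' u < B) ->
  (forall i b b', (s (i, b) < s (i, b')) = (s' (i, b) < s' (i, b'))) ->
  oiso (fun u : 'I_d * I => u.1 * B + s u) (fun u : 'I_d * I => u.1 * B + s' u).
Proof.
move=> sB s'B ss [i b] [j b'] /=.
have lt (t t' : 'I_d * I -> nat) (k k' : 'I_d) c c' : (forall u, t u < B) -> k < k' ->
    k * B + t (k, c) < k' * B + t' (k', c').
  move=> tB kk; apply: (@leq_trans (k.+1 * B)).
    by rewrite mulSn addnC ltn_add2r.
  by apply: leq_trans (leq_addr _ _); rewrite leq_mul2r kk orbT.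
have nlt (t t' : 'I_d * I -> nat) (k k' : 'I_d) c c' : (forall u, t u < B) -> k < k' ->
    (k' * B + t' (k', c') < k * B + t (k, c)) = false.
  by move=> tB kk; apply/negbTE; rewrite -leqNgt ltnW // lt.
have [ij|ji|/val_inj ij] := ltngtP i j.
- by rewrite !lt.
- by rewrite !nlt.
- by rewrite ij !ltn_add2l ss.
Qed.

Section HL.
Variables (E : finType) (e0 : E) (Pat : Type).
Variables (sup : Pat -> nat -> Prop) (dead : Pat -> (nat -> seq E) -> Prop).

Definition safe_ext (J : Type) (l l' : nat) (z z' : J -> seq E) :=
  [/\ forall j, size (z j) = l, forall j, size (z' j) = l', l <= l',
      forall j, prefix (z j) (z' j) &
      forall π (b : nat -> J), dead π (z' \o b) -> dead π (z \o b)].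

Hypothesis dead_sup : forall π x x', (forall b, sup π b -> x b = x' b) ->
  dead π x -> dead π x'.
(** This is what makes conditions amalgamate: where they do not prescribe a word, padding by blanks
    is safe. *)
Hypothesis dead_blank : forall π l l' x x', l <= l' ->
  (forall b, sup π b -> size (x b) = l /\ size (x' b) = l') ->
  (forall b, sup π b -> prefix (x b) (x' b)) ->
  (exists2 b, sup π b & x' b = x b ++ nseq (l' - l) e0) ->
  dead π x' -> dead π x.

(** * Finite conditions and decisions about colours *)

Section Forcing.
Variables (V : eqType).

Record cond := Cond { dm : seq V; wd : V -> seq E; lv : nat }.

Definition valid p := uniq (dm p) /\ forall v, v \in dm p -> size (wd p v) = lv p.

Definition stronger q p := [/\ {subset dm p <= dm q}, lv p <= lv q,
  forall v, v \in dm p -> prefix (wd p v) (wd q v) &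
  forall π (b : nat -> V), (forall n, b n \in dm p) ->
    dead π (wd q \o b) -> dead π (wd p \o b)].

Lemma stronger_refl p : stronger p p.
Proof. by split=> // v _; exact: prefix_refl. Qed.

Lemma stronger_trans q p r : stronger q p -> stronger r q -> stronger r p.
Proof.
move=> [d1 l1 p1 k1] [d2 l2 p2 k2]; split.
- by move=> v /d1/d2.
- exact: leq_trans l1 l2.
- move=> v vp; exact: prefix_trans (p1 _ vp) (p2 _ (d1 _ vp)).
- by move=> π b bp /k2 h; apply: k1 => //; apply: h => n; apply: d1.
Qed.

Variables (I C : finType) (c : (I -> seq E) -> C).

Let triple := (cond * (I -> V) * C)%type.

Definition realizes r (t : triple) := c (fun i => wd r (t.1.2 i)) = t.2.

Definition below q (L : seq triple) := forall t, List.In t L -> stronger q t.1.1.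

(** A triple (q, α, ε) is read as the decision that below q the words at α get colour ε. Coherence
    says that finitely many decisions can be honoured at once, below any condition under theirs. *)
Definition coherent (Θ : set triple) := forall L : seq triple,
  (forall t, List.In t L -> Θ t) -> forall q, valid q -> below q L ->
  exists r, [/\ valid r, stronger r q & forall t, List.In t L -> realizes r t].

(* A maximal coherent set of decisions plays the role of a generic filter. *)
Lemma max_coherent : exists Θ, coherent Θ /\
  forall t, coherent (Θ `|` [set t]) -> Θ t.
Proof.
have [|Θ [cΘ mΘ]] := @Zorn_bigcup triple coherent.
  move=> F Fc tot L LF q vq bq.
  have [[Θ FΘ LΘ]|L0] : (exists2 Θ, F Θ & forall t, List.In t L -> Θ t) \/ L = [::].
    elim: L LF {bq} => [|t L IH] LF; [by right|left].
    have [Θ1 FΘ1 tΘ1] := LF t (or_introl erefl).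
    have [|[Θ2 FΘ2 LΘ2]|->] := IH; first by move=> t' t'L; apply: LF; right.
      have [sub|sub] := tot _ _ FΘ1 FΘ2.
        exists Θ2 => // t' [<-|]; [exact: sub|exact: LΘ2].
      by exists Θ1 => // t' [<-//|/LΘ2/sub].
    by exists Θ1 => // t' [<-|].
  - exact: (Fc _ FΘ L).
  - exists q; split=> //; first exact: stronger_refl.
    by rewrite L0.
exists Θ; split=> // t ct; apply: contrapT => nt.
apply: (mΘ _ _ ct); split; first by move=> u; left.
by move=> /(_ t (or_intror erefl)).
Qed.

(** If nothing below [p] decided the colour at [α], maximality would refuse every colour in turn.
    The refusals add up to a condition and a finite list of decisions that exclude all colours,
    against coherence. *)
Lemma coherent_dense Θ : coherent Θ ->
  (forall t, coherent (Θ `|` [set t]) -> Θ t) ->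
  forall (α : I -> V) p, valid p ->
  exists q ε, [/\ valid q, stronger q p & Θ (q, α, ε)].
Proof.
move=> cΘ mΘ α p vp; apply: contrapT => nq.
have H (cs : seq C) : exists q L, [/\ valid q, stronger q p,
    forall t, List.In t L -> Θ t, below q L &
    forall r, valid r -> stronger r q -> (forall t, List.In t L -> realizes r t) ->
      c (fun i => wd r (α i)) \notin cs].
  elim: cs => [|ε cs [q [L [vq qp LΘ bq av]]]].
    by exists p, [::]; split=> //; exact: stronger_refl.
  have nΘ : ~ Θ (q, α, ε) by move=> h; apply: nq; exists q, ε.
  have : ~ coherent (Θ `|` [set (q, α, ε)]) by move=> /mΘ.
  move=> /existsNP[L'] /not_implyP[L'Θ] /existsNP[q'] /not_implyP[vq'].
  move=> /not_implyP[bq' no].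
  have qL' : List.In (q, α, ε) L'.
    apply: contrapT => h; apply: no; apply: cΘ => // t tL'.
    by have [//|tE] := L'Θ t tL'; move: tL'; rewrite tE.
  have qq : stronger q' q by exact: (bq' _ qL').
  exists q', (L ++ [seq t <- L' | `[< Θ t >]]); split=> //.
  - exact: stronger_trans qp qq.
  - move=> t /List.in_app_iff[/LΘ//|/List.filter_In[_ /asboolP//]].
  - move=> t /List.in_app_iff[/bq h|/List.filter_In[/bq'//]].
    exact: stronger_trans h qq.
  - move=> r vr rq rL; rewrite inE negb_or; apply/andP; split; last first.
      apply: av => //; first exact: stronger_trans qq rq.
      by move=> t tL; apply: rL; apply/List.in_app_iff; left.
    apply/eqP => cε; apply: no; exists r; split=> // t tL'.
    have [tΘ|->//] := L'Θ t tL'.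
    apply: rL; apply/List.in_app_iff; right; apply/List.filter_In.
    by split=> //; apply/asboolP.
have [q [L [vq _ LΘ bq av]]] := H (enum C).
have [r [vr rq rL]] := cΘ L LΘ q vq bq.
by have := av r vr rq rL; rewrite mem_enum.
Qed.

End Forcing.

(* Harrington's argument: nodes are indexed by X, so large that polarized and
   Ramsey's theorem make the conditions deciding the colours compatible. *)
Theorem halpern_lauchli d (C : finType) (l : nat) (x : 'I_d -> seq E)
    (c : ('I_d -> seq E) -> C) : (forall i, size (x i) = l) ->
  exists lx (x' : 'I_d -> seq E) ε, safe_ext l lx x x' /\
  forall (J : finType) (lab : J -> 'I_d) lz (z : J -> seq E), lx <= lz ->
    (forall j, size (z j) = lz) -> (forall j, prefix (x' (lab j)) (z j)) ->
  exists lz' (z' : J -> seq E), safe_ext lz lz' z z' /\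
  forall g : 'I_d -> J, (forall i, lab (g i) = i) -> safe_ext lx lz x' (z \o g) ->
    c (z' \o g) = ε.
Proof.
move=> xl; have [X0 XP] := polarized d.
pose X : Type := {classic X0}; pose V : eqType := ('I_d * {classic X0})%type.
have [Θ [cΘ mΘ]] := @max_coherent V _ _ c.
pose node (α : 'I_d -> X) i : V := (i, α i).
have node_inj α : injective (node α) by move=> i j [].
pose base α : cond V := Cond [seq node α i | i <- enum 'I_d]
  (fun v => x v.1) l.
have vbase α : valid (base α).
  split; first by rewrite map_inj_uniq ?enum_uniq.
  by move=> v /mapP[i _ ->]; exact: xl.
have dns α : exists qe : cond V * C,
    [/\ valid qe.1, stronger qe.1 (base α) & Θ (qe.1, node α, qe.2)].
  have [q [ε [vq qb qΘ]]] := coherent_dense cΘ mΘ (node α) (vbase α).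
  by exists (q, ε).
have {}[P PP] := choice dns.
pose p α := (P α).1.
(* The data of a condition without the names of its indices: colour, level and words in the order of
   the domain. There are countably many such data, so they can be made constant on a product. *)
pose dat α := ((P α).2, lv (p α), [seq wd (p α) v | v <- dm (p α)],
   [ffun i => wd (p α) (node α i)]).
have [K [Ki [k0 Kc]]] := XP (fun α => pickle (dat α)).
have datE n n' : dat (fun i => K i (n i)) = dat (fun i => K i (n' i)).
  by apply: (pcan_inj (@pickleK _)); rewrite !Kc.
pose α0 := (fun i => K i 0).
pose N := size (dm (p α0)).
pose at_ (n : 'I_d -> nat) k := onth (dm (p (fun i => K i (n i)))) k.
pose sel (b : bool) (n : 'I_d * bool -> nat) i := n (i, b).
(* What [dat] forgets: which entries of two domains coincide, and which entries are prescribed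
   nodes. After thinning by [h] this depends only on the relative order of the two index tuples. *)
pose f n := ([ffun kk : 'I_N * 'I_N => at_ (sel false n) kk.1 == at_ (sel true n) kk.2],
  [ffun ki : 'I_N * 'I_d => at_ (sel false n) ki.1 == Some ((ki.2, K ki.2 (sel true n ki.2)) : V)]).
have [h [hh hf]] := ramsey_family f.
pose KK i n := K i (h n).
have KKi i : injective (KK i).
  by move=> n n' /Ki /(homo_ltn_inj hh).
pose pp n := p (fun i => KK i (n i)).
have vpp n : valid (pp n) by have [] := PP (fun i => KK i (n i)).
have szN n : size (dm (pp n)) = N.
  have := datE (fun i => h (n i)) (fun=> 0); rewrite /dat => -[_ _ /(congr1 size) + _].
  by rewrite !size_map.
have hom n1 n2 n1' n2' : oiso (fun u : 'I_d * bool => if u.2 then n2 u.1 else n1 u.1)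
      (fun u => if u.2 then n2' u.1 else n1' u.1) ->
    (forall k k', k < N -> k' < N -> onth (dm (pp n1)) k = onth (dm (pp n2)) k' ->
      onth (dm (pp n1')) k = onth (dm (pp n2')) k') /\
    (forall k i, k < N -> onth (dm (pp n1)) k = Some ((i, KK i (n2 i)) : V) ->
      onth (dm (pp n1')) k = Some ((i, KK i (n2' i)) : V)).
  move=> /hf; rewrite /f /= => -[/ffunP fE /ffunP fH]; split.
    move=> k k' kN kN' /eqP kk; apply/eqP.
    by have := fE (Ordinal kN, Ordinal kN'); rewrite !ffunE /= => <-.
  move=> k i kN /eqP kk; apply/eqP.
  by have := fH (Ordinal kN, i); rewrite !ffunE /= => <-.
have onth_lt n k v : onth (dm (pp n)) k = Some v -> k < N.
  by move=> kv; rewrite -(szN n) -onthTE kv.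
pose blk B (a : 'I_d -> nat) (i : 'I_d) := i * B + a i.
have hom_blk B a1 a2 a1' a2' : (forall i, a1 i < B) -> (forall i, a2 i < B) ->
    (forall i, a1' i < B) -> (forall i, a2' i < B) ->
    (forall i, (a1 i < a2 i) = (a1' i < a2' i)) ->
    (forall i, (a2 i < a1 i) = (a2' i < a1' i)) ->
    oiso (fun u : 'I_d * bool => if u.2 then blk B a2 u.1 else blk B a1 u.1)
         (fun u => if u.2 then blk B a2' u.1 else blk B a1' u.1).
  move=> h1 h2 h1' h2' lt gt.
  have := @oiso_block bool d B (fun u => if u.2 then a2 u.1 else a1 u.1)
    (fun u => if u.2 then a2' u.1 else a1' u.1).
  move=> H u v; have HE := H _ _ _ u v; case: u v HE => i [] [j []] /= HE;
    by apply: HE => [[? []]|[? []]|k [] []] //=; rewrite ?ltnn.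
(* An intermediate tuple with the same order pattern towards both sides shows
   that a common element has the same index in both enumerations. *)
have same_pos B a1 a2 k k' v : (forall i, a1 i < B) -> (forall i, a2 i < B) ->
    (forall i, ~~ odd (a1 i)) -> (forall i, ~~ odd (a2 i)) ->
    onth (dm (pp (blk B a1))) k = Some v -> onth (dm (pp (blk B a2))) k' = Some v -> k = k'.
  move=> h1 h2 o1 o2 kv kv'.
  have kN := onth_lt _ _ _ kv; have kN' := onth_lt _ _ _ kv'.
  pose g i := if a1 i < a2 i then (a1 i).+1 else if a2 i < a1 i then (a2 i).+1 else a1 i.
  have oS a b : ~~ odd a -> ~~ odd b -> (a < b) = (a.+1 < b).
    move=> oa ob; rewrite leq_eqVlt; case: eqP => [ab|//].
    by move: ob; rewrite -ab /= oa.
  have o12 i := oS _ _ (o1 i) (o2 i); have o21 i := oS _ _ (o2 i) (o1 i).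
  have h3 i : g i < B.
    by rewrite /g; move: (o12 i) (o21 i) (h1 i) (h2 i); case: (ltngtP (a1 i)); lia.
  have E1 : onth (dm (pp (blk B a1))) k = onth (dm (pp (blk B g))) k'.
    apply: (hom (blk B a1) (blk B a2) (blk B a1) (blk B g) _).1; rewrite ?kv ?kv' //.
    by apply: hom_blk => // i; rewrite /g; move: (o12 i) (o21 i); case: (ltngtP (a1 i)); lia.
  have E2 : onth (dm (pp (blk B g))) k = onth (dm (pp (blk B a2))) k'.
    apply: (hom (blk B a1) (blk B a2) (blk B g) (blk B a2) _).1; rewrite ?kv ?kv' //.
    by apply: hom_blk => // i; rewrite /g; move: (o12 i) (o21 i); case: (ltngtP (a1 i)); lia.
  have [ug _] := vpp (blk B g).
  apply/eqP; rewrite -(nth_uniq v _ _ ug) ?szN //.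
  by rewrite !(onth_nth _ v) // ?E2 -?E1.
(* An element that is hit accidentally would also be hit after shifting b to
   the odd number b + 1. *)
have hit B a k (i : 'I_d) b : (forall i, a i < B) -> b.+1 < B -> (forall i, ~~ odd (a i)) -> ~~ odd b ->
    onth (dm (pp (blk B a))) k = Some ((i, KK i (i * B + b)) : V) -> b = a i.
  move=> aB bB oa ob kv; have kN := onth_lt _ _ _ kv.
  apply/eqP/negP => /negP ba.
  pose a2 b i' := if i' == i then b else a i'.
  have a2B b' i' : b' < B -> a2 b' i' < B by rewrite /a2; case: eqP.
  have := (hom (blk B a) (blk B (a2 b)) (blk B a) (blk B (a2 b.+1)) _).2 k i kN.
  have bi b' : blk B (a2 b') i = i * B + b' by rewrite /blk /a2 eqxx.
  rewrite !bi kv; set O := (X in (X -> _) -> _); have HO : O.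
    have bnb i' : (a2 b i' = a i' /\ a2 b.+1 i' = a i') \/
        [/\ i' = i, a2 b i' = b & a2 b.+1 i' = b.+1].
      by rewrite /a2; case: eqP => [->|]; [right|left].
    have ob' : b.+1 != a i by apply/eqP => bE; have := oa i; rewrite -bE /= ob.
    apply: hom_blk => // i'; try by apply: a2B => //; exact: ltnW.
      case: (bnb i') => [[-> ->//]|[-> -> ->]].
      by move: ba; lia.
    case: (bnb i') => [[-> ->//]|[-> -> ->]].
    by move: ob'; lia.
  move=> /(_ HO erefl) [] /KKi /eqP.
  by rewrite eqn_add2l eqn_leq ltnn andbF.
pose lx := lv (p α0); pose x' i := wd (p α0) (node α0 i).
have lvE n : lv (pp n) = lx by have := datE (fun i => h (n i)) (fun=> 0); rewrite /dat => -[].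
have epsE n : (P (fun i => KK i (n i))).2 = (P α0).2.
  by have := datE (fun i => h (n i)) (fun=> 0); rewrite /dat => -[].
have x'E n i : wd (pp n) ((i, KK i (n i)) : V) = x' i.
  have := datE (fun i => h (n i)) (fun=> 0); rewrite /dat => -[_ _ _ /ffunP /(_ i)].
  by rewrite !ffunE.
have wdE n n' k v : onth (dm (pp n)) k = Some v -> onth (dm (pp n')) k = Some v ->
    wd (pp n) v = wd (pp n') v.
  move=> kv kv'; have := datE (fun i => h (n i)) (fun i => h (n' i)).
  rewrite /dat => -[_ _ /(congr1 (fun s => onth s k)) + _].
  by rewrite !onth_map kv kv' => -[].
exists lx, x', (P α0).2; split.
  have [vq [dq lq pq kq] _] := PP α0; split=> // [i|i|π b].
  - by apply: vq.2; apply/dq/map_f; rewrite mem_enum.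
  - by apply: (pq (node α0 i)); apply: map_f; rewrite mem_enum.
  - move=> /(kq π (node α0 \o b)); apply=> n /=.
    by apply: map_f; rewrite mem_enum.
move=> J lab lz z lxz zl zx'.
pose B := (2 * #|J|).+2.
(* Even numbers, because [same_pos] and [hit] need the odd ones for their intermediate tuples. *)
pose num (j : J) := 2 * enum_rank j.
have numB j : (num j).+1 < B by rewrite /num /B !ltnS leq_mul2l ltnW.
have numo j : ~~ odd (num j) by rewrite /num oddM.
pose nodeJ (j : J) : V := (lab j, KK (lab j) (lab j * B + num j)).
have nodeJ_inj : injective nodeJ.
  move=> j j' [ll]; rewrite ll => /KKi /eqP; rewrite eqn_add2l /num eqn_mul2l /=.
  by move=> /eqP/val_inj/enum_rank_inj.
pose D (g : {ffun 'I_d -> J}) :=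
  (forall i, lab (g i) = i) /\ safe_ext lx lz x' (z \o g).
pose pg (g : {ffun 'I_d -> J}) := pp (blk B (fun i => num (g i))).
(* The common strengthening: the given words at the nodes of [J], and elsewhere the word of any
   condition containing the index, padded by blanks. By [same_pos] all these conditions give the
   same word. *)
pose wq v := if [pick j | nodeJ j == v] is Some j then z j else
  if [pick g | `[< D g >] && (v \in dm (pg g))] is Some g
  then wd (pg g) v ++ nseq (lz - lx) e0 else [::].
pose q := Cond (undup (map nodeJ (enum J) ++
  flatten [seq dm (pg g) | g <- enum {: {ffun 'I_d -> J}} & `[< D g >]])) wq lz.
have wqJ j : wq (nodeJ j) = z j.
  rewrite /wq; case: pickP => [j' /eqP/nodeJ_inj -> //|/(_ j)].
  by rewrite eqxx.
have wqE g v : D g -> v \in dm (pg g) -> (forall j, nodeJ j <> v) ->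
    wq v = wd (pg g) v ++ nseq (lz - lx) e0.
  move=> Dg vg vJ; rewrite /wq; case: pickP => [j /eqP /vJ //|_].
  case: pickP => [g' /andP[_ vg']|/(_ g)]; last by rewrite vg andbT asboolT.
  congr (_ ++ _); have /onthP[k kv] := vg; have /onthP[k' kv'] := vg'.
  have kk : k = k'.
    by apply: (same_pos B _ _ _ _ _ _ _ _ _ kv kv') => i //; exact: ltnW.
  by apply: (wdE _ _ k); rewrite // kk.
have hitJ g j : D g -> nodeJ j \in dm (pg g) -> g (lab j) = j.
  move=> [gl _] /onthP[k kj].
  have /eqP := hit B _ k (lab j) (num j) (fun i => ltnW (numB _)) (numB _) (fun i => numo _) (numo _) kj.
  by rewrite /num eqn_mul2l /= => /eqP/val_inj/enum_rank_inj <-.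
have wpg g i : D g -> wd (pg g) (nodeJ (g i)) = x' i.
  by move=> [gl _]; rewrite -(x'E (blk B (fun i => num (g i)))) /nodeJ gl.
have vq : valid q.
  split=> [|v]; first exact: undup_uniq.
  rewrite mem_undup mem_cat => vD /=.
  have [[j <-]|vJ] := pselect (exists j, nodeJ j = v); first by rewrite wqJ.
  case/orP: vD => [/mapP[j _ vj]|/flatten_mapP[g]]; first by case: vJ; exists j.
  rewrite mem_filter => /andP[/asboolP Dg _] vg.
  rewrite (wqE g) // => [|j jv]; last by apply: vJ; exists j.
  by rewrite size_cat size_nseq (vpp _).2 // lvE subnKC.
have qg g : D g -> stronger q (pg g).
  move=> Dg; have [gl [_ _ _ _ gk]] := Dg; split.
  - move=> v vg; rewrite mem_undup mem_cat; apply/orP; right.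
    by apply/flatten_mapP; exists g => //; rewrite mem_filter mem_enum andbT; apply/asboolP.
  - by rewrite lvE.
  - move=> v vg /=; have [[j jv]|vJ] := pselect (exists j, nodeJ j = v).
      by rewrite -jv wqJ -(hitJ g j) ?jv // wpg // -{1}(gl (lab j)) zx'.
    rewrite (wqE g) ?prefix_prefix // => j jv; apply: vJ; by exists j.
  - move=> π b bg /= dq.
    (* Either all words of the pattern come from the family, and the safety of [g] applies, or one
       of them has only been padded. *)
    have [bJ|] := pselect (forall n, sup π n -> exists j, nodeJ j = b n).
      have bE n : sup π n -> b n = nodeJ (g (b n).1).
        by move=> /bJ[j jb]; rewrite -jb /= hitJ // jb.
      have : dead π ((z \o g) \o (fun n => (b n).1)).
        by apply: dead_sup dq => n sn /=; rewrite bE //= wqJ gl.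
      move=> /gk; apply: dead_sup => n sn /=.
      by rewrite [in RHS]bE // wpg.
    move=> /existsNP[n /not_implyP[sn nJ]].
    apply: (@dead_blank π lx lz _ (wq \o b)) => //=.
    + move=> m sm; split; first by rewrite (vpp _).2 ?lvE.
      by apply: vq.2; rewrite mem_undup mem_cat; apply/orP; right;
        apply/flatten_mapP; exists g => //; rewrite mem_filter mem_enum andbT; apply/asboolP.
    + move=> m sm; have [[j jv]|vJ] := pselect (exists j, nodeJ j = b m).
        by rewrite -jv wqJ -(hitJ g j) ?jv // wpg // -{1}(gl (lab j)) zx'.
      rewrite (wqE g) ?prefix_prefix // => j jv; apply: vJ; by exists j.
    + exists n => //; rewrite (wqE g) // => j jv; apply: nJ; by exists j.
pose tr (g : {ffun 'I_d -> J}) := ((pg g, fun i => nodeJ (g i)), (P α0).2).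
pose L := [seq tr g | g <- enum {: {ffun 'I_d -> J}} & `[< D g >]].
have LP t : List.In t L -> exists2 g, D g & t = tr g.
  move=> /List.in_map_iff[g [<- /List.filter_In[_ /asboolP Dg]]].
  by exists g.
have [|t /LP[g Dg ->]|r [vr [rd rl rp rk] rL]] := cΘ L _ q vq.
- move=> t /LP[g Dg ->]; have [_ _] := PP (fun i => KK i (blk B (fun i => num (g i)) i)).
  rewrite epsE /tr; congr (Θ (_, _, _)); apply: funext => i.
  by rewrite /node /nodeJ Dg.1.
- exact: qg.
have Jq j : nodeJ j \in dm q.
  by rewrite mem_undup mem_cat map_f // mem_enum.
exists (lv r), (fun j => wd r (nodeJ j)); split.
  split=> // [j|j|π b].
  - by rewrite vr.2 // rd.
  - by rewrite -wqJ; apply: rp.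
  - move=> /(rk π (nodeJ \o b) (fun n => Jq _)) /=.
    by apply: dead_sup => n _ /=; rewrite wqJ.
move=> g gl gs.
have Dg : D (finfun g).
  split=> [i|]; first by rewrite ffunE.
  by rewrite (_ : z \o finfun g = z \o g) //; apply: funext => i /=; rewrite ffunE.
have /rL : List.In (tr (finfun g)) L.
  apply/List.in_map_iff; exists (finfun g); split=> //; apply/List.filter_In.
  split; last exact/asboolP.
  by elim: (enum _) (mem_enum predT (finfun g)) => // a s IH; rewrite inE => /orP[/eqP->|/IH]; [left|right].
rewrite /realizes /= => <-; congr c; apply: funext => i /=.
by rewrite ffunE.
Qed.
End HL.

(** * Words, kills and self-maps of the tree *)

Definition letter kk N (PF : finType) :=
  ('I_kk.+1 * {set PF * {set 'I_N.+1} * 'I_N.+1})%type.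

(* A position p with kind p = Some (cw, ν) may carry a vertex of label ν, whose
   relations to the earlier vertices are listed in cw; at the other positions a
   letter lists the patterns that it kills (second component), or only splits
   words (first component). *)
Record coding := Coding {
  rels : nat;
  pts : nat;
  pat : finType;
  dom : pat -> {set 'I_pts.+1};
  ulab : pat -> 'I_pts.+1 -> nat;
  rlab : pat -> 'I_pts.+1 -> 'I_pts.+1 -> 'I_rels.+1;
  kind : nat -> option (seq (letter rels pts pat) * nat);
  irr : forall A b b', b \in dom A -> b' \in dom A -> b != b' ->
    rlab A b b' != ord0;
  kind_size : forall p cw ν, kind p = Some (cw, ν) -> size cw <= p;
  kind_even : forall p, ~~ odd p -> kind p = None;
  kind_coder : forall s ν n, exists2 p, n <= p & kind p = Some (s, ν) }.

Section Kills.
Variable Y : coding.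
Local Notation PF := (pat Y).
Local Notation Pt := 'I_(pts Y).+1.
Local Notation letter := (letter (rels Y) (pts Y) (pat Y)).
Local Notation dA := (@dom Y).
Local Notation UA := (@ulab Y).
Local Notation RA := (@rlab Y).
Local Notation kind := (@kind Y).
Local Notation irr := (@irr Y).

Definition word := seq letter.
Definition blank : letter := (ord0, finset.set0).
Definition at_ (w : word) p := nth blank w p.

(** The word of the vertex at [p]: its code filled up to length [p], so that its letters at earlier
    vertices are its relations to them. *)
Definition dn p : word :=
  if kind p is Some (cw, _) then cw ++ nseq (p - size cw) blank else [::].

Implicit Types (S : {set Pt}) (x : Pt -> word) (A : PF) (w cw : word).

Definition upd (x : Pt -> word) b0 w b := if b == b0 then w else x b.

(* Dead A S x: the points of A outside S are realized already, relative to the words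
   x b for b in S, so that vertices extending these words must not form a copy of the
   rest of A. Dead_rel lets a vertex of code cw realize b0. *)
Inductive Dead (A : PF) : {set Pt} -> (Pt -> word) -> Prop :=
| Dead_full x : Dead A (dA A) x
| Dead_abs S x p : kind p = None ->
    (forall b, b \in S -> ((A, S, b) : PF * {set Pt} * Pt) \in (at_ (x b) p).2) -> Dead A S x
| Dead_rel S x p cw ν b0 : kind p = Some (cw, ν) -> S \subset dA A ->
    b0 \in dA A -> b0 \notin S -> UA A b0 = ν ->
    (forall b, b \in S -> (at_ (x b) p).1 = RA A b0 b) ->
    Dead A (b0 |: S) (upd x b0 cw) -> Dead A S x.

Lemma at_blank w p : size w <= p -> at_ w p = blank.
Proof. exact: nth_default. Qed.

Lemma at_cat_blank w j p : at_ (w ++ nseq j blank) p = at_ w p.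
Proof.
rewrite /at_ nth_cat; case: ltnP => // wp.
by rewrite nth_nseq if_same nth_default.
Qed.

Lemma at_prefix w w' p : prefix w w' -> p < size w -> at_ w' p = at_ w p.
Proof. by move=> /prefixP[u ->] pw; rewrite /at_ nth_cat pw. Qed.

Lemma size_dn p cw ν : kind p = Some (cw, ν) -> size (dn p) = p.
Proof.
by move=> kp; rewrite /dn kp size_cat size_nseq subnKC // (kind_size kp).
Qed.

Lemma dnE p cw ν : kind p = Some (cw, ν) -> dn p = cw ++ nseq (p - size cw) blank.
Proof. by rewrite /dn => ->. Qed.

Lemma at_dn p cw ν q : kind p = Some (cw, ν) -> at_ (dn p) q = at_ cw q.
Proof. by move=> kp; rewrite /dn kp at_cat_blank. Qed.

(** [Dead_abs] holds vacuously at position 0, which carries no vertex. The empty set is therefore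
    set aside whenever a witness in [S] is wanted. *)
Lemma Dead_set0 A x : Dead A finset.set0 x.
Proof. by apply: (@Dead_abs A _ x 0) => [|b]; rewrite ?kind_even // inE. Qed.

Lemma rel_nblank A S x p b0 b : S \subset dA A -> b0 \in dA A -> b0 \notin S ->
  b \in S -> (at_ (x b) p).1 = RA A b0 b -> at_ (x b) p != blank.
Proof.
move=> SA b0A b0S bS rE; apply: contraNneq (@irr A b0 b b0A (fintype.subsetP SA _ bS) _).
  by move=> xb; rewrite -rE xb.
by apply: contraNneq b0S => ->.
Qed.

(** A derivation reads only letters that are not blank: those listing a kill, and those with a label
    that is nonzero by irreducibility. *)
Lemma Dead_mono A S x x' :
  (forall b p, b \in S -> at_ (x b) p != blank -> at_ (x' b) p = at_ (x b) p) ->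
  Dead A S x -> Dead A S x'.
Proof.
move=> xx' D; elim: D x' xx' => {S x} [x|S x p kp ro|S x p cw ν b0 kp SA b0A b0S u ro _ IH] x' xx'.
- exact: Dead_full.
- apply: (Dead_abs kp) => b bS; rewrite xx' ?ro //.
  by apply/eqP => xb; have := ro b bS; rewrite xb inE.
- apply: (Dead_rel kp SA b0A b0S u) => [b bS|].
    by rewrite xx' ?ro // (rel_nblank SA b0A b0S bS (ro b bS)).
  apply: IH => b q; rewrite /upd !inE; case: eqP => //= _ bS; exact: xx'.
Qed.

Lemma Dead_eq A S x x' : (forall b p, b \in S -> at_ (x b) p = at_ (x' b) p) ->
  Dead A S x -> Dead A S x'.
Proof. by move=> xx'; apply: Dead_mono => b p bS _; rewrite xx'. Qed.

Lemma Dead_prefix A S x x' : (forall b, b \in S -> prefix (x b) (x' b)) ->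
  Dead A S x -> Dead A S x'.
Proof.
move=> xx'; apply: Dead_mono => b p bS xb; rewrite (at_prefix (xx' b bS)) //.
by rewrite ltnNge; apply: contraNN xb => /at_blank ->.
Qed.

(* Irreducibility is what makes a coordinate that stays blank harmless. *)
Lemma Dead_blank l A S x x' :
  (forall b p, b \in S -> p < l -> at_ (x b) p = at_ (x' b) p) ->
  (exists2 b, b \in S & forall p, l <= p -> at_ (x' b) p = blank) ->
  Dead A S x' -> Dead A S x.
Proof.
move=> xx' xb D; elim: D x xx' xb => {S x'} [x'|S x' p kp ro|S x' p cw ν b0 kp SA b0A b0S u ro _ IH] x xx' [b1 b1S xb].
- exact: Dead_full.
- have pl : p < l.
    rewrite ltnNge; apply/negP => /xb xb1; have := ro b1 b1S.
    by rewrite xb1 inE.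
  by apply: (Dead_abs kp) => b bS; rewrite xx' ?ro.
- have pl : p < l.
    rewrite ltnNge; apply/negP => /xb xb1.
    by have := rel_nblank SA b0A b0S b1S (ro b1 b1S); rewrite xb1 eqxx.
  apply: (Dead_rel kp SA b0A b0S u) => [b bS|]; first by rewrite xx' ?ro.
  apply: IH.
    by move=> b q; rewrite /upd !inE; case: eqP => //= _ bS; exact: xx'.
  exists b1; first by rewrite !inE b1S orbT.
  by rewrite /upd; case: eqP => [b10|//]; move: b0S; rewrite -b10 b1S.
Qed.

Definition kill_step A S n (x : Pt -> word) (e : Pt -> letter) :=
  if kind n is Some (cw, ν) then
    exists b0, [/\ S \subset dA A, b0 \in dA A /\ b0 \notin S, UA A b0 = ν,
      forall b, b \in S -> (e b).1 = RA A b0 b & Dead A (b0 |: S) (upd x b0 (dn n))]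
  else forall b, b \in S -> ((A, S, b) : PF * {set Pt} * Pt) \in (e b).2.

Lemma at_rcons w e p : at_ (rcons w e) p = if p == size w then e else at_ w p.
Proof.
rewrite /at_ nth_rcons; case: ltngtP => // pw.
by rewrite nth_default // ltnW.
Qed.

(** A letter at level [n] can serve only the outermost step of a derivation. Once the vertex at [p]
    enters, its code is blank from [p] on, and by [Dead_blank] the rest of the derivation stays
    below [p]. *)
Lemma Dead_rcons A S n (x : Pt -> word) (e : Pt -> letter) :
  (forall b, b \in S -> size (x b) = n) ->
  Dead A S (fun b => rcons (x b) (e b)) <-> Dead A S x \/ kill_step A S n x e.
Proof.
move=> xn; split; last first.
  move=> [|]; first by apply: Dead_prefix => b _; exact: prefix_rcons.
  rewrite /kill_step; case kn: (kind n) => [[cw ν]|] => [[b0 [SA [b0A b0S] u ro D]]|ro].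
    apply: (Dead_rel kn SA b0A b0S u) => [b bS|]; first by rewrite at_rcons xn // eqxx ro.
    apply: Dead_mono D => b p; rewrite /upd !inE; case: eqP => [->|bb0] /= bS.
      by rewrite (at_dn _ kn).
    move=> xb; rewrite at_rcons; case: eqP => // pn; move: xb.
    by rewrite at_blank ?eqxx // pn.
  by apply: (Dead_abs kn) => b bS; rewrite at_rcons xn // eqxx ro.
move=> D; have [->|S0] := eqVneq S finset.set0; first by left; exact: Dead_set0.
have [b1 b1S] := set0Pn _ S0.
inversion D as [y E1 E2|S1 y p kp ro E1 E2|S1 y p cw ν b0 kp SA b0A b0S u ro D' E1 E2]; subst.
- left; exact: Dead_full.
- have [pn|pn] := eqVneq p n.
    right; rewrite /kill_step -pn kp => b bS; have := ro b bS.
    by rewrite at_rcons xn // pn eqxx.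
  left; apply: (Dead_abs kp) => b bS; have := ro b bS.
  by rewrite at_rcons xn // (negbTE pn).
- have pn : p <= n.
    rewrite leqNgt; apply/negP => np; have := rel_nblank (x := fun b => rcons (x b) (e b)) SA b0A b0S b1S (ro b1 b1S).
    by rewrite at_blank ?eqxx // size_rcons xn.
  have DD w : (forall q, at_ w q = at_ cw q) -> Dead A (b0 |: S) (upd x b0 w).
    move=> wE; apply: (Dead_blank (l := p)) D'.
      move=> b q; rewrite /upd !inE; case: eqP => //= _ bS qp.
      by rewrite at_rcons xn // (ltn_eqF (leq_trans qp pn)).
    exists b0; first by rewrite !inE eqxx.
    move=> q pq; rewrite /upd eqxx at_blank //.
    exact: leq_trans (kind_size kp) pq.
  move: pn; rewrite leq_eqVlt => /orP[/eqP pn|pn].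
    right; rewrite /kill_step -pn kp; exists b0; split=> //.
      by move=> b bS; have := ro b bS; rewrite at_rcons xn // pn eqxx.
    by apply: DD => q; rewrite (at_dn _ kp).
  left; apply: (Dead_rel kp SA b0A b0S erefl); last exact: DD.
  move=> b bS; have := ro b bS.
  by rewrite at_rcons xn // (ltn_eqF pn).
Qed.

Definition kmatch (F : word -> word) p q :=
  if kind p is Some (cw, ν) then
    (exists cw', kind q = Some (cw', ν)) /\ F (dn p) = dn q
  else kind q = None.

(* Such maps send vertices to vertices (UM_kind), and kill nothing new. *)
Record UM (F : word -> word) (g : nat -> nat) : Prop := {
  UM_rcons : forall y e, prefix (rcons (F y) e) (F (rcons y e));
  UM_size : forall y, size (F y) = g (size y);
  UM_kind : forall p, kmatch F p (g p);
  UM_dead : forall A S x n, (forall b, size (x b) = n) ->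
    Dead A S (F \o x) <-> Dead A S x }.

Lemma UM_id : UM id id.
Proof.
split=> // [y e|p]; first exact: prefix_refl.
by rewrite /kmatch; case kp: (kind p) => [[cw ν]|] //; split=> //; exists cw.
Qed.

Lemma UM_prefix F g y y' : UM F g -> prefix y y' -> prefix (F y) (F y').
Proof.
move=> FU /prefixP[u ->]; elim/last_ind: u => [|u e IH].
  by rewrite cats0 prefix_refl.
rewrite -rcons_cat; apply: prefix_trans IH _; apply: prefix_trans (UM_rcons FU _ _).
exact: prefix_rcons.
Qed.

Lemma UM_comp F g F' g' : UM F g -> UM F' g' -> UM (F \o F') (g \o g').
Proof.
move=> FU FU'; split.
- move=> y e /=; apply: prefix_trans (UM_rcons FU _ _) _.
  exact: UM_prefix FU (UM_rcons FU' _ _).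
- by move=> y /=; rewrite (UM_size FU) (UM_size FU').
- move=> p; have := UM_kind FU' p; rewrite /kmatch; case kp: (kind p) => [[cw ν]|].
    move=> [[cw' kp'] FE]; have := UM_kind FU (g' p); rewrite /kmatch kp' /= FE.
    by [].
  by move=> kp'; have := UM_kind FU (g' p); rewrite /kmatch kp'.
- move=> A S x n xn; rewrite -(UM_dead FU' A S xn).
  by apply: (@UM_dead _ _ FU A S (F' \o x) (g' n)) => b /=; rewrite (UM_size FU') xn.
Qed.

(** By [Dead_rcons] a kill by the new letter depends on the letters, on the kind of level [n], and
    on deadness of words of length [n], [dn n] included. [F] preserves all of these. *)
Lemma kill_transfer (F : word -> word) A S x n q (e : Pt -> letter) :
  (forall b, size (x b) = n) -> (forall b, size (F (x b)) = q) -> kmatch F n q ->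
  (forall A S x, (forall b, size (x b) = n) -> Dead A S (F \o x) <-> Dead A S x) ->
  Dead A S (fun b => rcons (F (x b)) (e b)) <-> Dead A S (fun b => rcons (x b) (e b)).
Proof.
move=> xn Fxq km FD.
rewrite (Dead_rcons A (n := n) e (fun b _ => xn b)).
rewrite (Dead_rcons A (n := q) e (fun b _ => Fxq b)).
have -> : Dead A S (fun b => F (x b)) <-> Dead A S x by exact: (FD A S x xn).
have -> // : kill_step A S q (fun b => F (x b)) e <-> kill_step A S n x e.
move: km; rewrite /kmatch /kill_step; case kn: (kind n) => [[cw ν]|] => [[[cw' ->] Fdn]|-> //].
have DD b0 : Dead A (b0 |: S) (upd (fun b => F (x b)) b0 (dn q)) <->
    Dead A (b0 |: S) (upd x b0 (dn n)).
  rewrite -(FD A _ (upd x b0 (dn n))) => [|b].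
    rewrite (_ : F \o _ = upd (fun b => F (x b)) b0 (dn q)) //.
    by apply: funext => b; rewrite /upd /=; case: eqP.
  by rewrite /upd; case: eqP => // _; rewrite (size_dn kn).
split=> -[b0 [SA ? ? ? D]]; exists b0; split=> //; exact/DD.
Qed.

End Kills.

Lemma take_size_rcons (T : Type) (s : seq T) x : take (size s) (rcons s x) = s.
Proof. by rewrite -cats1 take_size_cat. Qed.

(** * Building self-maps of the tree level by level *)

Section Levels.
Variable Y : coding.
Local Notation PF := (pat Y).
Local Notation Pt := 'I_(pts Y).+1.
Local Notation letter := (letter (rels Y) (pts Y) (pat Y)).
Local Notation word := (word Y).
Local Notation blank := (blank Y).
Local Notation kind := (@kind Y).
Local Notation dn := (@dn Y).
Implicit Types (S : {set Pt}) (A : PF) (w cw : word).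

Definition safe (J : Type) (z z' : J -> word) :=
  forall A S (b : Pt -> J), Dead A S (z' \o b) -> Dead A S (z \o b).

Definition safe_on n (z z' : word -> word) :=
  forall A S (b : Pt -> word), (forall i, size (b i) = n) ->
  Dead A S (z' \o b) -> Dead A S (z \o b).

(** [halpern_lauchli] for [Dead]. The family consists of the words of length [n] in [P]; the other
    words of this length are padded by blanks, which keeps the whole level safe. *)
Lemma hl_words d (C : finType) L (x : 'I_d -> word) (c : ('I_d -> word) -> C) :
  (forall i, size (x i) = L) ->
  exists lx (x' : 'I_d -> word) ε,
   [/\ L <= lx, forall i, size (x' i) = lx, forall i, prefix (x i) (x' i) & safe x x'] /\
  forall n (P : pred word) (lab : word -> 'I_d) lz (z : word -> word), lx <= lz ->
    (forall w, size w = n -> size (z w) = lz) ->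
    (forall w, size w = n -> P w -> prefix (x' (lab w)) (z w)) ->
  exists lz' (z' : word -> word),
   [/\ lz <= lz', forall w, size w = n -> size (z' w) = lz',
     forall w, size w = n -> prefix (z w) (z' w), safe_on n z z' &
     forall g : 'I_d -> word, (forall i, [/\ size (g i) = n, P (g i) & lab (g i) = i]) ->
       safe x' (z \o g) -> c (z' \o g) = ε].
Proof.
move=> xL.
pose sup (π : PF * {set Pt}) n := exists2 b : Pt, b \in π.2 & n = b :> nat.
pose dead (π : PF * {set Pt}) (x : nat -> word) := Dead π.1 π.2 (fun b : Pt => x b).
have dead_sup π x1 x2 : (forall b, sup π b -> x1 b = x2 b) -> dead π x1 -> dead π x2.
  move=> xx; apply: Dead_eq => b p bS; rewrite xx //; by exists b.
have dead_blank π l l' x1 x2 : l <= l' ->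
  (forall b, sup π b -> size (x1 b) = l /\ size (x2 b) = l') ->
  (forall b, sup π b -> prefix (x1 b) (x2 b)) ->
  (exists2 b, sup π b & x2 b = x1 b ++ nseq (l' - l) blank) ->
  dead π x2 -> dead π x1.
  move=> ll sz pr [_ [b bS ->] bl]; have sb := sz _ (ex_intro2 _ _ b bS erefl).
  apply: (Dead_blank (l := l)).
    move=> b' p bS' pl; apply/esym/at_prefix; first by apply: pr; exists b'.
    by rewrite (sz _ (ex_intro2 _ _ b' bS' erefl)).1.
  by exists b => // p lp; rewrite bl at_cat_blank at_blank // sb.1.
have safeE (J : Type) (z1 z2 : J -> word) :
    (forall π (b : nat -> J), dead π (z2 \o b) -> dead π (z1 \o b)) -> safe z1 z2.
  move=> H A S b; have := H (A, S) (b \o inord).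
  have e (z : J -> word) : (fun i : Pt => (z \o (b \o inord)) i) = z \o b.
    by apply: funext => i /=; rewrite inord_val.
  by rewrite /dead !e.
have [lx [x' [ε [[_ xl Ll xp xs] HL]]]] := halpern_lauchli dead_sup dead_blank c xL.
exists lx, x', ε; split; first by split=> //; exact: safeE.
move=> n P lab lz z lxz zl zx.
pose J : finType := {t : n.-tuple letter | P t}.
pose wd (j : J) : word := tval (val j).
have wds j : size (wd j) = n by rewrite size_tuple.
have wdP j : P (wd j) by exact: (valP j).
have wdJ w : size w = n -> P w -> exists j, wd j = w.
  move=> /eqP wn Pw; by exists (exist (fun t : n.-tuple letter => P t) (Tuple wn) Pw).
have wd_inj : injective wd by move=> j j' /val_inj/val_inj.
have [lz' [z0 [[_ z0l ll z0p z0s] z0c]]] :=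
  HL J (lab \o wd) lz (z \o wd) lxz (fun j => zl _ (wds j)) (fun j => zx _ (wds j) (wdP j)).
pose z' w := if [pick j | wd j == w] is Some j then z0 j else z w ++ nseq (lz' - lz) blank.
have z'J j : z' (wd j) = z0 j.
  by rewrite /z'; case: pickP => [j' /eqP/wd_inj -> //|/(_ j)]; rewrite eqxx.
have z'P w : ~~ P w -> z' w = z w ++ nseq (lz' - lz) blank.
  by move=> nP; rewrite /z'; case: pickP => // j /eqP jw; move: (wdP j); rewrite jw (negbTE nP).
have z'p w : size w = n -> prefix (z w) (z' w).
  move=> wn; have [Pw|nP] := boolP (P w); last by rewrite z'P ?prefix_prefix.
  by have [j <-] := wdJ w wn Pw; rewrite z'J; exact: z0p.
exists lz', z'; split=> //.
- move=> w wn; have [Pw|nP] := boolP (P w).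
    by have [j <-] := wdJ w wn Pw; rewrite z'J.
  by rewrite z'P // size_cat size_nseq zl // subnKC.
- move=> A S b bn D; have [->|S0] := eqVneq S finset.set0; first exact: Dead_set0.
  have [i1 i1S] := set0Pn _ S0.
  have [SP|] := pselect (forall i, i \in S -> P (b i)); last first.
    move=> /existsNP[i /not_implyP[iS /negP nP]].
    apply: (Dead_blank (l := lz)) D.
      move=> i' p iS' pl; apply/esym/at_prefix; first by apply: z'p.
      by rewrite /= zl.
    by exists i => // p lp; rewrite /= z'P // at_cat_blank at_blank // zl.
  have jx i : exists j, i \in S -> wd j = b i.
    have [iS|_] := boolP (i \in S); first by have [j jb] := wdJ _ (bn i) (SP i iS); exists j.
    by have [j jb] := wdJ _ (bn i1) (SP i1 i1S); exists j.
  have [j jP] := choice jx.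
  have : Dead A S (z0 \o j).
    by apply: Dead_eq D => i p iS /=; rewrite -z'J jP.
  move=> /(safeE _ _ _ z0s); apply: Dead_eq => i p iS /=.
  by rewrite jP.
- move=> g gP gs.
  have [j jP] := choice (fun i => let: And3 a b _ := gP i in wdJ _ a b).
  have -> : z' \o g = z0 \o j by apply: funext => i /=; rewrite -jP z'J.
  apply: z0c => [i|]; first by rewrite /= jP; have [] := gP i.
  have E : (z \o wd) \o j = z \o g by apply: funext => i /=; rewrite jP.
  split=> //.
  - by move=> i /=; rewrite zl.
  - by move=> i /=; rewrite -[X in prefix (x' X) _](_ : lab (wd (j i)) = i) ?zx // jP; have [] := gP i.
  - by move=> π b; rewrite E; apply: gs.
Qed.

Definition exact_on n (z : word -> word) :=
  (exists q, forall w, size w = n -> size (z w) = q) /\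
  forall A S (b : Pt -> word), (forall i, size (b i) = n) ->
    Dead A S (z \o b) <-> Dead A S b.

Definition level_ext n (z z' : word -> word) := exists q,
  [/\ forall w, size w = n -> size (z' w) = q,
      forall w, size w = n -> prefix (z w) (z' w), safe_on n z z' & kmatch z' n q].

Lemma level_ext_exact n z z' : exact_on n z -> level_ext n z z' -> exact_on n z'.
Proof.
move=> [_ zD] [q [zq zp zs _]]; split; first by exists q.
move=> A S b bn; split=> [/(zs _ _ _ bn)/(zD A S b bn)//|/(zD A S b bn)].
by apply: Dead_prefix => i _; exact: zp.
Qed.

Lemma waitS_ex (sν : word * nat) : exists m, kind (size sν.1 + m) = Some sν.
Proof.
case: sν => s ν; have [p sp kp] := kind_coder s ν (size s).
by exists (p - size s); rewrite subnKC.
Qed.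

Definition waitS sν := sval (cid (waitS_ex sν)).

(** The number of blanks to append at level [n]. If the level carries a vertex, [s] is the image of
    its word and the blanks lead to a position coding [s]; otherwise they make the length even,
    where no vertex sits. *)
Definition wait n (s : word) :=
  if kind n is Some (cw, ν) then waitS (s, ν) else odd (size s) : nat.

Lemma waitP n s : kind (size s + wait n s) =
  if kind n is Some (cw, ν) then Some (s, ν) else None.
Proof.
rewrite /wait; case: (kind n) => [[cw ν]|].
  by rewrite /waitS; case: cid.
by rewrite kind_even // oddD oddb addbb.
Qed.

Lemma pad_level_ext n z z' q : (forall w, size w = n -> size (z' w) = q) ->
  (forall w, size w = n -> prefix (z w) (z' w)) -> safe_on n z z' ->
  (exists q, forall w, size w = n -> size (z w) = q) ->
  forall s, size s = n -> (forall cw ν, kind n = Some (cw, ν) -> s = dn n) ->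
  level_ext n z (fun w => z' w ++ nseq (wait n (z' s)) blank).
Proof.
move=> zq zp zs _ s sn sdn; exists (q + wait n (z' s)); split.
- by move=> w wn; rewrite size_cat size_nseq zq.
- move=> w wn; apply: prefix_trans (zp w wn) _; exact: prefix_prefix.
- move=> A S b bn D; apply: zs => //; apply: Dead_eq D => i p _ /=.
  by rewrite at_cat_blank.
- have := waitP n (z' s); rewrite zq // /kmatch; case kn: (kind n) => [[cw ν]|//] kq.
  split; first by exists (z' s).
  by rewrite -(sdn cw ν) // (dnE kq) zq // addKn.
Qed.

Lemma level_ext_id n z : exact_on n z -> exists z', level_ext n z z'.
Proof.
move=> [[q zq] _]; have [s [sn sdn]] : exists s, size s = n /\
    (forall cw ν, kind n = Some (cw, ν) -> s = dn n).
  case kn: (kind n) => [[cw ν]|]; first by exists (dn n); rewrite (size_dn kn).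
  by exists (nseq n blank); rewrite size_nseq.
exists (fun w => z w ++ nseq (wait n (z s)) blank).
apply: (pad_level_ext zq) => //; last by exists q.
by move=> w _; exact: prefix_refl.
Qed.

(** [arr n] is the map as it arrives at level [n], before [Ext] acts. Its exactness follows from
    that of the previous level by [kill_transfer]. *)
Lemma build_UM (Ext : nat -> (word -> word) -> word -> word) :
  (forall n z, exact_on n z -> level_ext n z (Ext n z)) ->
  exists E g (arr : nat -> word -> word), [/\ UM E g,
    forall w, E w = Ext (size w) (arr (size w)) w, arr 0 [::] = [::],
    forall y e, arr (size y).+1 (rcons y e) = rcons (E y) e &
    forall n, exact_on n (arr n)].
Proof.
move=> ExtP.
pose nxt n (z : word -> word) w := rcons (z (take n w)) (at_ w n).
pose fix lev n := Ext n (if n is n'.+1 then nxt n' (lev n') else id).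
pose arr n := if n is n'.+1 then nxt n' (lev n') else id.
have levE n : lev n = Ext n (arr n) by case: n.
have takeK n w : size w = n.+1 -> rcons (take n w) (at_ w n) = w.
  by move=> wn; rewrite /at_ -take_nth ?wn // take_oversize ?wn.
have stake n w : size w = n.+1 -> size (take n w) = n.
  by move=> wn; rewrite size_takel // wn.
have ex n : exact_on n (arr n).
  elim: n => [|n IH]; first by split; first by exists 0.
  have [q [zq zp zs zk]] := ExtP _ _ IH; have [_ zD] := level_ext_exact IH (ExtP _ _ IH).
  rewrite -levE in zq zp zs zk zD.
  split; first by exists q.+1 => w wn; rewrite /= /nxt size_rcons zq // stake.
  move=> A S b bn.
  have := kill_transfer (F := lev n) A S (x := fun i => take n (b i)) (n := n) (q := q)
     (fun i => at_ (b i) n) (fun i => stake _ _ (bn i)) (fun i => zq _ (stake _ _ (bn i))) zk zD.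
  rewrite (_ : (fun i => rcons (take n (b i)) (at_ (b i) n)) = b) //.
  by apply: funext => i; rewrite takeK.
have ext n : level_ext n (arr n) (lev n) by rewrite levE; apply: ExtP.
pose E w := lev (size w) w; pose g n := size (E (nseq n blank)).
have gE n q : (forall w, size w = n -> size (lev n w) = q) -> g n = q.
  by move=> H; rewrite /g /E size_nseq H ?size_nseq.
exists E, g, arr; split=> //.
- split.
  + move=> y e; have [q [_ zp _ _]] := ext (size y).+1.
    have := zp (rcons y e); rewrite size_rcons => /(_ erefl).
    by rewrite /= /nxt take_size_rcons ?at_rcons ?eqxx // /E size_rcons.
  + by move=> y; have [q [zq _ _ _]] := ext (size y); rewrite (gE _ q) // /E zq.
  + move=> p; have [q [zq _ _]] := ext p; rewrite (gE _ q) // /kmatch.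
    case kp: (kind p) => [[cw ν]|//].
    by rewrite /E (size_dn kp).
  + move=> A S b n bn; have [_ zD] := level_ext_exact (ex n) (ext n).
    rewrite (_ : E \o b = lev n \o b); first exact: zD.
    by apply: funext => i /=; rewrite /E bn.
- by move=> w; rewrite /E levE.
- by move=> y e /=; rewrite /nxt take_size_rcons at_rcons eqxx.
Qed.

End Levels.

(** * The Ramsey theorem for similarity types *)

Section Types.
Variable Y : coding.
Local Notation PF := (pat Y).
Local Notation Pt := 'I_(pts Y).+1.
Local Notation letter := (letter (rels Y) (pts Y) (pat Y)).
Local Notation word := (word Y).
Local Notation blank := (blank Y).
Local Notation kind := (@kind Y).
Local Notation dn := (@dn Y).
Implicit Types (S : {set Pt}) (A : PF) (w cw : word) (F G H : word -> word).

Lemma UM_id_size H g Q : UM H g -> (forall w, size w < Q -> H w = w) ->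
  forall q, q < Q -> g q = q.
Proof.
by move=> HU Hid q qQ; rewrite -[in LHS](size_nseq q blank) -(UM_size HU) Hid size_nseq.
Qed.

(** [Fs Q] is a composition whose factor number Q fixes all words shorter than Q. It stabilizes on
    each word, and what follows stage Q + 1 is a map [H] that fixes the words shorter than Q; so the
    limit inherits every [Good Q]. *)
Lemma fusion (Good : nat -> (word -> word) -> Prop) :
  (forall Q F g, UM F g -> exists E g', [/\ UM E g',
     forall w, size w < Q -> E w = w & Good Q (F \o E)]) ->
  exists F g, UM F g /\ forall Q n, exists F' H g1 g2, [/\ UM F' g1 /\ UM H g2,
    forall w, size w < Q -> H w = w, Good Q F' &
    forall w, size w <= n -> F w = F' (H w)].
Proof.
move=> step.
have stepx (QF : nat * (word -> word)) : exists E, (exists g, UM QF.2 g) ->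
    [/\ exists g', UM E g', forall w, size w < QF.1 -> E w = w & Good QF.1 (QF.2 \o E)].
  have [[g FU]|n] := pselect (exists g, UM QF.2 g); last by exists id.
  by have [E [g' [? ? ?]]] := step QF.1 _ _ FU; exists E => _; split=> //; exists g'.
have [e eP] := choice stepx.
pose fix Fs Q := if Q is Q'.+1 then Fs Q' \o e (Q', Fs Q') else id.
have FsU Q : exists g, UM (Fs Q) g.
  elim: Q => [|Q [g FU]]; first by exists id; exact: UM_id.
  have [[g' EU] _ _] := eP (Q, Fs Q) (ex_intro _ g FU).
  by exists (g \o g'); exact: UM_comp FU EU.
have tail Q M : Q <= M -> exists H g, [/\ UM H g, forall w, size w < Q -> H w = w &
    Fs M = Fs Q \o H].
  elim: M => [|M IH]; first by rewrite leqn0 => /eqP ->; exists id, id; split=> //; exact: UM_id.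
  rewrite leq_eqVlt => /orP[/eqP ->|]; first by exists id, id; split=> //; exact: UM_id.
  rewrite ltnS => QM; have [H [g [HU Hid HF]]] := IH QM.
  have [[g' EU] Eid _] := eP (M, Fs M) (FsU M).
  exists (H \o e (M, Fs M)), (g \o g'); split.
  - exact: UM_comp HU EU.
  - by move=> w wQ /=; rewrite Eid ?Hid //=; exact: leq_trans wQ QM.
  - by rewrite -[Fs M.+1]/(Fs M \o e (M, Fs M)) {1}HF.
pose F w := Fs (size w).+1 w.
have FE M w : size w < M -> F w = Fs M w.
  by move=> /tail[H [g [_ Hid ->]]] /=; rewrite Hid.
have [gs gsU] := choice FsU.
exists F, (fun n => gs n.+1 n); split.
  split.
  - move=> w e1; rewrite !(FE (size w).+2) ?size_rcons //; exact: (UM_rcons (gsU _)).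
  - by move=> y; rewrite /F (UM_size (gsU _)).
  - move=> p; have := UM_kind (gsU p.+1) p; rewrite /kmatch.
    by case kp: (kind p) => [[cw ν]|//]; rewrite /F (size_dn kp).
  - move=> A S x n xn; rewrite -(UM_dead (gsU n.+1) A S xn).
    by rewrite (_ : F \o x = Fs n.+1 \o x) //; apply: funext => b /=; rewrite /F xn.
move=> Q n; have [H [g [HU Hid HF]]] := tail Q.+1 (maxn Q.+1 n.+1) (leq_maxl _ _).
exists (Fs Q.+1), H, (gs Q.+1), g; split=> //.
- by move=> w wQ; rewrite Hid // ltnW.
- by have [_ _] := eP (Q, Fs Q) (FsU Q).
- by move=> w wn; rewrite (FE (maxn Q.+1 n.+1)) ?HF // leq_max [X in _ || X]ltnS wn orbT.
Qed.

Variables (m : nat) (y : 'I_m -> word) (ν : 'I_m -> nat).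

Definition D w := exists l, prefix w (y l).

(** The initial segment that [G w] is forced to have: the image of the predecessor of [w] and the
    last letter of [w]. What [G] adds after it must not kill. *)
Definition arrow G w :=
  if size w is n.+1 then rcons (G (take n w)) (at_ w n) else [::].

(* The words of the y l form the similarity type of a tuple of vertices, and G
   realizes this type inside the tree: between consecutive letters of the type
   nothing interesting happens. *)
Record AM G (h : nat -> nat) : Prop := {
  AM_rcons : forall w e, D (rcons w e) -> prefix (rcons (G w) e) (G (rcons w e));
  AM_size : forall w, D w -> size (G w) = h (size w);
  AM_safe : forall A S n (b : Pt -> word), (forall i, D (b i) /\ size (b i) = n) ->
    Dead A S (G \o b) -> Dead A S (arrow G \o b);
  AM_coder : forall l, (exists cw, kind (h (size (y l))) = Some (cw, ν l)) /\
    G (y l) = dn (h (size (y l)));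
  AM_none : forall n, (exists l, n <= size (y l)) -> (forall l, size (y l) <> n) ->
    kind (h n) = None }.

Lemma D_prefix w w' : prefix w w' -> D w' -> D w.
Proof. by move=> ww [l wl]; exists l; exact: prefix_trans ww wl. Qed.

Lemma D_take n w : D w -> D (take n w).
Proof. by apply: D_prefix; exact: prefix_take. Qed.

Lemma D_level n : (exists l, n <= size (y l)) -> exists2 w, D w & size w = n.
Proof.
move=> [l nl]; exists (take n (y l)); last by rewrite size_takel.
by exists l; exact: prefix_take.
Qed.

Lemma take_at n w : size w = n.+1 -> rcons (take n w) (at_ w n) = w.
Proof. by move=> wn; rewrite /at_ -take_nth ?wn // take_oversize ?wn. Qed.

Lemma UM_AM F g G h : UM F g -> AM G h -> AM (F \o G) (g \o h).
Proof.
move=> FU GA; split.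
- move=> w e De /=; apply: prefix_trans (UM_rcons FU _ _) _.
  exact: UM_prefix FU (AM_rcons GA De).
- by move=> w Dw /=; rewrite (UM_size FU) (AM_size GA).
- move=> A S n b bn DFG.
  have {DFG}: Dead A S (G \o b).
    rewrite -(@UM_dead _ _ _ FU A S (G \o b) (h n)) // => i /=.
    by rewrite (AM_size GA) ?(bn i).2 //; exact: (bn i).1.
  move=> /(AM_safe GA bn); case: n bn => [|n] bn.
    rewrite (_ : arrow G \o b = arrow (F \o G) \o b) //; apply: funext => i /=.
    by rewrite /arrow (bn i).2.
  have sz i : size (G (take n (b i))) = h n.
    rewrite (AM_size GA); last exact: D_take (bn i).1.
    by rewrite size_takel // (bn i).2.
  have K := @kill_transfer Y F A S (fun i => G (take n (b i))) (h n) (g (h n))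
    (fun i => at_ (b i) n) sz (fun i => etrans (UM_size FU _) (congr1 g (sz i)))
    (UM_kind FU _) (fun A S x => @UM_dead _ _ _ FU A S x (h n)).
  rewrite (_ : arrow G \o b = fun i => rcons (G (take n (b i))) (at_ (b i) n)); last first.
    by apply: funext => i /=; rewrite /arrow (bn i).2.
  rewrite (_ : arrow (F \o G) \o b = fun i => rcons (F (G (take n (b i)))) (at_ (b i) n)).
    by move=> /K.
  by apply: funext => i /=; rewrite /arrow (bn i).2.
- move=> l; have [[cw kc] GE] := AM_coder GA l.
  by have := UM_kind FU (h (size (y l))); rewrite /kmatch kc /= GE.
- move=> n nl nn; have kc := AM_none GA nl nn.
  by have := UM_kind FU (h n); rewrite /kmatch kc.
Qed.

Lemma AM_arrow G h w : AM G h -> D w -> prefix (arrow G w) (G w).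
Proof.
move=> GA Dw; rewrite /arrow; case wn: (size w) => [|n]; first exact: prefix0s.
by rewrite -{3}(take_at wn); apply: (AM_rcons GA); rewrite take_at.
Qed.

Lemma size_arrow G h w : AM G h -> D w ->
  size (arrow G w) = if size w is n.+1 then (h n).+1 else 0.
Proof.
move=> GA Dw; rewrite /arrow; case wn: (size w) => [//|n].
by rewrite size_rcons (AM_size GA) ?size_takel ?wn //; exact: D_take.
Qed.

Lemma AM_prefix G h w w' : AM G h -> D w' -> prefix w w' -> prefix (G w) (G w').
Proof.
move=> GA + /prefixP[u]; elim/last_ind: u w' => [|u e IH] w' Dw' E.
  by rewrite E cats0 prefix_refl.
rewrite -rcons_cat in E; rewrite E in Dw' *.
apply: prefix_trans (IH _ _ erefl) _; first exact: D_prefix (prefix_rcons _ _) Dw'.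
by apply: prefix_trans (prefix_rcons _ e) (AM_rcons GA Dw').
Qed.

Lemma AM_lt G h p q : AM G h -> (exists l, q <= size (y l)) -> p < q -> h p < h q.
Proof.
move=> GA /D_level[w Dw wq] pq.
have spw : size (take p.+1 w) = p.+1 by rewrite size_takel // wq.
have Dp := D_take p.+1 Dw.
have := size_arrow GA Dp; rewrite spw => sa.
have := prefix_trans (AM_arrow GA Dp) (AM_prefix GA Dw (prefix_take _ _)).
by move=> /size_prefix; rewrite sa (AM_size GA) // wq.
Qed.

Lemma AM_at G h w p : AM G h -> D w -> p < size w -> at_ (G w) (h p) = at_ w p.
Proof.
move=> GA Dw pw.
have spw : size (take p.+1 w) = p.+1 by rewrite size_takel.
have Dp := D_take p.+1 Dw.
have pr := prefix_trans (AM_arrow GA Dp) (AM_prefix GA Dw (prefix_take _ _)).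
rewrite (at_prefix pr) ?(size_arrow GA) ?spw // /arrow spw at_rcons.
rewrite (AM_size GA); last exact: D_take Dp.
rewrite size_takel ?spw // eqxx.
by rewrite (at_prefix (prefix_take w p.+1)) // spw.
Qed.

Lemma AM_inj G h w w' : AM G h -> D w -> D w' -> size w = size w' -> G w = G w' -> w = w'.
Proof.
move=> GA Dw Dw' ww GG; apply: (@eq_from_nth _ blank) => // p pw.
by have := AM_at GA Dw pw; rewrite GG (AM_at GA) -?ww.
Qed.

(** The length of the words [arrow G w] for [w] of length [a], where [G] becomes free to choose its
    level [a]. *)
Definition base a (h : nat -> nat) := if a is a'.+1 then (h a').+1 else 0.

Definition agree_lt a G G' := forall w, D w -> size w < a -> G w = G' w.

Lemma arrow_agree a G G' w : agree_lt a G G' -> D w -> size w = a -> arrow G w = arrow G' w.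
Proof.
move=> GG Dw wa; rewrite /arrow; case wn: (size w) => [//|n].
rewrite GG //; first exact: D_take.
by rewrite -wa wn size_takel // wn.
Qed.

(** [G0] fixes the starting points [x0 i] of level [a]. The partition theorem is applied to them
    once, and its second half at every level n >= Q of the tree, so that whatever level [G] chooses
    for [a] has been prepared. *)
Lemma hl_fixed_base a (C : finType) (c : (word -> word) -> C) :
  (exists l, a <= size (y l)) ->
  (forall G G', agree_lt a.+1 G G' -> c G = c G') ->
  forall G0 h0, AM G0 h0 -> exists E g, [/\ UM E g,
    forall w, size w < base a h0 -> E w = w &
    exists ε, forall G h, AM G h -> base a h = base a h0 -> agree_lt a G G0 ->
      c (E \o G) = ε].
Proof.
move=> al cdep G0 h0 G0A; set Q := base a h0.
pose Da := undup [seq take a (y l) | l <- enum 'I_m & a <= size (y l)].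
pose d := size Da; pose s (i : 'I_d) := nth [::] Da i.
have s_inj : injective s.
  by move=> i j /eqP; rewrite /s nth_uniq ?undup_uniq // => /eqP/val_inj.
have sDa i : s i \in Da by exact: mem_nth.
have sP i : D (s i) /\ size (s i) = a.
  have := sDa i; rewrite mem_undup => /mapP[l]; rewrite mem_filter => /andP[la _] ->.
  by split; [exists l; exact: prefix_take|rewrite size_takel].
have sE w : D w -> size w = a -> exists i, s i = w.
  move=> [l wl] wa; have la : a <= size (y l) by rewrite -wa; exact: size_prefix.
  have wDa : w \in Da.
    rewrite mem_undup; apply/mapP; exists l; first by rewrite mem_filter la mem_enum.
    by rewrite -wa; have /prefixP[u ->] := wl; rewrite take_size_cat.
  have iw : index w Da < d by rewrite index_mem.
  by exists (Ordinal iw); rewrite /s nth_index.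
have [i0 [tgt i0P]] : exists (i0 : 'I_d) (tgt : option nat),
    if tgt is Some v then exists l, [/\ s i0 = y l, size (y l) = a & v = ν l]
    else forall l, size (y l) <> a.
  have [[l la]|nl] := pselect (exists l, size (y l) = a).
    have [i il] := sE (y l) (ex_intro _ l (prefix_refl _)) la.
    by exists i, (Some (ν l)); exists l.
  have [w Dw wa] := D_level al; have [i _] := sE _ Dw wa.
  by exists i, None => l la; apply: nl; exists l.
(* The map [E] will append blanks to reach a position of the right kind. Their number depends on the
   word [u i0] of the vertex alone (on its length, if level [a] has no vertex), so [ins] can colour
   a tuple after this padding. *)
pose wt (u : word) := if tgt is Some v then waitS (u, v) else odd (size u) : nat.
pose ins (u : 'I_d -> word) w :=
  if size w == a then
    if [pick i | s i == w] is Some i then u i ++ nseq (wt (u i0)) blank else w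
  else G0 w.
pose x0 i := arrow G0 (s i).
have x0Q i : size (x0 i) = Q by rewrite (size_arrow G0A) ?(sP i).2 //; exact: (sP i).1.
have x0_inj : injective x0.
  move=> i j ij; apply: s_inj; have [Di si] := sP i; have [Dj sj] := sP j.
  move: ij; rewrite /x0 /arrow; case wn: (size (s i)) => [|n].
    by rewrite (size0nil wn); move: (wn); rewrite si -sj => /size0nil ->.
  have wn' : size (s j) = n.+1 by rewrite sj -si.
  rewrite wn' => /rcons_inj[tt ee].
  rewrite -(take_at wn) -(take_at wn') ee; congr rcons.
  by apply: (AM_inj G0A _ _ _ tt); rewrite ?size_takel ?wn ?wn' //; exact: D_take.
have [lx [x' [ε [[Qlx xl xp xs] HL]]]] := hl_words (fun u => c (ins u)) x0Q.
pose P w := [exists i, x0 i == take Q w].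
pose lab w := odflt i0 [pick i | x0 i == take Q w].
have labE w i : x0 i = take Q w -> P w /\ lab w = i.
  move=> iw; split; first by apply/existsP; exists i; rewrite iw.
  rewrite /lab; case: pickP => [j /eqP|/(_ i)]; last by rewrite iw eqxx.
  by rewrite -iw => /x0_inj.
have labP w : P w -> x0 (lab w) = take Q w.
  by move=> /existsP[i /eqP iw]; rewrite (labE w i iw).2.
(* At level Q the words above some [x0 i] are first sent to [x' i]; at higher levels they extend it
   already. *)
pose z1 n (z : word -> word) w := if n == Q then
  (if P w then x' (lab w) else w ++ nseq (lx - Q) blank) else z w.
pose cond n (z : word -> word) := [/\ Q <= n, n = Q -> forall w, size w = n -> z w = w &
  Q < n -> exists2 lz, lx <= lz & forall w, size w = n -> size (z w) = lz /\
    (P w -> prefix (x' (lab w)) (z w))].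
pose col n z (out : word -> word) := forall g : 'I_d -> word,
  (forall i, size (g i) = n /\ x0 i = take Q (g i)) -> safe x' (z1 n z \o g) ->
  (if tgt is Some v then (exists cw, kind n = Some (cw, v)) /\ g i0 = dn n else kind n = None) ->
  exists u : 'I_d -> word, c (ins u) = ε /\ forall i, out (g i) = u i ++ nseq (wt (u i0)) blank.
have ExtE (nz : nat * (word -> word)) : exists out, exact_on nz.1 nz.2 ->
   [/\ level_ext nz.1 nz.2 out,
    nz.1 < Q -> (forall w, size w = nz.1 -> nz.2 w = w) -> forall w, size w = nz.1 -> out w = w &
    cond nz.1 nz.2 -> (forall w, size w = nz.1 -> prefix (z1 nz.1 nz.2 w) (out w)) /\
      col nz.1 nz.2 out].
  case: nz => n z /=; have [ex|] := pselect (exact_on n z); last by exists id.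
  have [[nQ zid]|nid] := pselect (n < Q /\ forall w, size w = n -> z w = w).
    exists z => _; split=> [|//|[]]; last by rewrite leqNgt nQ.
    exists n; split=> //.
    - by move=> w wn; rewrite zid.
    - by move=> w _; exact: prefix_refl.
    - rewrite /kmatch; case kn: (kind n) => [[cw v]|//]; split; first by exists cw.
      by rewrite zid // (size_dn kn).
  have [cnd|ncnd] := pselect (cond n z); last first.
    have [out outP] := level_ext_id ex; exists out => _; split=> // nQ zid.
    by case: nid.
  have [Qn zQ zlt] := cnd.
  have [lz [lxz z1l z1x]] : exists lz, [/\ lx <= lz, forall w, size w = n -> size (z1 n z w) = lz &
      forall w, size w = n -> P w -> prefix (x' (lab w)) (z1 n z w)].
    rewrite /z1; case: eqVneq => [nE|nQ].
      exists lx; split=> // w wn.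
        by case: ifP => _ //; rewrite size_cat size_nseq wn nE subnKC.
      by move=> Pw; rewrite Pw prefix_refl.
    have /zlt[lz lxz zz] : Q < n by rewrite ltn_neqAle eq_sym nQ.
    by exists lz; split=> // w wn; have [] := zz w wn.
  have [lz' [z' [lz'z z'l z'p z's z'c]]] := HL n P lab lz (z1 n z) lxz z1l z1x.
  have z1p w : size w = n -> prefix (z w) (z1 n z w).
    move=> wn; rewrite /z1; case: eqP => [nE|_]; last exact: prefix_refl.
    rewrite zQ //; case: ifP => [Pw|_]; last exact: prefix_prefix.
    have := xp (lab w); rewrite labP // take_oversize //; by rewrite wn nE.
  have z1s : safe_on n z (z1 n z).
    move=> A S b bn; rewrite /z1; case: eqVneq => [nE|_] //.
    move=> DD; have [->|S0] := eqVneq S finset.set0; first exact: Dead_set0.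
    have zb : z \o b = b by apply: funext => i /=; rewrite zQ.
    rewrite zb; have [SP|] := pselect (forall i, i \in S -> P (b i)).
      have : Dead A S (x' \o (lab \o b)).
        by apply: Dead_eq DD => i p iS /=; rewrite SP.
      move=> /xs; apply: Dead_eq => i p iS /=.
      by rewrite labP ?SP // take_oversize // bn nE.
    move=> /existsNP[i /not_implyP[iS /negP/negbTE nP]].
    apply: (Dead_blank (l := Q)) DD.
      move=> j p jS pQ /=; apply/esym/at_prefix; last by rewrite bn nE.
      have := z1p (b j) (bn j); rewrite zQ // /z1 nE eqxx //.
    by exists i => // p Qp; rewrite /= nP at_cat_blank at_blank // bn nE.
  have [sd [sdn sdE]] : exists sd : word, size sd = n /\
      (forall cw v, kind n = Some (cw, v) -> sd = dn n).
    case kn: (kind n) => [[cw v]|]; first by exists (dn n); rewrite (size_dn kn).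
    by exists (nseq n blank); rewrite size_nseq.
  exists (fun w => z' w ++ nseq (wait n (z' sd)) blank) => _; split.
  - apply: (pad_level_ext z'l) => //.
    + by move=> w wn; apply: prefix_trans (z1p w wn) (z'p w wn).
    + by move=> A S b bn /(z's A S b bn)/(z1s A S b bn).
    + by have [] := ex.
  - by move=> nQ; rewrite leqNgt nQ in Qn.
  - move=> _; split.
      by move=> w wn; apply: prefix_trans (z'p w wn) _; exact: prefix_prefix.
    move=> g gP gs gt; exists (z' \o g); split.
      apply: z'c => // i; have [gn gx] := gP i.
      by have [] := labE _ _ gx.
    move=> i /=; congr (_ ++ nseq _ _); move: gt; rewrite /wt /wait.
    case: (tgt) => [v|].
      by move=> [[cw kn] ->]; rewrite (sdE _ _ kn) kn.
    by move=> ->; rewrite !z'l //; have [] := gP i0.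
have [Ext ExtP] := choice ExtE.
have [E [g [arr [EU EE arr0 arrS ex]]]] :=
  build_UM (Ext := fun n z => Ext (n, z)) (fun n z ex => let: And3 a _ _ := ExtP (n, z) ex in a).
have arr_id n : (forall w, size w < n -> E w = w) -> forall w, size w = n -> arr n w = w.
  move=> Eid w; case/lastP: w => [<- //|w e]; rewrite size_rcons => wn.
  by rewrite -wn arrS Eid // -wn.
have Eid n : n <= Q -> forall w, size w < n -> E w = w.
  elim: n => [//|n IH] nQ w; rewrite ltnS leq_eqVlt => /orP[/eqP wn|]; last first.
    by apply: IH; exact: ltnW.
  have [_ K _] := ExtP (n, arr n) (ex n); rewrite EE wn; apply: K => //=.
  exact: arr_id (IH (ltnW nQ)).
have cQ : cond Q (arr Q).
  split=> // [_|]; last by rewrite ltnn.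
  exact: arr_id (Eid Q (leqnn _)).
have EQ w : size w = Q -> prefix (z1 Q (arr Q) w) (E w).
  by move=> wQ; have [_ _ /(_ cQ)[K _]] := ExtP (Q, arr Q) (ex Q); rewrite EE wQ; exact: K.
have cn n : Q <= n -> cond n (arr n).
  rewrite leq_eqVlt => /orP[/eqP <- //|Qn]; split; first exact: ltnW.
    by move=> nQ; rewrite nQ ltnn in Qn.
  move=> _; have [[lz alz] _] := ex n.
  have K w : size w = n -> prefix (z1 Q (arr Q) (take Q w)) (arr n w).
    case/lastP: w => [|w e]; first by move=> n0; rewrite -n0 in Qn.
    rewrite size_rcons => wn; rewrite -wn arrS.
    have Qw : Q <= size w by rewrite -ltnS wn.
    rewrite -cats1 takel_cat //.
    apply: prefix_trans (EQ _ (size_takel Qw)) _.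
    apply: prefix_trans (UM_prefix EU (prefix_take w Q)) _.
    exact: prefix_rcons.
  have tK w : take Q (take Q w) = take Q w by rewrite -take_min minnn.
  exists lz.
    have := K (nseq n blank) (size_nseq _ _) => /size_prefix.
    rewrite alz ?size_nseq //; apply: leq_trans.
    rewrite /z1 eqxx; case: ifP => _; first by rewrite xl.
    rewrite size_cat size_nseq size_takel ?size_nseq ?subnKC //; exact: ltnW.
  move=> w wn; split; first exact: alz.
  move=> Pw; apply: prefix_trans (K w wn).
  by rewrite /z1 eqxx /P /lab tK -/(P w) Pw -/(lab w) prefix_refl.
exists E, g; split=> //; first exact: (Eid Q (leqnn _)).
exists ε => G h GA hQ GG0; pose N := h a.
have sD i := (sP i).1.
have szG i : size (G (s i)) = N by rewrite (AM_size GA) ?(sP i).2.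
have x0p i : prefix (x0 i) (G (s i)).
  by rewrite /x0 -(arrow_agree GG0 (sD i) (sP i).2); exact: AM_arrow GA (sD i).
have QN : Q <= N by rewrite -(szG i0) -(x0Q i0); apply: size_prefix.
have x0t i : x0 i = take Q (G (s i)).
  by have /prefixP[u ->] := x0p i; rewrite take_size_cat.
have [_ _ /(_ (cn N QN))[_ cl]] := ExtP (N, arr N) (ex N).
(* The words [G (s i)] form one of the transversals treated at level [N]: [AM_safe] excludes kills
   between the [x0 i] and them. *)
have [|||u [cu uE]] := cl (G \o s).
- by move=> i; split=> /=.
- rewrite /z1; case: eqVneq => [NQ|_].
    rewrite (_ : _ \o (G \o s) = x') // ; apply: funext => i /=.
    by have [-> ->] := labE _ _ (x0t i).
  move=> A S b /= DD.
  have : Dead A S (G \o (s \o b)).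
    by have [_ K] := ex N; apply/(K A S (G \o (s \o b))) => // i /=.
  move=> /(AM_safe GA (n := a) (fun i => sP (b i))).
  apply: Dead_prefix => i _ /=.
  by rewrite (arrow_agree GG0 (sD _) (sP _).2); exact: xp.
- move: i0P; case: (tgt) => [v [l [sl la ->]]|nl] /=.
    by have [[cw kc] GE] := AM_coder GA l; rewrite sl GE la /N; split=> //; exists cw; rewrite -la.
  exact: (AM_none GA al nl).
rewrite -cu; apply: cdep => w Dw; rewrite ltnS leq_eqVlt /ins => /orP[/eqP wa|wa].
  rewrite wa eqxx; have [i iw] := sE w Dw wa.
  case: pickP => [j /eqP jw|/(_ i)]; last by rewrite iw eqxx.
  by rewrite /= -jw EE szG; exact: uE.
rewrite (ltn_eqF wa) /= GG0 //; apply: (Eid Q (leqnn _)).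
rewrite (AM_size G0A) // /Q /base; case: (a) wa al => [//|a'] wa al.
rewrite ltnS in wa; move: wa; rewrite leq_eqVlt => /orP[/eqP ->|wa]; first exact: ltnSn.
rewrite ltnW // ltnS; apply: (AM_lt G0A) => //.
by have [l ll] := al; exists l; exact: ltnW.
Qed.

End Types.

(** * Induction over the levels of a similarity type *)

Section RamseyTypes.
Variable Y : coding.
Local Notation letter := (letter (rels Y) (pts Y) (pat Y)).
Local Notation word := (word Y).
Local Notation blank := (blank Y).
Implicit Types (w cw : word) (F G H : word -> word).
Variables (m : nat) (y : 'I_m -> word) (ν : 'I_m -> nat).
Local Notation D := (D y).
Local Notation AM := (AM y ν).
Local Notation agree_lt := (agree_lt y).

Lemma UM_base F g Q a h : UM F g -> (forall w, size w < Q -> F w = w) ->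
  base a h = Q -> base a (g \o h) = Q.
Proof.
move=> FU Fid; case: a => [//|a] /= hQ; rewrite (UM_id_size FU Fid) //.
by rewrite -hQ.
Qed.

Lemma base_size Q a G h w : AM G h -> base a h = Q -> (exists l, a <= size (y l)) ->
  D w -> size w < a -> size (G w) < Q.
Proof.
move=> GA <- al Dw; rewrite (AM_size GA) //; case: a al => [//|a] al /=.
rewrite ltnS leq_eqVlt => /orP[/eqP ->|wa]; first exact: ltnSn.
rewrite ltnS ltnW //; apply: (AM_lt GA) => //.
by have [l ll] := al; exists l; exact: ltnW.
Qed.

(** For a fixed base Q there are finitely many restrictions of [G] below level [a], as their values
    are words shorter than Q; [keyed] encodes them. They are treated one after another by
    [hl_fixed_base], and a fusion treats all Q. *)
Lemma ramsey_level a (C : finType) (c : (word -> word) -> C) :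
  (exists l, a <= size (y l)) ->
  (forall G G', agree_lt a.+1 G G' -> c G = c G') ->
  exists F g, UM F g /\ forall G h G1 h1, AM G h -> AM G1 h1 -> agree_lt a G G1 ->
    c (F \o G) = c (F \o G1).
Proof.
move=> al cdep.
pose Good Q F := forall G h G1 h1, AM G h -> AM G1 h1 -> base a h = Q -> base a h1 = Q ->
  agree_lt a G G1 -> c (F \o G) = c (F \o G1).
have cdepF F G G' : agree_lt a.+1 G G' -> c (F \o G) = c (F \o G').
  by move=> GG; apply: cdep => w Dw wa /=; rewrite GG.
have [|F [g [FU FP]]] := @fusion Y Good.
  move=> Q F g FU.
  pose Dl := flatten [seq [seq take n (y l) | n <- iota 0 (size (y l)).+1] | l <- enum 'I_m].
  have DlP w : D w -> w \in Dl.
    move=> [l wl]; apply/flatten_mapP; exists l; first by rewrite mem_enum.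
    apply/mapP; exists (size w); first by rewrite mem_iota /= add0n ltnS size_prefix.
    by have /prefixP[u ->] := wl; rewrite take_size_cat.
  pose keyed (G : word -> word) := [ffun i : 'I_(size Dl) =>
    if (size (nth [::] Dl i) < a) && `[< D (nth [::] Dl i) >]
    then (insub (G (nth [::] Dl i)) : option (Q.-bseq letter)) else None].
  have keyedP G h G1 h1 : AM G h -> AM G1 h1 -> base a h = Q -> base a h1 = Q ->
      agree_lt a G G1 <-> keyed G = keyed G1.
    move=> GA G1A hQ h1Q; split=> [GG|/ffunP kk w Dw wa].
      apply/ffunP => i; rewrite [LHS]ffunE [RHS]ffunE.
      by case: ifP => // /andP[ia /asboolP iD]; rewrite GG.
    have iw : index w Dl < size Dl by rewrite index_mem DlP.
    have := kk (Ordinal iw); rewrite [LHS]ffunE [RHS]ffunE nth_index ?DlP // wa asboolT //=.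
    have sG := base_size GA hQ al Dw wa; have sG1 := base_size G1A h1Q al Dw wa.
    case: insubP => [u _ uE|]; last by rewrite ltnW.
    case: insubP => [v _ vE|]; last by rewrite ltnW.
    by move=> [uv]; rewrite -uE -vE uv.
  have [E [g' [EU Eid EP]]] : exists E g', [/\ UM E g', forall w, size w < Q -> E w = w &
      forall k, k \in enum {: {ffun 'I_(size Dl) -> option (Q.-bseq letter)}} ->
      forall G h G1 h1, AM G h -> AM G1 h1 -> base a h = Q -> base a h1 = Q ->
        keyed G = k -> keyed G1 = k -> c (F \o E \o G) = c (F \o E \o G1)].
    elim: (enum _) => [|k ks [E [g' [EU Eid EP]]]].
      by exists id, id; split=> //; exact: UM_id.
    have [[G0 [h0 [G0A h0Q k0]]]|nG] :=
      pselect (exists G0 h0, [/\ AM G0 h0, base a h0 = Q & keyed G0 = k]); last first.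
      exists E, g'; split=> // k'; rewrite inE => /orP[/eqP ->|/EP//].
      by move=> G h G1 h1 GA _ hQ _ kG; case: nG; exists G, h.
    have [E1 [g1 [E1U E1id [ε E1P]]]] :=
      hl_fixed_base al (c := fun X => c (F \o E \o X)) (cdepF (F \o E)) G0A.
    rewrite h0Q in E1id E1P.
    exists (E \o E1), (g' \o g1); split.
    - exact: UM_comp.
    - by move=> w wQ /=; rewrite E1id ?Eid.
    move=> k'; rewrite inE => /orP[/eqP ->|k's] G h G1 h1 GA G1A hQ h1Q kG kG1.
      have cE X hX : AM X hX -> base a hX = Q -> keyed X = k -> c (F \o (E \o E1) \o X) = ε.
        move=> XA hXQ Xk; apply: (E1P X hX XA hXQ).
        by apply/(keyedP _ _ _ _ XA G0A) => //; rewrite Xk.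
      by rewrite (cE G h) // (cE G1 h1).
    have kE X hX : AM X hX -> base a hX = Q -> keyed (E1 \o X) = keyed X.
      move=> XA hXQ; apply/esym/(keyedP _ _ _ _ XA (UM_AM E1U XA)) => //.
        exact: UM_base E1U E1id hXQ.
      by move=> w Dw wa /=; rewrite E1id //; exact: base_size XA hXQ al Dw wa.
    have := EP k' k's (E1 \o G) (g1 \o h) (E1 \o G1) (g1 \o h1).
    move=> K; apply: K.
    - exact: UM_AM.
    - exact: UM_AM.
    - exact: UM_base E1U E1id hQ.
    - exact: UM_base E1U E1id h1Q.
    - by rewrite (kE _ _ GA).
    - by rewrite (kE _ _ G1A).
  exists E, g'; split=> // G h G1 h1 GA G1A hQ h1Q GG.
  apply: (EP (keyed G) _ G h G1 h1) => //; first by rewrite mem_enum.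
  by apply/esym/(keyedP _ _ _ _ GA G1A hQ h1Q).
exists F, g; split=> // G h G1 h1 GA G1A GG.
have hh : base a h1 = base a h.
  rewrite /base; case: (a) al GG => [//|a'] al GG.
  have [|w Dw wa] := @D_level Y m y a'.
    by have [l ll] := al; exists l; exact: ltnW.
  by rewrite -wa -(AM_size GA) // -(AM_size G1A) // GG // wa.
have [F' [H [g1 [g2 [[F'U HU] Hid FGood FE]]]]] := FP (base a h) (maxn (h a) (h1 a)).
have cE X hX : AM X hX -> hX a <= maxn (h a) (h1 a) -> c (F \o X) = c (F' \o (H \o X)).
  move=> XA hXa; apply: cdep => w Dw; rewrite ltnS => wa /=.
  rewrite FE // (AM_size XA) //; apply: leq_trans hXa.
  by move: wa; rewrite leq_eqVlt => /orP[/eqP -> //|wa]; apply: ltnW; exact: (AM_lt XA).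
rewrite (cE _ _ GA) ?leq_maxl // (cE _ _ G1A) ?leq_maxr //.
apply: (FGood _ (g2 \o h) _ (g2 \o h1)).
- exact: UM_AM.
- exact: UM_AM.
- exact: UM_base HU Hid erefl.
- exact: UM_base HU Hid hh.
- by move=> w Dw wa /=; rewrite GG.
Qed.

Theorem ramsey_type (C : finType) (c : (word -> word) -> C) :
  (forall G G', (forall w, D w -> G w = G' w) -> c G = c G') ->
  exists F g, UM F g /\ exists ε, forall G h, AM G h -> c (F \o G) = ε.
Proof.
move=> cdep; pose a := (\max_l size (y l)).+1.
have {cdep} : forall G G', agree_lt a G G' -> c G = c G'.
  move=> G G' GG; apply: cdep => w Dw; apply: GG => //.
  have [l /size_prefix wl] := Dw; rewrite ltnS; apply: leq_trans wl _.
  exact: (leq_bigmax l).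
elim: a c => [|a IH] c cdep.
  exists id, id; split; first exact: UM_id.
  by exists (c id) => G h _; apply: cdep.
have [al|nal] := pselect (exists l, a <= size (y l)); last first.
  apply: IH => G G' GG; apply: cdep => w Dw; rewrite ltnS leq_eqVlt => /orP[/eqP wa|]; last exact: GG.
  by case: nal; have [l /size_prefix wl] := Dw; exists l; rewrite -wa.
have [F [g [FU FP]]] := ramsey_level al cdep.
(* The colour after [F] depends only on the levels below [a], so it may be read off any embedding of
   the type that agrees with [G] there. The default of [xget] occurs only if there is none. *)
pose vals G : set C := [set ε | exists G1 h1, [/\ AM G1 h1, agree_lt a G G1 & c (F \o G1) = ε]].
pose c' G := xget (c id) (vals G).
have [|F2 [g2 [F2U [ε F2P]]]] := IH c'.
  move=> G G' GG; rewrite /c'; congr xget; apply/seteqP; split=> e [G1 [h1 [G1A G1a G1c]]];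
    by exists G1, h1; split=> // w Dw wa;
      first [by rewrite -GG // G1a | by rewrite GG // G1a].
exists (F \o F2), (g \o g2); split; first exact: UM_comp.
exists ε => G h GA; rewrite -(F2P _ _ GA) /c'.
case: xgetP => [e _ [G1 [h1 [G1A G1a <-]]]|/(_ (c (F \o (F2 \o G))))].
  exact: (FP _ _ _ _ (UM_AM F2U GA) G1A G1a).
by case; exists (F2 \o G), (g2 \o h); split=> //; exact: UM_AM.
Qed.

End RamseyTypes.

(** * A copy of K in the tree *)

Section NiceCopy.
Variables (Y : coding) (T : countType).
Local Notation PF := (pat Y).
Local Notation Pt := 'I_(pts Y).+1.
Local Notation letter := (letter (rels Y) (pts Y) (pat Y)).
Local Notation word := (word Y).
Local Notation blank := (blank Y).
Local Notation kind := (@kind Y).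
Local Notation dn := (@dn Y).
Local Notation dA := (@dom Y).
Implicit Types (S : {set Pt}) (A : PF).

Variables (uK : T -> nat) (rK : T -> T -> 'I_(rels Y).+1) (φ : 'I_(rels Y).+1 -> 'I_(rels Y).+1).

Definition copy A (Q : {set Pt}) (h : Pt -> T) :=
  (forall b, b \in Q -> uK (h b) = ulab A b) /\
  forall b b', b \in Q -> b' \in Q -> b != b' -> rK (h b) (h b') = rlab A b b'.

(** With the points outside [S] realized by [h], vertices related to [h] as the [v b] are must not
    realize the rest of [A]. *)
Definition obstructs A S (h v : Pt -> T) := copy A (dA A :\: S) h /\
  forall b b', b \in S -> b' \in dA A :\: S -> rK (h b') (v b) = rlab A b' b.

Hypothesis rK_flip : forall u v, rK v u = φ (rK u v).
Hypothesis rlab_flip : forall A b b', b \in dA A -> b' \in dA A ->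
  rlab A b' b = φ (rlab A b b').
Hypothesis free : forall A h, ~ copy A (dA A) h.

Definition evcol A S (h : Pt -> T) (v : T) : letter :=
  (ord0, [set t : PF * {set Pt} * Pt | [&& t.1.1 == A, t.1.2 == S, t.2 \in S &
    `[< copy A (dA A :\: S) h /\
        forall b', b' \in dA A :\: S -> rK (h b') v = rlab A b' t.2 >]]])%SET.

Definition relcol (u v : T) : letter := (rK u v, finset.set0).

Definition hval i (u : T) (h : {ffun Pt -> 'I_i.+1}) b := odflt u (@pickle_inv T (h b)).

Definition events i (u : T) : seq (T -> letter) :=
  [seq evcol t.1.1 t.1.2 (hval u t.2) | t : PF * {set Pt} * {ffun Pt -> 'I_i.+1}].

(** Stages start at even length, so the columns land on even positions; the blanks fill the odd
    ones, which may happen to be vertices. *)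
Definition spaced (cs : seq (T -> letter)) : seq (T -> letter) :=
  flatten [seq [:: c; fun=> blank] | c <- cs].

(* Before the vertex u is placed, relcol u splits and the events kill at positions
   which are not vertices, so that nothing happens at the position of u itself. *)
Definition prestage i u := spaced (relcol u :: events i u).

Arguments prestage : simpl never.

Definition before i u (w : T -> word) v : word := w v ++ [seq c v | c <- prestage i u].

(** The blanks wait for a position coding the word and the label of [u]; the last letter of the
    stage sits at this vertex. If there is no vertex to place, two blanks keep the lengths even and
    growing. *)
Definition stage i (w : T -> word) (v : T) : word :=
  if @pickle_inv T i is Some u then
    before i u w v ++ nseq (waitS (before i u w u, uK u)) blank ++ [:: relcol u v]
  else w v ++ [:: blank; blank].

Fixpoint st i : T -> word := if i is i'.+1 then stage i' (st i') else fun=> [::].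

Lemma waitSP (s : word) n : kind (size s + waitS (s, n)) = Some (s, n).
Proof. by rewrite /waitS; case: cid. Qed.

Lemma size_spaced cs : size (spaced cs) = (size cs).*2.
Proof. by rewrite /spaced; elim: cs => //= c cs ->. Qed.

Lemma nth_spaced cs k v : nth blank [seq c v | c <- spaced cs] k =
  if odd k then blank else nth blank [seq c v | c <- cs] k./2.
Proof.
rewrite /spaced; elim: cs k => [|c cs IH] [|[|k]] //=; first by rewrite ?nth_nil ?if_same.
by rewrite IH negbK.
Qed.

Variable v0 : T.
Let L i := size (st i v0).

Lemma size_st i v : size (st i v) = L i.
Proof.
rewrite /L; elim: i => [//|i IH] /=; rewrite /stage.
by case: pickle_inv => [u|]; rewrite /before !size_cat /= ?size_nseq ?size_map IH.
Qed.

Lemma st_prefixS i v : prefix (st i v) (st i.+1 v).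
Proof.
rewrite /= /stage /before; case: pickle_inv => [u|]; last exact: prefix_prefix.
by rewrite -catA prefix_prefix.
Qed.

Lemma st_prefix i j v : i <= j -> prefix (st i v) (st j v).
Proof.
move=> /subnK <-; elim: (j - i) => [|k IH]; first exact: prefix_refl.
by apply: prefix_trans IH _; rewrite addSn; exact: st_prefixS.
Qed.

Lemma L_le i j : i <= j -> L i <= L j.
Proof. by move=> /(@st_prefix _ _ v0)/size_prefix. Qed.

Definition Pst i := (L i.+1).-1.

Lemma stageP i u : @pickle_inv T i = Some u ->
  [/\ L i.+1 = (Pst i).+1, L i + size (prestage i u) <= Pst i &
   kind (Pst i) = Some (before i u (st i) u, uK u)].
Proof.
move=> iu; rewrite /Pst.
have LS : L i.+1 = (L i + size (prestage i u) + waitS (before i u (st i) u, uK u)).+1.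
  rewrite /L /= /stage iu size_cat /before !size_cat /= size_nseq size_map.
  by rewrite addn1 addnS.
have sb : size (before i u (st i) u) = L i + size (prestage i u).
  by rewrite /before size_cat size_map size_st.
rewrite LS succnK; split=> //; first exact: leq_addr.
by rewrite -sb waitSP.
Qed.

Lemma L_even i : ~~ odd (L i).
Proof.
elim: i => [//|i IH]; case iu: (@pickle_inv T i) => [u|].
  have [-> _ kP] := stageP iu; rewrite /= negbK.
  by apply: contraPT kP => /kind_even ->.
by rewrite /L /= /stage iu size_cat oddD /= addbF.
Qed.

Lemma L_lt i : L i < L i.+1.
Proof.
case iu: (@pickle_inv T i) => [u|].
  have [-> le _] := stageP iu; rewrite ltnS; apply: leq_trans le; exact: leq_addr.
by rewrite /L /= /stage iu size_cat /= addn2.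
Qed.

Lemma L_mono i j : (L i < L j) = (i < j).
Proof.
apply/idP/idP => [|ij]; last exact: leq_trans (L_lt i) (L_le ij).
by apply: contraTT; rewrite -!leqNgt; exact: L_le.
Qed.

Lemma L_ge i : i <= L i.
Proof. by elim: i => // i IH; exact: leq_ltn_trans IH (L_lt i). Qed.

Lemma L_stage p : exists i, L i <= p < L i.+1.
Proof.
have ex : exists i, p < L i.+1 by exists p; exact: L_ge.
case: (ex_minnP ex) => i pi mi; exists i; rewrite pi andbT leqNgt; apply/negP => ip.
case: i pi mi ip => [//|i] pi mi ip.
by have := mi i ip; rewrite ltnn.
Qed.

Definition Wat v p : letter := at_ (st p.+1 v) p.

Lemma at_st i v p : p < L i -> at_ (st i v) p = Wat v p.
Proof.
move=> pi; rewrite /Wat; have pp : p < L p.+1 by exact: L_ge.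
have [ip|ip] := leqP i p.+1.
  by rewrite (at_prefix (st_prefix v ip)) // size_st.
by rewrite -(at_prefix (st_prefix v (ltnW ip))) // size_st.
Qed.

Definition kw v l : word := mkseq (Wat v) l.

Lemma size_kw v l : size (kw v l) = l.
Proof. exact: size_mkseq. Qed.

Lemma at_kw v l p : at_ (kw v l) p = if p < l then Wat v p else blank.
Proof.
case: ltnP => pl; first by rewrite /at_ nth_mkseq.
by rewrite at_blank // size_kw.
Qed.

Lemma Wat_stage i u v k : @pickle_inv T i = Some u -> L i + k < L i.+1 ->
  Wat v (L i + k) = if k < size (prestage i u) then
     if odd k then blank else nth blank [seq c v | c <- relcol u :: events i u] k./2
   else if L i + k == Pst i then relcol u v else blank.
Proof.
move=> iu kl; have [LS le _] := stageP iu.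
rewrite -(at_st v kl) [st _ _]/= /stage iu {1}/before /at_ -catA nth_cat size_st.
have -> : (L i + k < L i) = false by lia.
rewrite addKn nth_cat size_map; case: ltnP => kp; first by rewrite nth_spaced.
rewrite nth_cat size_nseq.
have E : L i.+1 = (L i + size (prestage i u) + waitS (before i u (st i) u, uK u)).+1.
  rewrite /L /= /stage iu size_cat /before !size_cat /= size_nseq size_map.
  by rewrite addn1 addnS.
rewrite /Pst E succnK; rewrite E in kl; case: ltnP => kw.
  by rewrite nth_nseq if_same; case: eqP => //; lia.
have -> : k - size (prestage i u) - waitS (before i u (st i) u, uK u) = 0 by lia.
by case: eqP => //; lia.
Qed.

Lemma pickle_inv_le i (h : Pt -> T) : (forall b, pickle (h b) <= i) ->
  exists f : {ffun Pt -> 'I_i.+1}, forall b, @pickle_inv T (f b) = Some (h b).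
Proof.
move=> hi; exists [ffun b => inord (pickle (h b))] => b.
by rewrite ffunE inordK ?ltnS // pickleK_inv.
Qed.

Lemma event_pos i u A S (h : Pt -> T) : @pickle_inv T i = Some u ->
  (forall b, pickle (h b) <= i) ->
  exists p, [/\ p < Pst i, ~~ odd p & forall v, Wat v p = evcol A S h v].
Proof.
move=> iu /pickle_inv_le[f fh]; have [LS le _] := stageP iu.
pose t : PF * {set Pt} * {ffun Pt -> 'I_i.+1} := (A, S, f).
have tI : index t (enum {: PF * {set Pt} * {ffun Pt -> 'I_i.+1}}) <
   size (enum {: PF * {set Pt} * {ffun Pt -> 'I_i.+1}}) by rewrite index_mem mem_enum.
set k := index _ _ in tI; pose k' := k.+1.*2.
have k'l : k' < size (prestage i u).
  by rewrite size_spaced ltn_double [size _]/= size_map ltnS.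
have kP : L i + k' < Pst i by apply: leq_trans le; rewrite ltn_add2l.
exists (L i + k'); split=> // [|v]; first by rewrite oddD negb_add (negbTE (L_even i)) odd_double.
rewrite (Wat_stage v iu); last by rewrite LS; exact: ltnW.
rewrite k'l odd_double half_double /= (nth_map (fun=> blank)); last by rewrite size_map.
rewrite (nth_map t) // nth_index ?mem_enum //= /t /=.
congr (evcol _ _ _ _); apply: funext => b; by rewrite /hval fh.
Qed.

Lemma Wat_cases p : [\/ forall v, Wat v p = blank,
  exists i u, [/\ @pickle_inv T i = Some u, p = Pst i & forall v, Wat v p = relcol u v],
  ~~ odd p /\ exists u, forall v, Wat v p = relcol u v |
  ~~ odd p /\ exists i A S h, [/\ L i <= p, forall b, pickle (h b) <= i &
    forall v, Wat v p = evcol A S h v]].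
Proof.
have [i /andP[ip pi]] := L_stage p.
rewrite -(subnKC ip) in pi *; set k := p - L i in pi *.
case iu: (@pickle_inv T i) => [u|]; last first.
  apply: Or41 => v; rewrite -(at_st v pi) /= /stage iu /at_ nth_cat size_st ltnNge leq_addr /=.
  by rewrite addKn; case: (k) => [|[|[]]].
have W v := Wat_stage v iu pi.
have [kl|kl] := ltnP k (size (prestage i u)); last first.
  have [pE|pE] := eqVneq (L i + k) (Pst i).
    apply: Or42; exists i, u; split=> // v.
    by rewrite W ltnNge kl /= pE eqxx.
  by apply: Or41 => v; rewrite W ltnNge kl /= (negbTE pE).
have [ok|ek] := boolP (odd k); first by apply: Or41 => v; rewrite W kl ok.
have oL : ~~ odd (L i + k) by rewrite oddD negb_add (negbTE (L_even i)) (negbTE ek).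
case k2: (k./2) => [|k'].
  apply: Or43; split=> //; exists u => v; by rewrite W kl (negbTE ek) k2.
apply: Or44; split=> //.
have k'l : k' < size (enum {: PF * {set Pt} * {ffun Pt -> 'I_i.+1}}).
  move: kl; rewrite size_spaced [size (_ :: _)]/= size_map.
  by have := odd_double_half k; rewrite k2 (negbTE ek) -!muln2; lia.
have [t0 _] : exists t0 : PF * {set Pt} * {ffun Pt -> 'I_i.+1}, True.
  by case: (enum _) k'l => // t0 s _; exists t0.
pose t := nth t0 (enum {: PF * {set Pt} * {ffun Pt -> 'I_i.+1}}) k'.
exists i, t.1.1, t.1.2, (hval u t.2); split; first exact: leq_addr.
  move=> b; rewrite /hval; have := ltn_ord (t.2 b); case hE: (@pickle_inv T (t.2 b)) => [x|] /=.
    have := @pickle_invK T (t.2 b); rewrite /ocancel hE /= => ->.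
    by rewrite ltnS.
  by have := @pickle_invK T i; rewrite iu /= => ->.
move=> v; rewrite W kl (negbTE ek) k2 /= (nth_map (fun=> blank)); last by rewrite size_map.
by rewrite (nth_map t0).
Qed.

Lemma kw_before i u : @pickle_inv T i = Some u ->
  forall p, at_ (before i u (st i) u) p = if p < Pst i then
    (if p < L i + size (prestage i u) then Wat u p else blank) else blank.
Proof.
move=> iu p; have [LS le kP] := stageP iu.
have sb : size (before i u (st i) u) = L i + size (prestage i u).
  by rewrite /before size_cat size_map size_st.
have [pl|pl] := ltnP p (L i + size (prestage i u)); last first.
  by rewrite if_same at_blank // sb.
rewrite (leq_trans pl le) -(@at_st i.+1) ?LS; last by rewrite ltnS ltnW // (leq_trans pl le).
by rewrite /= /stage iu /at_ nth_cat sb pl.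
Qed.

Lemma kw_dn i u : @pickle_inv T i = Some u -> dn (Pst i) = kw u (Pst i).
Proof.
move=> iu; have [LS le kP] := stageP iu.
apply: (@eq_from_nth _ blank) => [|p]; rewrite (size_dn kP) ?size_kw // => pP.
rewrite -!/(at_ _ p) at_kw pP (at_dn _ kP) (kw_before iu) pP; case: ifP => // /negbT.
rewrite -leqNgt => pl.
have pL : L i <= p by apply: leq_trans pl; exact: leq_addr.
have := @Wat_stage i u u (p - L i) iu; rewrite subnKC // LS => /(_ (ltnW pP)) ->.
by rewrite (ltn_eqF pP); case: ltnP => //; lia.
Qed.

Lemma evcolP A S A' S' h v b : ((A', S', b) : PF * {set Pt} * Pt) \in (evcol A S h v).2 ->
  [/\ A' = A, S' = S, b \in S, copy A (dA A :\: S) h &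
   forall b', b' \in dA A :\: S -> rK (h b') v = rlab A b' b].
Proof. by rewrite inE /= => /and4P[/eqP -> /eqP -> bS /asboolP[]]. Qed.

(* Soundness: a killed family of approximations to vertices of the structure is
   killed by actual vertices, enumerated before. *)
Lemma Dead_obstructs l A S x v :
  (forall b p, b \in S -> at_ (x b) p != blank -> p < l /\ at_ (x b) p = Wat (v b) p) ->
  S != finset.set0 -> Dead A S x ->
  exists2 h, obstructs A S h v & forall b, b \in dA A :\: S ->
    exists2 j, pickle (h b) <= j & L j < l.
Proof.
move=> xv S0 D; elim: D v xv S0 => {S x} [x|S x p kp ro|S x p cw ν b0 kp SA b0A b0S u ro _ IH] v xv S0.
- exists v; first by split; [split|] => [b|b b'|b b' _]; rewrite finset.setDv inE.
  by move=> b; rewrite finset.setDv inE.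
- have [b1 b1S] := set0Pn _ S0.
  have nb b : b \in S -> at_ (x b) p != blank.
    by move=> bS; apply/eqP => xb; have := ro b bS; rewrite xb inE.
  have rW b : b \in S -> ((A, S, b) : PF * {set Pt} * Pt) \in (Wat (v b) p).2.
    by move=> bS; have [_ <-] := xv b p bS (nb b bS); exact: ro.
  have [pl _] := xv b1 p b1S (nb b1 b1S).
  have rb := rW b1 b1S.
  case: (Wat_cases p) => [W|[i [u [_ _ W]]]|[_ [u W]]|[_ [i [A' [S' [h [ip hi W]]]]]]].
  + by rewrite W inE in rb.
  + by rewrite W inE in rb.
  + by rewrite W inE in rb.
  + have {}rW b : b \in S -> ((A, S, b) : PF * {set Pt} * Pt) \in (evcol A' S' h (v b)).2.
      by rewrite -W; exact: rW.
    have [AA SS _ cp _] := evcolP (rW b1 b1S); rewrite -AA -SS in cp.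
    exists h; last by move=> b _; exists i; rewrite ?hi //; exact: leq_ltn_trans ip pl.
    split=> // b b' bS b'S; have [_ _ _ _] := evcolP (rW b bS).
    by rewrite -AA -SS; apply.
- have [b1 b1S] := set0Pn _ S0.
  have nb b : b \in S -> at_ (x b) p != blank.
    by move=> bS; exact: (rel_nblank SA b0A b0S bS (ro b bS)).
  have po : odd p by apply: contraPT kp => /kind_even ->.
  have [pl W1] := xv b1 p b1S (nb b1 b1S).
  case: (Wat_cases p) => [W|[i [w [iw pE W]]]|[]|[]]; rewrite ?po //.
    by have := nb b1 b1S; rewrite W1 W eqxx.
  have [LS le kP] := stageP iw; have kp' := kp; rewrite pE kP in kp'.
  have [cwE νE] : before i w (st i) w = cw /\ uK w = ν by case: kp'.
  have [|| h [[cu cr] hr] hj] := IH (fun b => if b == b0 then w else v b).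
  + move=> b q; rewrite /upd !inE; case: eqP => [_ _|/= _ bS]; last exact: xv.
    rewrite -cwE (kw_before iw); case: ifP; last by rewrite eqxx.
    case: ifP; last by rewrite eqxx.
    by move=> _ qP _; split=> //; apply: ltn_trans pl; rewrite pE.
  + by apply/set0Pn; exists b0; rewrite !inE eqxx.
  have hw b' : b' \in dA A :\: (b0 |: S) -> rK (h b') w = rlab A b' b0.
    by move=> b'D; have := hr b0 b' (finset.setU11 b0 S) b'D; rewrite eqxx.
  have DS b : b \in dA A :\: S -> b <> b0 -> b \in dA A :\: (b0 |: S).
    by rewrite !inE => /andP[bS bA] /eqP bb0; rewrite negb_or bb0 bS bA.
  exists (fun b => if b == b0 then w else h b).
    split; first split.
    * move=> b bD; case: eqP => [->|bb0]; first by rewrite νE u.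
      exact/cu/DS.
    * move=> b b' bD b'D; case: (b =P b0) => [->|bb0]; case: (b' =P b0) => [->|b'b0].
      - by rewrite eqxx.
      - move=> _; have b'D' := DS _ b'D b'b0; rewrite rK_flip hw // -rlab_flip //.
        by move: b'D; rewrite inE => /andP[].
      - by move=> _; apply/hw/DS.
      - by move=> bb'; apply: cr => //; exact: DS.
    * move=> b b' bS b'D; case: eqP => [->|b'b0].
        have [_ E] := xv b p bS (nb b bS).
        by have := ro b bS; rewrite E W.
      have bb0 : b <> b0 by move=> bE; move: b0S; rewrite -bE bS.
      by have := hr b b' (finset.setU1r b0 bS) (DS _ b'D b'b0); case: eqP.
  move=> b bD; case: eqP => [_|bb0]; last exact/hj/DS.
  exists i; first by have := @pickle_invK T i; rewrite iw /= => ->.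
  by apply: leq_ltn_trans pl; rewrite pE; apply: leq_trans le; exact: leq_addr.
Qed.

(** Stage i lists all patterns over vertices enumerated up to i, so the obstruction is killed before
    the position of the vertex of stage i. *)
Lemma obstructs_Dead i u A S h v : @pickle_inv T i = Some u -> obstructs A S h v ->
  (forall b, b \in dA A :\: S -> pickle (h b) <= i) ->
  Dead A S (fun b => kw (v b) (Pst i)).
Proof.
move=> iu [[cu cr] hr] hi.
pose h' b := if b \in dA A :\: S then h b else u.
have [|p [pP po W]] := @event_pos i u A S h' iu.
  move=> b; rewrite /h'; case: ifP => [/hi//|_].
  by have := @pickle_invK T i; rewrite iu /= => ->.
apply: (@Dead_abs _ A S _ p) => [|b bS]; first exact: kind_even.
rewrite at_kw pP W inE /= !eqxx bS /=; apply/asboolP; split; first split.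
- by move=> b' b'D; rewrite /h' b'D cu.
- by move=> b' b'' b'D b''D bb; rewrite /h' b'D b''D cr.
- by move=> b' b'D; rewrite /h' b'D; exact: hr.
Qed.

(** At a vertex position outside the copy the column is blank. At the vertex of stage i a kill comes
    from obstructing vertices enumerated up to i, and the matching event of this stage came
    earlier. *)
Lemma kw_no_kill p A S v : kind p <> None ->
  Dead A S (fun b => kw (v b) p.+1) -> Dead A S (fun b => kw (v b) p).
Proof.
move=> kp DD; have [->|S0] := eqVneq S finset.set0; first exact: Dead_set0.
have po : odd p by apply/negPn/negP => /kind_even.
case: (Wat_cases p) => [W|[i [u [iu pE W]]]|[]|[]]; rewrite ?po //.
  apply: Dead_eq DD => b q _; rewrite !at_kw ltnS leq_eqVlt.
  by case: eqP => [->|//]; rewrite ltnn W.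
have [|h hv hj] := Dead_obstructs (l := p.+1) (v := v) _ S0 DD.
  by move=> b q _; rewrite at_kw; case: ltnP => //; rewrite eqxx.
have [LS _ _] := stageP iu.
rewrite pE; apply: (obstructs_Dead iu hv) => b /hj[j pj].
by rewrite pE -LS L_mono ltnS; exact: leq_trans.
Qed.

(** The column [relcol u] occurs twice in its stage: at [L i], where it may split words, and at the
    vertex itself. *)
Lemma kw_no_split p v w : kind p <> None -> (forall q, q < p -> Wat v q = Wat w q) ->
  Wat v p = Wat w p.
Proof.
move=> kp vw; have po : odd p by apply/negPn/negP => /kind_even.
case: (Wat_cases p) => [W|[i [u [iu pE W]]]|[]|[]]; rewrite ?po ?W //.
have [LS le _] := stageP iu; have s0 : 0 < size (prestage i u) by rewrite size_spaced.
have Lp : L i < p by rewrite pE; apply: leq_trans le; rewrite -addn1 leq_add2l.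
have := vw _ Lp.
have Wi x : Wat x (L i) = relcol u x.
  have := @Wat_stage i u x 0 iu; rewrite addn0 s0 /= => -> //; exact: L_lt.
by rewrite !Wi.
Qed.

Lemma nice_copy_inhab : exists (W : T -> nat -> letter) (P : T -> nat), [/\
  (forall v, (exists cw, kind (P v) = Some (cw, uK v)) /\ dn (P v) = mkseq (W v) (P v)),
  injective P /\ (forall u v, P u < P v -> (W v (P u)).1 = rK u v),
  (forall p v w, kind p <> None -> (forall q, q < p -> W v q = W w q) -> W v p = W w p),
  (forall p A S v, kind p <> None ->
    Dead A S (fun b => mkseq (W (v b)) p.+1) -> Dead A S (fun b => mkseq (W (v b)) p)) &
  forall v A b, ulab A b = uK v -> ~ Dead A [set b]%SET (fun=> dn (P v))].
Proof.
have iv v : @pickle_inv T (pickle v) = Some v by exact: pickleK_inv.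
exists Wat, (fun v => Pst (pickle v)); split.
- move=> v; have [_ _ kP] := stageP (iv v); split; last exact: kw_dn.
  by exists (before (pickle v) v (st (pickle v)) v).
- split=> [u v uv|u v _].
    apply: (pcan_inj (@pickleK T)).
    have [LSu _ _] := stageP (iv u); have [LSv _ _] := stageP (iv v).
    have LL : L (pickle u).+1 = L (pickle v).+1 by rewrite LSu LSv uv.
    by case: (ltngtP (pickle u) (pickle v)) => //; rewrite -ltnS -L_mono LL ltnn.
  have [LS le _] := stageP (iv u).
  have Lp : L (pickle u) <= Pst (pickle u) by apply: leq_trans le; exact: leq_addr.
  have := @Wat_stage _ _ v (Pst (pickle u) - L (pickle u)) (iv u).
  rewrite subnKC // LS => /(_ (ltnSn _)) ->.
  by rewrite eqxx; case: ltnP => //; lia.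
- exact: kw_no_split.
- exact: kw_no_kill.
(* A dead singleton would produce vertices which together with [v] form a copy of [A]. *)
- move=> v A b ub DD; have [_ _ kP] := stageP (iv v).
  have [||h [[cu cr] hr] _] := Dead_obstructs (l := Pst (pickle v)) (v := fun=> v) _ _ DD.
  + move=> b' q _; rewrite (kw_dn (iv v)) at_kw; case: ltnP => //; by rewrite eqxx.
  + by apply/set0Pn; exists b; rewrite inE.
  have DS b' : b' \in dA A -> b' <> b -> b' \in dA A :\ b.
    by rewrite !inE => -> /eqP ->.
  apply: (@free A (fun b' => if b' == b then v else h b')); split.
    move=> b' b'A; case: eqP => [-> //|b'b]; exact/cu/DS.
  move=> b1 b2; case: (b1 =P b) => [->|b1b] b1A; case: (b2 =P b) => [->|b2b] b2A.
  + by rewrite eqxx.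
  + by move=> _; rewrite rK_flip (hr b _ (finset.set11 b) (DS _ b2A b2b)) -rlab_flip.
  + by move=> _; apply: (hr b) => //; [rewrite inE|exact: DS].
  + by move=> bb; apply: cr => //; exact: DS.
Qed.

End NiceCopy.

(** * Similarity types of tuples *)

Lemma prefix_mkseq (T : eqType) (f : nat -> T) i j : i <= j -> prefix (mkseq f i) (mkseq f j).
Proof. by move=> ij; rewrite /mkseq -[in iota 0 j](subnKC ij) iotaD map_cat prefix_prefix. Qed.

Lemma sorted_nth_lt (s : seq nat) i j : sorted ltn s -> i < j -> j < size s ->
  nth 0 s i < nth 0 s j.
Proof.
move=> ss ij js; apply: (sorted_ltn_nth ltn_trans) => //.
by rewrite inE; exact: ltn_trans js.
Qed.

Lemma sorted_nth_ltE (s : seq nat) i j : sorted ltn s -> i < size s -> j < size s ->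
  (nth 0 s i < nth 0 s j) = (i < j).
Proof.
move=> ss si sj; case: (ltngtP i j) => [ij|ji|->]; last by rewrite ltnn.
- exact: sorted_nth_lt.
- by apply/negbTE; rewrite -leqNgt ltnW //; exact: sorted_nth_lt.
Qed.

Section First.
Implicit Types Q : nat -> Prop.

(* 0 if Q is empty *)
Definition fstp Q : nat :=
  match pselect (exists p, `[< Q p >]) with
  | left ex => (ex_minn ex).+1
  | right _ => 0
  end.

Lemma fstpS Q p : fstp Q = p.+1 -> Q p /\ forall q, q < p -> ~ Q q.
Proof.
rewrite /fstp; case: pselect => // ex [].
case: ex_minnP => m /asboolP Qm mm <-; split=> // q qm Qq.
by have := mm q; rewrite asboolT // => /(_ erefl); rewrite leqNgt qm.
Qed.

Lemma fstp_ex Q p : Q p -> exists2 q, q <= p & fstp Q = q.+1.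
Proof.
move=> Qp; rewrite /fstp; case: pselect => [ex|[]]; last by exists p; apply/asboolP.
case: ex_minnP => m _ mm; exists m => //; apply: mm; exact/asboolP.
Qed.
End First.

(** * Similarity types determined by boundedly many entries *)

Section Bounded.
Variables (Y : coding) (T : Type).
Local Notation PF := (pat Y).
Local Notation Pt := 'I_(pts Y).+1.
Local Notation letter := (letter (rels Y) (pts Y) (pat Y)).
Local Notation word := (word Y).
Local Notation blank := (blank Y).
Local Notation kind := (@kind Y).
Local Notation dn := (@dn Y).
Implicit Types (S : {set Pt}) (A : PF).
Variables (uK : T -> nat) (W : T -> nat -> letter) (P : T -> nat).
Hypothesis coderP : forall v,
  (exists cw, kind (P v) = Some (cw, uK v)) /\ dn (P v) = mkseq (W v) (P v).
Hypothesis no_split : forall p v w, kind p <> None ->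
  (forall q, q < p -> W v q = W w q) -> W v p = W w p.
Hypothesis no_kill : forall p A S v, kind p <> None ->
    Dead A S (fun b => mkseq (W (v b)) p.+1) -> Dead A S (fun b => mkseq (W (v b)) p).

(** A kill involves at most [pts Y + 1] entries; one more makes [ord0] and [ord_max] distinct, as a
    splitting requires. *)
Local Notation q := (pts Y).+2.

(* Lengths (None), splittings and first kills of a tuple: the positions that
   determine its similarity type *)
Definition code := option (option (PF * {set Pt})).

Definition pos_split v w := fstp (fun p => [/\ p < P v, p < P w & W v p <> W w p]).

Definition pos_kill A S (v : Pt -> T) := fstp (fun p => [/\ forall b, p < P (v b),
  Dead A S (fun b => mkseq (W (v b)) p.+1) & ~ Dead A S (fun b => mkseq (W (v b)) p)]).

Definition pos (c : code) (t : 'I_q -> T) : nat :=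
  match c with
  | None => (P (t ord0)).+1
  | Some None => pos_split (t ord0) (t ord_max)
  | Some (Some AS) => pos_kill AS.1 AS.2 (fun b => t (widen_ord (leqnSn _) b))
  end.

Lemma pos_kind c t p : pos c t = p.+1 -> (exists i, P (t i) = p) \/ kind p = None.
Proof.
case: c => [[[A S]|]|] /=.
- move=> /fstpS[[_ D nD] _]; right; apply: contrapT => kp; apply: nD.
  exact: no_kill.
- move=> /fstpS[[pv pw vw] mn]; right; apply: contrapT => kp; apply: vw.
  apply: no_split => // r rp; apply: contrapT => vw.
  by apply: (mn r rp); split=> //; exact: ltn_trans rp _.
- by move=> [<-]; left; exists ord0.
Qed.

Section OneTuple.
Variables (m : nat) (ρ : 'I_m -> T) (ps : seq nat) (k : 'I_m -> nat).
Hypothesis ps_sorted : sorted ltn ps.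
Hypothesis k_lt : forall l, k l < size ps.
Hypothesis k_nth : forall l, nth 0 ps (k l) = P (ρ l).
Hypothesis ps_all : forall c (κ : 'I_q -> 'I_m) p, pos c (ρ \o κ) = p.+1 -> p \in ps.
Hypothesis ps_pos : forall p, p \in ps -> exists c (κ : 'I_q -> 'I_m), pos c (ρ \o κ) = p.+1.

Let h := nth 0 ps.
(** The similarity type of [ρ]: the words of its vertices, reduced to the relevant positions
    [ps]. *)
Definition tword l : word := mkseq (fun a => W (ρ l) (h a)) (k l).

Lemma h_index p n : p \in ps -> n < size ps -> p < h n -> exists2 j, j < n & p = h j.
Proof.
move=> pps nps ph; have ip : index p ps < size ps by rewrite index_mem.
exists (index p ps); last by rewrite /h nth_index.
by rewrite -(sorted_nth_ltE ps_sorted) // nth_index.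
Qed.

Lemma h_le a b : b < size ps -> a <= b -> h a <= h b.
Proof.
move=> bs; rewrite leq_eqVlt => /orP[/eqP -> //|ab].
by apply: ltnW; exact: sorted_nth_lt.
Qed.

Lemma tword_prefix w l : prefix w (tword l) ->
  size w <= k l /\ forall a, a < size w -> at_ w a = W (ρ l) (h a).
Proof.
move=> wl; have := size_prefix wl; rewrite size_mkseq => wk; split=> // a aw.
by rewrite -(at_prefix wl) // /at_ nth_mkseq //; exact: leq_trans wk.
Qed.

Lemma tword_agree w l l' : prefix w (tword l) -> prefix w (tword l') ->
  mkseq (W (ρ l)) (h (size w)) = mkseq (W (ρ l')) (h (size w)).
Proof.
move=> /tword_prefix[wk wW] /tword_prefix[wk' wW'].
apply/eq_in_map => p; rewrite mem_iota /= add0n => pw; apply: contrapT => Wp.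
have hP : p < P (ρ l) by rewrite -k_nth; apply: leq_trans pw _; exact: h_le.
have hP' : p < P (ρ l') by rewrite -k_nth; apply: leq_trans pw _; exact: h_le.
pose κ (i : 'I_q) := if i == ord0 then l else l'.
have [r rp rE] := @fstp_ex (fun p => [/\ p < P (ρ l), p < P (ρ l') & W (ρ l) p <> W (ρ l') p]) p
  (And3 hP hP' Wp).
have rps : r \in ps by apply: (@ps_all (Some None) κ); rewrite /= /pos_split /κ.
have wps : size w < size ps by exact: leq_ltn_trans wk (k_lt l).
have [j jw rj] := h_index rps wps (leq_ltn_trans rp pw).
have [[_ _ +] _] := fstpS rE; apply.
by rewrite rj -wW // -wW'.
Qed.

(** [G] sends a reduced word to the full word through it. It is safe because the first kill of a
    family is a relevant position, and none lies between the end [t0] of the arrow and [h n]. *)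
Lemma tuple_AM : exists G, AM tword (fun l => uK (ρ l)) G h.
Proof.
pose G w : word := match pselect (exists l, prefix w (tword l)) with
  | left ex => mkseq (W (ρ (projT1 (cid ex)))) (h (size w)) | right _ => [::] end.
have GE w l : prefix w (tword l) -> G w = mkseq (W (ρ l)) (h (size w)).
  move=> wl; rewrite /G; case: pselect => [ex|[]]; last by exists l.
  by case: cid => l' wl' /=; exact: tword_agree.
have GrE w e l : prefix (rcons w e) (tword l) ->
    rcons (G w) e = mkseq (W (ρ l)) (h (size w)).+1.
  move=> wel; have [_ W1] := tword_prefix wel.
  rewrite (GE w l) ?mkseqS; last exact: prefix_trans (prefix_rcons _ _) wel.
  have := W1 (size w); rewrite size_rcons => /(_ (ltnSn _)).
  by rewrite at_rcons eqxx => <-.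
exists G; split.
- move=> w e [l wel]; have [wk _] := tword_prefix wel; rewrite size_rcons in wk.
  rewrite (GrE w e l wel) (GE _ _ wel) size_rcons; apply: prefix_mkseq.
  by apply: sorted_nth_lt => //; exact: leq_ltn_trans wk (k_lt l).
- by move=> w [l wl]; rewrite (GE w l wl) size_mkseq.
- move=> A S n b bn DD.
  have [l lP] := choice (fun i => (bn i).1).
  have nk i : n <= k (l i) by have [+ _] := tword_prefix (lP i); rewrite (bn i).2.
  pose z t i := mkseq (W (ρ (l i))) t.
  have DZ : Dead A S (z (h n)).
    by apply: Dead_eq DD => i p _ /=; rewrite (GE _ _ (lP i)) (bn i).2.
  have [t0 [t0P t0h]] : exists t0, arrow G \o b = z t0 /\ forall p, p < h n -> p \in ps -> p < t0.
    case: n bn nk {DD DZ} => [|n] bn nk.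
      exists 0; split=> [|p ph pps].
        by apply: funext => i /=; rewrite /arrow (bn i).2.
      by have [] := h_index pps (leq_ltn_trans (nk ord0) (k_lt _)) ph.
    exists (h n).+1; split=> [|p ph pps].
      apply: funext => i /=; have wn := (bn i).2.
      rewrite /arrow wn (GrE _ _ (l i)) ?size_takel ?wn //.
      by rewrite take_at.
    have nps := leq_ltn_trans (nk ord0) (k_lt _).
    have [j jn ->] := h_index pps nps ph.
    by rewrite ltnS; apply: h_le => //; exact: ltnW.
  rewrite t0P; apply: contrapT => nD.
  have mono t t' : t <= t' -> Dead A S (z t) -> Dead A S (z t').
    by move=> tt; apply: Dead_prefix => i _; exact: prefix_mkseq.
  have [p [ph pD npD]] : exists p, [/\ p < h n, Dead A S (z p.+1) & ~ Dead A S (z p)].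
    have ex : exists t, `[< Dead A S (z t) >] by exists (h n); apply/asboolP.
    case: (ex_minnP ex) => t /asboolP tD tm.
    have t_gt : t0 < t by rewrite ltnNge; apply/negP => /mono /(_ tD).
    case: t tD tm t_gt => // p pD pm _; exists p; split=> //.
      by apply: pm; apply/asboolP.
    by move=> pD'; have := pm p; rewrite asboolT // => /(_ erefl); rewrite ltnn.
  have pP i : p < P (ρ (l i)).
    by rewrite -k_nth; apply: leq_trans ph _; apply: h_le.
  have [r rp rE] := @fstp_ex (fun p => [/\ forall i, p < P (ρ (l i)),
     Dead A S (z p.+1) & ~ Dead A S (z p)]) p (And3 pP pD npD).
  have rps : r \in ps.
    apply: (@ps_all (Some (Some (A, S))) (fun i => l (inord i))).
    rewrite /=; set v := (X in pos_kill _ _ X).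
    have -> : v = ρ \o l by apply: funext => i; rewrite /v /= inord_val.
    exact: rE.
  have [[_ rD _] _] := fstpS rE.
  apply: nD; apply: mono rD; apply: t0h => //.
  exact: leq_ltn_trans rp ph.
- move=> l; rewrite (GE _ l) ?prefix_refl // size_mkseq /h k_nth.
  by have [? ->] := coderP (ρ l).
- move=> n [l nl] nn; rewrite size_mkseq in nl.
  have nps : n < size ps by exact: leq_ltn_trans nl (k_lt l).
  have [c [κ /pos_kind[[i iE]|//]]] := ps_pos (mem_nth 0 nps).
  case: (nn (κ i)); rewrite size_mkseq; move: iE => /= iE.
  have := k_nth (κ i); rewrite iE => /eqP; rewrite nth_uniq // => [/eqP //|].
  by move: ps_sorted; rewrite ltn_sorted_uniq_leq => /andP[].
Qed.

End OneTuple.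

Lemma ramsey_types m B M (D : finType) (γ : ('I_m -> nat) -> D)
    (ts : seq {ffun 'I_m -> B.-bseq letter * 'I_M}) :
  exists (F : word -> word) g, UM F g /\ forall t, t \in ts -> exists ε, forall G h,
    AM (fun l => (t l).1 : word) (fun l => (t l).2 : nat) G h ->
    γ (fun l => g (h (size (t l).1))) = ε.
Proof.
elim: ts => [|t ts [F [g [FU FP]]]]; first by exists id, id; split=> //; exact: UM_id.
pose y l : word := (t l).1.
pose c (X : word -> word) := γ (fun l => size (F (X (y l)))).
have [|F2 [g2 [F2U [ε F2P]]]] := ramsey_type (y := y) (fun l => (t l).2 : nat) (c := c).
  move=> G G' GG; rewrite /c; congr γ; apply: funext => l.
  by rewrite GG //; exists l; exact: prefix_refl.
exists (F \o F2), (g \o g2); split; first exact: UM_comp.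
move=> t'; rewrite inE => /orP[/eqP ->|/FP[ε' P']].
  exists ε => G h GA; rewrite -(F2P G h GA) /c; congr γ; apply: funext => l /=.
  rewrite (UM_size FU) (UM_size F2U) (AM_size GA) //.
  by exists l; exact: prefix_refl.
exists ε' => G h GA; rewrite -(P' (F2 \o G) (g2 \o h)) //.
exact: UM_AM.
Qed.

Local Notation ls_ := (@lshift q q).
Local Notation rs_ := (@rshift q q).

(** [χ] compares the positions of two q-tuples, reads letters there, and records which positions
    exist and a label. On all reindexings of [ρ] this determines the similarity type, and there are
    finitely many types of [m]-tuples. *)
Lemma bounded_ramsey M : (forall v, uK v < M) ->
  exists r (C : finType) (χ : ('I_r -> T) -> C),
  forall m (D : finType) (γ : ('I_m -> nat) -> D), exists (F : word -> word) g, UM F g /\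
  forall ρ ρ' : 'I_m -> T, (forall σ : 'I_r -> 'I_m, χ (ρ \o σ) = χ (ρ' \o σ)) ->
    γ (fun l => g (P (ρ l))) = γ (fun l => g (P (ρ' l))).
Proof.
case: M => [|M] uM.
  exists 0, unit, (fun=> tt) => m D γ; exists id, id; split; first exact: UM_id.
  by move=> ρ ρ' _; congr γ; apply: funext => l; have := uM (ρ l).
pose χ (t : 'I_(q + q) -> T) := ([ffun cc : code * code =>
    pos cc.1 (t \o ls_) < pos cc.2 (t \o rs_)],
  [ffun c : code => W (t (rs_ ord0)) (pos c (t \o ls_)).-1],
  [ffun c : code => 0 < pos c (t \o ls_)],
  inord (uK (t ord0)) : 'I_M.+1).
exists (q + q)%N, _, χ => m D γ.
pose term : finType := (code * {ffun 'I_q -> 'I_m})%type.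
have [F [g [FU FP]]] := ramsey_types γ (enum {: {ffun 'I_m -> #|term|.-bseq letter * 'I_M.+1}}).
exists F, g; split=> // ρ ρ' χE.
pose u (ρ : 'I_m -> T) (α : term) := pos α.1 (ρ \o α.2).
have joinE (κ κ' : 'I_q -> 'I_m) : exists σ : 'I_(q + q) -> 'I_m,
    (forall i, σ (ls_ i) = κ i) /\ forall i, σ (rs_ i) = κ' i.
  exists (fun i => match fintype.split i with inl a => κ a | inr b => κ' b end).
  by split=> i; [rewrite (unsplitK (inl i))|rewrite (unsplitK (inr i))].
have info (κ κ' : 'I_q -> 'I_m) : [/\
    forall c c', (pos c (ρ \o κ) < pos c' (ρ \o κ')) = (pos c (ρ' \o κ) < pos c' (ρ' \o κ')),
    forall c, W (ρ (κ' ord0)) (pos c (ρ \o κ)).-1 = W (ρ' (κ' ord0)) (pos c (ρ' \o κ)).-1,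
    forall c, (0 < pos c (ρ \o κ)) = (0 < pos c (ρ' \o κ)) &
    uK (ρ (κ ord0)) = uK (ρ' (κ ord0))].
  have [σ [σl σr]] := joinE κ κ'.
  have El (τ : 'I_m -> T) : (τ \o σ) \o ls_ = τ \o κ by apply: funext => i /=; rewrite σl.
  have Er (τ : 'I_m -> T) : (τ \o σ) \o rs_ = τ \o κ' by apply: funext => i /=; rewrite σr.
  have := χE σ; rewrite /χ => -[/ffunP E1 /ffunP E2 /ffunP E3 E4]; split.
  - by move=> c c'; have := E1 (c, c'); rewrite !ffunE /= !El !Er.
  - by move=> c; have := E2 c; rewrite !ffunE !El /= !σr.
  - by move=> c; have := E3 c; rewrite !ffunE !El.
  - have e0 : ord0 = ls_ ord0 by exact: val_inj.
    by move: E4; rewrite e0 σl => /(congr1 (@nat_of_ord _)); rewrite !inordK.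
have uu : oiso (u ρ) (u ρ').
  by move=> [c κ] [c' κ']; have [E _ _ _] := info κ κ'; exact: E.
have [rs [s1 s2 rs_uniq rsP]] := oiso_enum uu.
(* The value 0 stands for a missing position and is dropped. *)
pose rs0 := [seq α <- rs | 0 < u ρ α].
have u0 α : (0 < u ρ α) = (0 < u ρ' α).
  by case: α => c κ; have [_ _ E _] := info κ κ; exact: E.
pose lt l : term := (None, [ffun=> l]).
have [j jP] := choice (fun l => rsP (lt l)).
have ulen τ l : u τ (lt l) = (P (τ l)).+1 by rewrite /u /= ffunE.
have jrs l : j l \in rs0.
  by have [jr ju _] := jP l; rewrite mem_filter jr ju ulen.
pose k l := index (j l) rs0.
pose ps (τ : 'I_m -> T) := [seq (u τ α).-1 | α <- rs0].
have kl l : k l < size rs0 by rewrite index_mem.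
have E τ : sorted ltn [seq u τ α | α <- rs] -> (forall α, (0 < u ρ α) = (0 < u τ α)) ->
   (forall α, exists β, β \in rs /\ u τ β = u τ α) -> (forall l, u τ (j l) = u τ (lt l)) ->
   exists G, AM (tword τ (ps τ) k) (fun l => uK (τ l)) G (nth 0 (ps τ)).
  move=> sτ τ0 τr τj; apply: tuple_AM.
  - rewrite /ps; have : sorted ltn [seq u τ α | α <- rs0].
      rewrite sorted_map; apply: sorted_filter; first by move=> a b c /=; exact: ltn_trans.
      by rewrite -sorted_map.
    have : all (fun α => 0 < u τ α) rs0 by apply/allP => α; rewrite mem_filter -τ0 => /andP[].
    elim: (rs0) => [//|α [//|β s] IH] /= /and3P[α0 β0 s0] /andP[αβ ss].
    rewrite -ltnS !prednK // αβ /=; apply: IH => //=; by rewrite β0.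
  - by move=> l; rewrite size_map.
  - by move=> l; rewrite (nth_map (j l)) // nth_index // τj ulen.
  - move=> c κ p cp; have [β [βrs βu]] := τr (c, finfun κ).
    have βp : u τ β = p.+1.
      rewrite βu -cp /u /=; congr pos; apply: funext => i /=; by rewrite ffunE.
    by apply/mapP; exists β; rewrite ?βp // mem_filter βrs τ0 βp.
  - move=> p /mapP[[c κ]]; rewrite mem_filter τ0 => /andP[cκ _] ->.
    by exists c, κ; rewrite prednK.
have [|||| G GA] := E ρ.
- exact: s1.
- by [].
- by move=> α; have [β [? ? _]] := rsP α; exists β.
- by move=> l; have [_ -> _] := jP l.
have [|||| G' GA'] := E ρ'.
- exact: s2.
- exact: u0.
- by move=> α; have [β [? _ ?]] := rsP α; exists β.
- by move=> l; have [_ _ ->] := jP l.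
have szB l τ : size (tword τ (ps τ) k l) <= #|term|.
  rewrite size_mkseq; apply: leq_trans (ltnW (kl l)) _.
  rewrite -(card_uniqP _) ?max_card // filter_uniq //.
pose t := [ffun l => (Bseq (szB l ρ), inord (uK (ρ l)) : 'I_M.+1)].
have [|ε tP] := FP t; first by rewrite mem_enum.
have tE l : tword ρ (ps ρ) k l = tword ρ' (ps ρ') k l.
  apply: (@eq_from_nth _ blank); rewrite !size_mkseq // => a ak.
  rewrite !nth_mkseq //; have ars : a < size rs0 by exact: ltn_trans ak (kl l).
  rewrite !(nth_map (j l)) //; case: (nth _ _ _) => c κ.
  have [_ E2 _ _] := info κ (fun=> l); exact: E2.
have R τ H : AM (tword τ (ps τ) k) (fun l => uK (τ l)) H (nth 0 (ps τ)) ->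
   (forall l, u τ (j l) = u τ (lt l)) ->
   (forall l, tword ρ (ps ρ) k l = tword τ (ps τ) k l) -> (forall l, uK (ρ l) = uK (τ l)) ->
   γ (fun l => g (P (τ l))) = ε.
  move=> HA τj tτ uτ; rewrite -(tP H (nth 0 (ps τ))).
    congr γ; apply: funext => l; rewrite ffunE /= tτ size_mkseq; congr g.
    by rewrite (nth_map (j l)) // nth_index // τj ulen.
  rewrite (_ : (fun l => _) = tword τ (ps τ) k); last by apply: funext => l; rewrite ffunE /= tτ.
  rewrite (_ : (fun l => _) = fun l => uK (τ l)) //.
  by apply: funext => l; rewrite ffunE /= inordK // uτ.
rewrite (R ρ G) // => [|l]; last by have [_ -> _] := jP l.
rewrite (R ρ' G') // => [l|l]; first by have [_ _ ->] := jP l.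
by have [_ _ _] := info (fun=> l) (fun=> l).
Qed.

End Bounded.

(** * The tree structure *)

Section TreeStructure.
Variable Y : coding.
Local Notation PF := (pat Y).
Local Notation Pt := 'I_(pts Y).+1.
Local Notation word := (word Y).
Local Notation blank := (blank Y).
Local Notation kind := (@kind Y).
Local Notation dn := (@dn Y).
Local Notation dA := (@dom Y).
Implicit Types (S : {set Pt}) (A : PF).
Variables (φ : 'I_(rels Y).+1 -> 'I_(rels Y).+1) (M : nat).

Definition tlab p := if kind p is Some (_, ν) then ν else 0.

(** A dead singleton at [dn p] would allow this vertex to be the last point of a copy of [A];
    excluding such vertices makes the tree structure free. *)
Definition valid_vertex p := [/\ kind p <> None, tlab p < M &
  forall A b, ulab A b = tlab p -> ~ Dead A [set b]%SET (fun=> dn p)].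

Definition trel p r : 'I_(rels Y).+1 :=
  if p < r then (at_ (dn r) p).1 else if r < p then φ (at_ (dn p) r).1 else ord0.

(* If vertices formed a copy of A, then descending through the copy would
   kill its last vertex. *)
Lemma tree_free A (h : Pt -> nat) : dA A != finset.set0 ->
  (forall b, b \in dA A -> valid_vertex (h b)) ->
  (forall b, b \in dA A -> tlab (h b) = ulab A b) ->
  ~ forall b b', b \in dA A -> b' \in dA A -> b != b' -> trel (h b) (h b') = rlab A b b'.
Proof.
move=> /set0Pn[b0 b0A] hv hl hr.
have hinj b b' : b \in dA A -> b' \in dA A -> h b = h b' -> b = b'.
  move=> bA b'A hh; apply/eqP/negPn/negP => bb; have := irr bA b'A bb.
  by rewrite -hr // hh /trel ltnn eqxx.
pose R n := [set b in dA A | n <= h b]%SET.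
have D n : Dead A (R n) (fun b => dn (h b)).
  elim: n => [|n IH].
    rewrite (_ : R 0 = dA A); first exact: Dead_full.
    by apply/setP => b; rewrite inE andbT.
  have [[b1 b1A hb1]|nb] := pselect (exists2 b, b \in dA A & h b = n); last first.
    rewrite (_ : R n.+1 = R n) //; apply/setP => b; rewrite !inE.
    case bA: (b \in dA A) => //=; rewrite [RHS]leq_eqVlt; case: eqP => // nE.
    by case: nb; exists b.
  have RE : R n = b1 |: R n.+1.
    apply/setP => b; rewrite !inE leq_eqVlt; case: (b =P b1) => [->|bb1] /=.
      by rewrite b1A hb1 eqxx.
    case bA: (b \in dA A) => //=; case: eqP => // nE.
    by case: bb1; apply: hinj => //; rewrite hb1.
  have [] := hv b1 b1A; rewrite hb1; case kn: (kind n) => [[cw ν]|//] _ _ _.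
  apply: (Dead_rel kn _ b1A).
  - by apply/fintype.subsetP => b; rewrite inE => /andP[].
  - by rewrite inE b1A hb1 ltnn.
  - by have := hl b1 b1A; rewrite hb1 /tlab kn.
  - move=> b; rewrite inE => /andP[bA nb].
    rewrite -hr // /trel ?hb1 ?nb //.
    by apply: contraL nb => /eqP <-; rewrite hb1 ltnn.
  - rewrite -RE; apply: Dead_eq IH => b p _; rewrite /upd; case: eqP => [->|//].
    by rewrite hb1 (at_dn _ kn).
case: (@arg_maxnP _ b0 (mem (dA A)) h b0A) => b1 b1A b1m.
have [_ _ nD] := hv b1 b1A; apply: (nD A b1); first by rewrite hl.
have -> : [set b1]%SET = R (h b1).
  apply/setP => b; rewrite !inE; apply/eqP/andP => [->//|[bA hb]].
  by apply: hinj => //; apply/eqP; rewrite eqn_leq hb andbT; exact: b1m.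
have D1 := D (h b1); apply: Dead_eq D1 => b p.
rewrite inE => /andP[bA hb]; congr (at_ (dn _) _).
by apply/eqP; rewrite eqn_leq hb andbT; exact: b1m.
Qed.

Section Maps.
Variables (F : word -> word) (g : nat -> nat).
Hypothesis FU : UM F g.

Lemma UM_at w p : p < size w -> at_ (F w) (g p) = at_ w p.
Proof.
move=> pw; have sp : size (take p w) = p by rewrite size_takel // ltnW.
have sp1 : size (take p.+1 w) = p.+1 by rewrite size_takel.
have pr : prefix (rcons (F (take p w)) (at_ w p)) (F w).
  apply: prefix_trans (UM_prefix FU (prefix_take w p.+1)).
  by rewrite (take_nth blank) //; exact: (UM_rcons FU).
have szr : size (F (take p w)) = g p by rewrite (UM_size FU) sp.
by rewrite (at_prefix pr) ?size_rcons ?szr // at_rcons szr eqxx.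
Qed.

Lemma UM_lt p r : p < r -> g p < g r.
Proof.
elim: r => // r IH; rewrite ltnS leq_eqVlt => /orP[/eqP ->|/IH pr].
  have := size_prefix (UM_rcons FU (nseq r blank) blank).
  by rewrite size_rcons !(UM_size FU) size_rcons size_nseq.
apply: ltn_trans pr _.
have := size_prefix (UM_rcons FU (nseq r blank) blank).
by rewrite size_rcons !(UM_size FU) size_rcons size_nseq.
Qed.

Lemma UM_valid p : valid_vertex p -> valid_vertex (g p) /\ tlab (g p) = tlab p.
Proof.
rewrite /valid_vertex /tlab; case kp: (kind p) => [[cw ν]|] [] // _ pM pD.
have := UM_kind FU p; rewrite /kmatch kp => -[[cw' ->] FE]; split=> //; split=> // A b ub.
rewrite -FE => DD; apply: (pD A b) => //.
apply/(UM_dead FU A _ (x := fun=> dn p) (n := p)) => // _.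
exact: size_dn kp.
Qed.

Lemma UM_trel p r : valid_vertex p -> valid_vertex r -> trel (g p) (g r) = trel p r.
Proof.
have K a b : valid_vertex b -> a < b -> at_ (dn (g b)) (g a) = at_ (dn b) a.
  rewrite /valid_vertex; case kb: (kind b) => [[cw ν]|] [] // _ _ _ ab.
  have := UM_kind FU b; rewrite /kmatch kb => -[_ <-].
  by rewrite UM_at // (size_dn kb).
move=> pv rv; rewrite /trel; case: (ltngtP p r) => [pr|rp|->]; last by rewrite ltnn.
- by rewrite UM_lt // K.
- by rewrite ltnNge ltnW ?UM_lt //= K.
Qed.

End Maps.

Variables (T : countType) (uK : T -> nat) (rK : T -> T -> 'I_(rels Y).+1).
Hypothesis rK_flip : forall u v, rK v u = φ (rK u v).
Hypothesis rK0 : forall u, rK u u = ord0.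
Hypothesis rlab_flip : forall A b b', b \in dA A -> b' \in dA A ->
  rlab A b' b = φ (rlab A b b').
Hypothesis free : forall A h, ~ copy uK rK A (dA A) h.
Hypothesis uK_lt : forall v, uK v < M.
Variable ι : nat -> T.
Hypothesis ι_inj : forall p r, valid_vertex p -> valid_vertex r -> ι p = ι r -> p = r.
Hypothesis ι_lab : forall p, valid_vertex p -> uK (ι p) = tlab p.
Hypothesis ι_rel : forall p r, valid_vertex p -> valid_vertex r ->
  rK (ι p) (ι r) = trel p r.

(** The self-embedding is [ι] after [g] after [P]: into the tree by the nice copy, along a self-map
    of the tree, and back into K. *)
Theorem ramsey_copy (v0 : T) : exists r (C : finType) (χ : ('I_r -> T) -> C),
  forall m (D : finType) (γ : ('I_m -> T) -> D), exists η : T -> T,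
   [/\ injective η, forall v, uK (η v) = uK v,
    forall u v, rK (η u) (η v) = rK u v &
    forall ρ ρ' : 'I_m -> T, (forall σ : 'I_r -> 'I_m, χ (ρ \o σ) = χ (ρ' \o σ)) ->
      γ (η \o ρ) = γ (η \o ρ')].
Proof.
have [W [P [Pcod [Pinj Prel] nspl nkil Pval]]] := nice_copy_inhab rK_flip rlab_flip free v0.
have [r [C [χ H]]] := bounded_ramsey Pcod nspl nkil uK_lt.
exists r, C, χ => m D γ; have [F [g [FU FP]]] := H m D (fun f => γ (ι \o f)).
have Plab v : tlab (P v) = uK v by rewrite /tlab; have [[cw ->] _] := Pcod v.
have Pv v : valid_vertex (P v).
  split; first by have [[cw ->] _] := Pcod v.
    by rewrite Plab.
  by move=> A b; rewrite Plab; exact: Pval.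
have gPv v := UM_valid FU (Pv v).
exists (fun v => ι (g (P v))); split.
- move=> u v /(ι_inj (gPv u).1 (gPv v).1) gg; apply: Pinj.
  by case: (ltngtP (P u) (P v)) => // /(UM_lt FU); rewrite gg ltnn.
- by move=> v; rewrite ι_lab ?(gPv v).2 ?Plab //; exact: (gPv v).1.
- move=> u v; rewrite ι_rel; [|exact: (gPv u).1|exact: (gPv v).1].
  rewrite (UM_trel FU) // /trel.
  have K a b : P a < P b -> (at_ (dn (P b)) (P a)).1 = rK a b.
    move=> ab; have [_ ->] := Pcod b; rewrite /at_ nth_mkseq //; exact: Prel.
  case: (ltngtP (P u) (P v)) => [uv|vu|/Pinj ->]; last by rewrite rK0.
  + exact: K.
  + by rewrite K // -rK_flip.
- by move=> ρ ρ' /FP.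
Qed.

End TreeStructure.

(** * Fraisse limits *)

Section Labels.
Variables (L : language) (S : Type) (A : lstructure L S).

Definition ulabel a := sval (cid (Urel_unique A a)).

Definition rlabel a b := match pselect (a = b) with
  | left _ => ord0
  | right ab => sval (cid (Rrel_unique A ab)) end.

Lemma UrelE i a : Urel A i a <-> ulabel a = i.
Proof. by rewrite /ulabel; case: cid => j [Uj ju] /=; split=> [/ju|<-]. Qed.

Lemma RrelE i a b : Rrel A i a b <-> a <> b /\ rlabel a b = i.
Proof.
rewrite /rlabel; case: pselect => [->|ab].
  by split=> [/(@Rrel_irrefl _ _ A)|[]].
case: cid => j [Rj ju] /=; split=> [Ri|[_ <-] //].
by split=> //; exact: ju.
Qed.

Lemma rlabel_diag a : rlabel a a = ord0.
Proof. by rewrite /rlabel; case: pselect. Qed.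

Lemma rlabel_flip a b : rlabel b a = Flip (rlabel a b).
Proof.
have [->|ab] := pselect (a = b); first by rewrite rlabel_diag Flip0.
have : Rrel A (rlabel a b) a b by apply/RrelE.
by move=> /Rrel_Flip/RrelE[].
Qed.

Lemma irreducible_rlabel a b : irreducible A -> a <> b -> rlabel a b <> ord0.
Proof. by move=> irA ab ab0; apply: (irA a b ab); apply/RrelE. Qed.

End Labels.

Section LabelEmbeddings.
Variable L : language.

Definition label_embedding_on (S T : Type) (A : lstructure L S) (B : lstructure L T)
    (D : set S) (f : S -> T) :=
  [/\ forall a b, D a -> D b -> f a = f b -> a = b,
      forall a, D a -> ulabel B (f a) = ulabel A a &
      forall a b, D a -> D b -> rlabel B (f a) (f b) = rlabel A a b].

Lemma embedding_onE (S T : Type) (A : lstructure L S) (B : lstructure L T)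
    (D : set S) (f : S -> T) :
  embedding_on A B D f <-> label_embedding_on A B D f.
Proof.
split=> [[fi fU fR]|[fi fU fR]]; split=> //.
- by move=> a Da; apply/UrelE/fU => //; apply/UrelE.
- move=> a b Da Db; have [->|ab] := pselect (a = b); first by rewrite !rlabel_diag.
  have /(fR _ _ _ Da Db)/RrelE[] // : Rrel A (rlabel A a b) a b by apply/RrelE.
- by move=> i a Da; rewrite !UrelE fU.
- move=> i a b Da Db; rewrite !RrelE fR //; split=> -[ab <-]; split=> //.
    by move=> fab; apply: ab; exact: fi fab.
  by move=> abE; apply: ab; rewrite abE.
Qed.

Lemma embedding_trans (S T V : Type) (A : lstructure L S) (B : lstructure L T)
    (C : lstructure L V) (D : set S) f g :
  embedding_on A B D f -> embedding B C g -> embedding_on A C D (g \o f).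
Proof.
move=> [fi fU fR] [gi gU gR]; split=> /=.
- by move=> a b Da Db /gi fab; apply: fi => //; exact: fab.
- by move=> i a Da; rewrite fU // gU.
- by move=> i a b Da Db; rewrite fR // gR.
Qed.

Lemma mk_lstructure (S : Type) (u : S -> unary_idx L) (r : S -> S -> binary_idx L) :
  (forall a b, a <> b -> r b a = Flip (r a b)) ->
  exists A : lstructure L S, (forall a, ulabel A a = u a) /\
    forall a b, a <> b -> rlabel A a b = r a b.
Proof.
move=> rF.
have A1 a : exists! i, u a = i by exists (u a).
have A2 i a : ~ (a <> a /\ r a a = i) by case.
have A3 a b : a <> b -> exists! i, a <> b /\ r a b = i.
  by move=> ab; exists (r a b); split=> // i [].
have A4 i a b : (a <> b /\ r a b = i) <-> (b <> a /\ r b a = Flip i).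
  split=> -[ab E]; split; try by move=> ba; apply: ab.
    by rewrite rF // E.
  by rewrite rF // E Flip_involutive.
exists (@LStructure L S (fun i a => u a = i) (fun i a b => a <> b /\ r a b = i) A1 A2 A3 A4).
split=> [a|a b ab]; first exact/UrelE.
by have /RrelE[] : Rrel (LStructure A1 A2 A3 A4) (r a b) a b by [].
Qed.

Lemma induced_lstructure (S V : Type) (B : lstructure L V) (f : S -> V) : injective f ->
  exists A : lstructure L S, embedding A B f.
Proof.
move=> fi; have [|A [Au Ar]] := @mk_lstructure S (ulabel B \o f)
  (fun a b => rlabel B (f a) (f b)).
  by move=> a b _; exact: rlabel_flip.
exists A; apply/embedding_onE; split=> // [a b _ _ /fi //|a b _ _].
by have [->|ab] := pselect (a = b); rewrite ?rlabel_diag ?Ar.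
Qed.

End LabelEmbeddings.

(** * Countable F-free structures embed in K *)

Section Universality.
Variables (L : language) (F : set (fin_structure L)) (T : countType) (K : lstructure L T).
Hypothesis KF : fraisse_limit K (Forb F).

Lemma finite_embeds (V : countType) (B : lstructure L V) (D : set V) (v0 : V) :
  (forall A, F A -> ~ embeds A B) -> finite_set D ->
  exists f : V -> T, embedding_on B K D f.
Proof.
move=> freeB /finite_seqP[s0 ->].
pose s := undup (v0 :: s0); have v0s : v0 \in s by rewrite mem_undup mem_head.
have ni : injective (fun i : 'I_(size s) => nth v0 s i).
  by move=> i j /eqP; rewrite nth_uniq ?undup_uniq // => /eqP/val_inj.
have [A Ae] := induced_lstructure B ni.
have [e ee] : embeds (FinStructure A) K.
  apply/(KF.2 (FinStructure A)) => A' FA' [g ge]; apply: (freeB A' FA').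
  by exists ((fun i : 'I_(size s) => nth v0 s i) \o g); exact: embedding_trans ge Ae.
have vs v : exists i : 'I_(size s), v \in s -> nth v0 s i = v.
  have [vs|_] := boolP (v \in s).
    have iv : index v s < size s by rewrite index_mem.
    by exists (Ordinal iv) => _; rewrite nth_index.
  have iv : index v0 s < size s by rewrite index_mem.
  by exists (Ordinal iv).
have [ix ixP] := choice vs.
have sub v : v \in s0 -> nth v0 s (ix v) = v.
  by move=> vs0; apply: ixP; rewrite mem_undup inE vs0 orbT.
exists (e \o ix); apply/embedding_onE.
have /embedding_onE[ei eu er] := ee; have /embedding_onE[Ai Au Ar] := Ae.
split=> /=.
- by move=> a b Da Db /(ei _ _ I I) ab; rewrite -(sub a) // ab sub.
- by move=> a Da; rewrite eu // -Au // sub.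
- by move=> a b Da Db; rewrite er // -Ar // !sub.
Qed.

(** Some embedding of the larger finite set exists; homogeneity moves it so as to agree with [f] on
    [D]. *)
Lemma extend_embedding (V : countType) (B : lstructure L V) (D : set V) (v : V) f :
  (forall A, F A -> ~ embeds A B) -> finite_set D -> embedding_on B K D f ->
  exists f', embedding_on B K (D `|` [set v]) f' /\ forall a, D a -> f' a = f a.
Proof.
move=> freeB finD fe.
have [|e ee] := finite_embeds (D := D `|` [set v]) v freeB; first by rewrite finite_setU.
have back t : exists t', forall a, D a -> e a = t -> t' = f a.
  have [[a [Da at_]]|n] := pselect (exists a, D a /\ e a = t); last first.
    by exists t => a Da at_; case: n; exists a.
  exists (f a) => a' Da' a't; have [ei _ _] := ee; congr f; apply: ei; rewrite ?at_ ?a't //; by left.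
have [p pP] := choice back.
have pe a : D a -> p (e a) = f a by move=> Da; exact: pP.
have [||g gA gD] := KF.1 (e @` D) p.
- exact: finite_image.
- have /embedding_onE[fi fu fr] := fe; have /embedding_onE[ei eu er] := ee.
  apply/embedding_onE; split.
  + by move=> _ _ [a Da <-] [b Db <-]; rewrite !pe // => /fi ->.
  + by move=> _ [a Da <-]; rewrite pe // fu // eu //; left.
  + by move=> _ _ [a Da <-] [b Db <-]; rewrite !pe // fr // er //; left.
exists (g \o e); split; first exact: embedding_trans ee gA.1.
by move=> a Da /=; rewrite gD ?pe //; exists a.
Qed.

Lemma countable_embeds (V : countType) (B : lstructure L V) :
  (forall A, F A -> ~ embeds A B) -> embeds B K.
Proof.
move=> freeB; have [[v0 _]|nV] := pselect (exists v : V, True); last first.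
  have [f _] : exists f : V -> T, True.
    have H (v : V) : exists t : T, True by case: nV; exists v.
    by have [f _] := choice H; exists f.
  by exists f; split=> [a b _ _ _|i a|i a]; exfalso; apply: nV; exists a.
pose D n := [set v : V | pickle v < n].
have finD n : finite_set (D n).
  apply: (@sub_finite_set _ _ [set` pmap (@pickle_inv V) (iota 0 n)]); last exact: finite_seq.
  move=> v /= vn; rewrite mem_pmap; apply/mapP; exists (pickle v); rewrite ?mem_iota //.
  by rewrite pickleK_inv.
have step (nf : nat * (V -> T)) : exists f', embedding_on B K (D nf.1) nf.2 ->
    embedding_on B K (D nf.1.+1) f' /\ forall a, D nf.1 a -> f' a = nf.2 a.
  case: nf => n f /=; have [fe|nfe] := pselect (embedding_on B K (D n) f); last by exists f.
  case vn: (@pickle_inv V n) => [v|].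
    have [f' [fe' ff]] := extend_embedding v freeB (finD n) fe.
    exists f' => _; split=> //; rewrite (_ : D n.+1 = D n `|` [set v]) //.
    apply/seteqP; split=> a; rewrite /D /= ltnS.
      rewrite leq_eqVlt => /orP[/eqP an|]; last by left.
      by right; move: vn; rewrite -an pickleK_inv => -[].
    move=> [/ltnW //|->].
    by have := @pickle_invK V n; rewrite vn /= => ->.
  exists f => _; split=> //; rewrite (_ : D n.+1 = D n) //.
  apply/seteqP; split=> a; rewrite /D /= ltnS; last exact: ltnW.
  by rewrite leq_eqVlt => /orP[/eqP an|//]; rewrite -an pickleK_inv in vn.
have [nx nxP] := choice step.
have [f0 f0e] := finite_embeds v0 freeB (finD 0).
pose fix fs n := if n is n'.+1 then nx (n', fs n') else f0.
have fse n : embedding_on B K (D n) (fs n).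
  by elim: n => // n IH; have [] := nxP (n, fs n) IH.
have fsS n m a : n <= m -> D n a -> fs m a = fs n a.
  move=> nm Da; elim: m nm => [|m IH]; first by rewrite leqn0 => /eqP ->.
  rewrite leq_eqVlt => /orP[/eqP <- //|nm]; rewrite -IH //.
  have [_ /= -> //] := nxP (m, fs m) (fse m).
  by apply: leq_trans Da _.
exists (fun v => fs (pickle v).+1 v).
have E a b : exists n, [/\ D n a, D n b, fs (pickle a).+1 a = fs n a & fs (pickle b).+1 b = fs n b].
  exists (maxn (pickle a) (pickle b)).+1; split.
  - by rewrite /D /= ltnS leq_maxl.
  - by rewrite /D /= ltnS leq_maxr.
  - by apply/esym/fsS; rewrite ?ltnS ?leq_maxl // /D /=.
  - by apply/esym/fsS; rewrite ?ltnS ?leq_maxr // /D /=.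
apply/embedding_onE; split.
- move=> a b _ _; have [n [Da Db -> ->]] := E a b.
  by have [ei _ _] := fse n; exact: ei.
- move=> a _; have /embedding_onE[_ eu _] := fse (pickle a).+1.
  by apply: eu; rewrite /D /=.
- move=> a b _ _; have [n [Da Db -> ->]] := E a b.
  by have /embedding_onE[_ _ er] := fse n; exact: er.
Qed.

End Universality.

(** Odd positions decode to triples (cw, ν, k), of which those with [cw] too long are dropped. The
    counter [k] makes each pair recur beyond every bound. *)
Lemma kind_ex (E : countType) : exists kind : nat -> option (seq E * nat),
  [/\ forall p cw ν, kind p = Some (cw, ν) -> size cw <= p,
      forall p, ~~ odd p -> kind p = None &
      forall s ν n, exists2 p, n <= p & kind p = Some (s, ν)].
Proof.
exists (fun p => if odd p then
  if unpickle p./2 is Some (cw, ν, k) then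
    if size (cw : seq E) <= p then Some (cw, ν : nat) else let _ : nat := k in None
  else None else None); split.
- move=> p cw ν; case: ifP => // _; case: unpickle => // -[[cw' ν'] k].
  by case: ifP => // cp [<- _].
- by move=> p /negbTE ->.
- move=> s ν n.
  have [k kP] : exists k : nat, maxn n (size s) <= pickle (s, ν, k).
    apply: contrapT => /forallNP H; set B := maxn _ _ in H.
    have HB (k : nat) : pickle (s, ν, k) < B by rewrite ltnNge; apply/negP; exact: (H k).
    pose f (k : 'I_B.+1) : 'I_B := Ordinal (HB k).
    have fi : injective f.
      move=> k k' /(congr1 (@nat_of_ord _)) /= /(pcan_inj pickleK) [kk].
      exact: val_inj.
    by have := leq_card f fi; rewrite !card_ord ltnn.
  move: kP; rewrite geq_max => /andP[nk sk].
  exists (pickle (s, ν, k)).*2.+1; first by lia.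
  rewrite /= odd_double /= uphalf_double pickleK.
  by rewrite (_ : size s <= _ = true) //; lia.
Qed.

(** * The Ramsey property of self-embeddings of K *)

Section EmbRamsey.
Variables (L : language) (F : set (fin_structure L)) (T : countType) (K : lstructure L T).
Hypothesis finF : finite_set F.
Hypothesis irrF : forall A : fin_structure L, F A -> irreducible A.
Hypothesis KF : fraisse_limit K (Forb F).

Lemma forb_not_embeds A : F A -> ~ embeds A K.
Proof.
move=> FA /(KF.2 A) /(_ A FA); apply; exists id; split=> //.
Qed.

Lemma forb_inhabited A : F A -> 0 < fin_card A.
Proof.
move=> FA; rewrite lt0n; apply/eqP => A0; apply: (forb_not_embeds FA).
have no (x : 'I_(fin_card A)) : False by case: x; rewrite A0.
have [f _] : exists f : 'I_(fin_card A) -> T, True.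
  have H (v : 'I_(fin_card A)) : exists t : T, True by case: (no v).
  by have [f _] := choice H; exists f.
by exists f; split=> [a b _ _ _|i a|i a]; case: (no a).
Qed.

Theorem emb_ramsey : exists r (C : finType) (χ : ('I_r -> T) -> C),
  forall m (D : finType) (γ : ('I_m -> T) -> D), exists η : Emb K,
  forall ρ ρ' : 'I_m -> T, (forall σ : 'I_r -> 'I_m, χ (ρ \o σ) = χ (ρ' \o σ)) ->
    γ (emb_fun η \o ρ) = γ (emb_fun η \o ρ').
Proof.
have [[v0 _]|nT] := pselect (exists v : T, True); last first.
  exists 0, unit, (fun=> tt) => m D γ; exists 1%g => ρ ρ' _; congr γ; apply: funext => i.
  by case: nT; exists (ρ i).
have [s sP] : exists s : seq (fin_structure L), forall A, F A <-> List.In A s.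
  have /finite_seqP[s FE] : finite_set (F : set {classic fin_structure L}) by exact: finF.
  exists s => A; rewrite FE /=; elim: s {FE} => //= B s IH.
  rewrite inE -IH; split=> [/orP[/eqP ->|]|[->|->]]; rewrite ?eqxx ?orbT; by auto.
have [A0 _] : exists A0 : fin_structure L, True.
  have [|A _] := @mk_lstructure L 'I_0 (fun i => False_rect _ (notF (ltn_ord i)))
    (fun _ _ => ord0); first by case.
  by exists (FinStructure A).
pose AA (i : 'I_(size s)) := nth A0 s i.
have FAA i : F (AA i).
  rewrite sP /AA; case: i => i /= iS; elim: (s) i iS => // B t IH [|i] /=; first by left.
  by rewrite ltnS => /IH; right.
have AAF A : F A -> exists i, AA i = A.
  rewrite sP /AA => As.
  suff [i iS iA] : exists2 i, i < size s & nth A0 s i = A by exists (Ordinal iS).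
  elim: (s) As => //= B t IH [->|/IH[i iS iA]]; first by exists 0.
  by exists i.+1.
pose N := \max_(i < size s) fin_card (AA i).
(* All members of F get the common point set ['I_N.+1]; [pt] is the partial way back to the points
   of the i-th member. *)
pose pt i (b : 'I_N.+1) : option 'I_(fin_card (AA i)) := insub (val b).
have cN i (x : 'I_(fin_card (AA i))) : x < N.+1.
  by rewrite ltnS ltnW //; apply: leq_trans (ltn_ord x) _; exact: (leq_bigmax i).
pose up i (x : 'I_(fin_card (AA i))) : 'I_N.+1 := Ordinal (cN i x).
have ptK i x : pt i (up i x) = Some x.
  exact: (valK x).
pose domA i := [set b : 'I_N.+1 | b < fin_card (AA i)]%SET.
have upA i x : up i x \in domA i by rewrite inE /=; exact: (ltn_ord x).
have domP i b : b \in domA i -> exists2 x, pt i b = Some x & b = up i x.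
  by rewrite inE => bA; exists (Ordinal bA); [rewrite /pt insubT|exact: val_inj].
pose ulabA i (b : 'I_N.+1) : nat := if pt i b is Some x then ulabel (AA i) x else 0.
pose rlabA i (b b' : 'I_N.+1) : 'I_(nbinary_pred L).+1 :=
  if pt i b is Some x then if pt i b' is Some y then rlabel (AA i) x y else ord0 else ord0.
have irrA i b b' : b \in domA i -> b' \in domA i -> b != b' -> rlabA i b b' != ord0.
  move=> /domP[x xb ->] /domP[y yb' ->] xy; rewrite /rlabA !ptK; apply/eqP.
  apply: irreducible_rlabel; first exact: irrF (FAA i).
  by move=> xyE; move: xy; rewrite xyE eqxx.
have [kind [k1 k2 k3]] := kind_ex (letter (nbinary_pred L) N 'I_(size s)).
pose Y := @Coding (nbinary_pred L) N 'I_(size s) domA ulabA rlabA kind irrA k1 k2 k3.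
pose φ : 'I_(rels Y).+1 -> 'I_(rels Y).+1 := @Flip L.
pose M := nunary L.
have rlab_flipY i b b' : b \in @dom Y i -> b' \in @dom Y i -> @rlab Y i b' b = φ (@rlab Y i b b').
  move=> /domP[x xb ->] /domP[y yb' ->]; rewrite /= /rlabA !ptK; exact: rlabel_flip.
pose VU : countType := {p : nat | `[< valid_vertex Y M p >]}.
have VUP (p : VU) : valid_vertex Y M (val p) by have := valP p => /asboolP.
have lt p : valid_vertex Y M p -> tlab Y p < nunary L by case.
have [|B [Bu Br]] := @mk_lstructure L VU (fun p => Ordinal (lt _ (VUP p)))
    (fun p r => trel φ (val p) (val r)).
  move=> p r pr; rewrite /trel; case: (ltngtP (val p) (val r)) => // [_|/val_inj //].
  by rewrite /φ Flip_involutive.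
have freeB A : F A -> ~ embeds A B.
  move=> /AAF[i <-] [f /embedding_onE[fi fu fr]].
  have [x0 _] : exists x : 'I_(fin_card (AA i)), True.
    by exists (Ordinal (forb_inhabited (FAA i))).
  pose h (b : 'I_(pts Y).+1) : nat := if pt i b is Some x then val (f x) else 0.
  have hE x : h (up i x) = val (f x) by rewrite /h ptK.
  apply: (@tree_free Y φ M i h).
  - by apply/set0Pn; exists (up i x0).
  - by move=> b /domP[x _ ->]; rewrite hE.
  - move=> b /domP[x _ ->]; rewrite hE /= /ulabA ptK -fu // Bu //.
  - move=> b b' /domP[x _ ->] /domP[y _ ->] xy; rewrite !hE /= /rlabA !ptK -fr // Br //.
    by move=> /fi xyE; move: xy; rewrite xyE // eqxx.
have [e /embedding_onE[ei eu er]] := countable_embeds KF freeB.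
pose ι p := if (insub p : option VU) is Some x then e x else v0.
have ιE p (pv : valid_vertex Y M p) : exists2 x : VU, val x = p & ι p = e x.
  rewrite /ι; case: insubP => [x _ xp|/negP[]]; last exact/asboolP.
  by exists x.
have [||||||||r [C [χ H]]] := @ramsey_copy Y φ M T (fun v => ulabel K v) (rlabel K) _ _ _ _ _ ι _ _ _ v0.
- by move=> u v; exact: rlabel_flip.
- exact: rlabel_diag.
- exact: rlab_flipY.
- move=> i h [hu hr]; apply: (forb_not_embeds (FAA i)); exists (h \o up i).
  have hr' x y : x <> y -> rlabel K (h (up i x)) (h (up i y)) = rlabel (AA i) x y.
    move=> xy; rewrite hr //; first by rewrite /= /rlabA !ptK.
    by apply/eqP => /(congr1 val) /= /val_inj.
  apply/embedding_onE; split=> /=.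
  + move=> x y _ _ hxy; apply: contrapT => xy.
    apply: (irreducible_rlabel (irrF (FAA i)) xy); rewrite -hr' // hxy; exact: rlabel_diag.
  + move=> x _; apply: val_inj; by rewrite /= hu //= /ulabA ptK.
  + by move=> x y _ _; have [->|xy] := pselect (x = y); rewrite ?rlabel_diag ?hr'.
- by move=> v; exact: ltn_ord.
- move=> p r /ιE[x <- ->] /ιE[y <- ->] /ei -> //.
- by move=> p /ιE[x <- ->]; rewrite eu // Bu.
- move=> p r /ιE[x <- ->] /ιE[y <- ->]; rewrite er //.
  have [->|xy] := pselect (x = y); last exact: Br.
  by rewrite rlabel_diag /trel ltnn.
exists r, C, χ => m D γ; have [η [ηi ηu ηr ηP]] := H m D γ.
have ηe : embedding K K η.
  apply/embedding_onE; split=> // [a b _ _ /ηi //|a _].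
  by apply: val_inj; exact: ηu.
by exists (mk_emb ηe).
Qed.

End EmbRamsey.

(** * Completion flows *)

(** Two iterates of [φ] coincide, and injectivity on [I] cancels the smaller one. *)
Lemma iter_fixed_on (C : finType) (φ : C -> C) (I : {set C}) :
  [set φ c | c in I]%SET = I -> exists k, forall c, c \in I -> iter k.+1 φ c = c.
Proof.
move=> φI; have φi : {in I &, injective φ} by apply/imset_injP; rewrite φI.
have φm c : c \in I -> φ c \in I by move=> cI; have := imset_f φ cI; rewrite φI.
have im k c : c \in I -> iter k φ c \in I by move=> cI; elim: k => //= k; exact: φm.
have ii k : {in I &, injective (iter k φ)}.
  elim: k => [|k IH] c c' cI c'I //= /φi E; apply: IH => //; apply: E; exact: im.
pose f (k : 'I_#|{: {ffun C -> C}}|.+1) : {ffun C -> C} := [ffun c => iter k φ c].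
have [i [j [ij fij]]] : exists i j : 'I_#|{: {ffun C -> C}}|.+1, i < j /\ f i = f j.
  apply: contrapT => H; have fi : injective f.
    move=> i j fij; apply: val_inj; case: (ltngtP i j) => // lij; case: H.
      by exists i, j.
    by exists j, i.
  by have := leq_card f fi; rewrite card_ord ltnn.
exists (j - i).-1 => c cI; rewrite prednK ?subn_gt0 //.
apply: (ii i) => //; first exact: im.
have /ffunP/(_ c) := fij; rewrite !ffunE => ->.
by rewrite -iterD subnKC // ltnW.
Qed.

Lemma ultra_colour (S : Type) (G : set_system S) (C : finType) (f : S -> C) :
  UltraFilter G -> exists c, G [set x | f x = c].
Proof.
move=> GU; apply: contrapT => /forallNP nG.
have H (s : seq C) : G [set x | f x \notin s].
  elim: s => [|c s IH]; first by apply: filterS filterT.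
  have [/nG//|GC] := in_ultra_setVsetC [set x | f x = c] GU.
  by apply: filterS2 IH GC => x fs /= fc; rewrite inE negb_or fs andbT; apply/eqP.
by have [x /=] := filter_ex (H (enum C)); rewrite mem_enum.
Qed.

Section Completion.
Variables (L : language) (T : countType) (K : lstructure L T).
Hypothesis uK : ultrahomogeneous K.
Variables (r : nat) (C : finType) (χ : ('I_r -> T) -> C).
Hypothesis χ_reindex : forall ρ ρ', χ ρ = χ ρ' ->
  forall σ : 'I_r -> 'I_r, χ (ρ \o σ) = χ (ρ' \o σ).
Hypothesis ramsey : forall m (D : finType) (γ : ('I_m -> T) -> D), exists η : Emb K,
  forall ρ ρ' : 'I_m -> T, (forall σ : 'I_r -> 'I_m, χ (ρ \o σ) = χ (ρ' \o σ)) ->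
    γ (emb_fun η \o ρ) = γ (emb_fun η \o ρ').

Definition canonical (θ : Emb K) := exists φ : C -> C, forall ρ, χ (emb_fun θ \o ρ) = φ (χ ρ).

Lemma canonicalP (θ : Emb K) :
  (forall ρ ρ', χ ρ = χ ρ' -> χ (emb_fun θ \o ρ) = χ (emb_fun θ \o ρ')) -> canonical θ.
Proof.
move=> H; have /choice[φ φP] : forall c, exists c', forall ρ, χ ρ = c -> χ (emb_fun θ \o ρ) = c'.
  move=> c; have [[ρ0 c0]|n] := pselect (exists ρ, χ ρ = c).
    by exists (χ (emb_fun θ \o ρ0)) => ρ cρ; apply: H; rewrite cρ c0.
  by exists c => ρ cρ; case: n; exists ρ.
by exists φ => ρ; exact: φP.
Qed.

Lemma canonical_mul θ θ' : canonical θ -> canonical θ' -> canonical (θ * θ')%g.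
Proof.
move=> [φ φP] [φ' φP']; exists (φ \o φ') => ρ /=.
by rewrite -φP' -φP.
Qed.

(** Colouring [(m + r)]-tuples by [γ] and [χ] together gives one embedding for both; [f] repeats an
    entry to make such a tuple out of a shorter one. *)
Lemma ramsey_canonical m (D : finType) (γ : ('I_m -> T) -> D) : exists η : Emb K,
  canonical η /\
  forall ρ ρ' : 'I_m -> T, (forall σ : 'I_r -> 'I_m, χ (ρ \o σ) = χ (ρ' \o σ)) ->
    γ (emb_fun η \o ρ) = γ (emb_fun η \o ρ').
Proof.
have [η ηP] := ramsey (fun ρ : 'I_(m + r) -> T =>
  (γ (ρ \o @lshift m r), χ (ρ \o @rshift m r))).
exists η; split.
  apply: canonicalP => ρ ρ' ρρ.
  have [r0|r0] := posnP r.
    congr χ; apply: funext => i; have := ltn_ord i; by rewrite {2}r0.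
  pose f (i : 'I_(m + r)) := match fintype.split i with inl _ => Ordinal r0 | inr j => j end.
  have fr (τ : 'I_r -> T) : ((emb_fun η \o (τ \o f)) \o @rshift m r) = emb_fun η \o τ.
    by apply: funext => i /=; rewrite /f (unsplitK (inr i)).
  have E (σ : 'I_r -> 'I_(m + r)) : χ ((ρ \o f) \o σ) = χ ((ρ' \o f) \o σ).
    exact: (χ_reindex ρρ (f \o σ)).
  by have [_] := ηP _ _ E; rewrite !fr.
move=> ρ ρ' ρρ; have [m0|m0] := posnP m.
  congr γ; apply: funext => i; have := ltn_ord i; by rewrite {2}m0.
pose f (i : 'I_(m + r)) := match fintype.split i with inl j => j | inr _ => Ordinal m0 end.
have fl (τ : 'I_m -> T) : ((emb_fun η \o (τ \o f)) \o @lshift m r) = emb_fun η \o τ.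
  by apply: funext => i /=; rewrite /f (unsplitK (inl i)).
have E (σ : 'I_r -> 'I_(m + r)) : χ ((ρ \o f) \o σ) = χ ((ρ' \o f) \o σ).
  exact: (ρρ (f \o σ)).
by have [+ _] := ηP _ _ E; rewrite !fl.
Qed.

Variable (X : flow K) (x0 : X).

(* The limit y of x0 along an ultrafilter of self-embeddings which are tame for all
   windows depends on an embedding only through its effect on colours. *)
Record window := Window { win_in : set X; win_out : set X; win_size : nat;
  win_pts : 'I_win_size -> T }.

Definition window_ok (w : window) := [/\ open (win_in w), closed (win_out w) &
  forall z (u : Aut K), win_in w z -> (forall i, aut_fun u (@win_pts w i) = @win_pts w i) ->
    win_out w (flow_act z u)].

(** There are two sets because the passage from automorphisms to embeddings is a limit: hitting the
    open set is only known to force membership in the larger closed one. *)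
Definition tame (w : window) (η : Emb K) := forall ζ ζ' : Emb K,
  (forall σ : 'I_r -> 'I_(win_size w), χ (emb_fun ζ \o (@win_pts w \o σ)) =
     χ (emb_fun ζ' \o (@win_pts w \o σ))) ->
  win_in w (emb_act x0 (η * ζ)%g) -> win_out w (emb_act x0 (η * ζ')%g).

(** Automorphisms approximating [g] and [h] on the points of the window differ by one that fixes
    these points. *)
Lemma emb_act_window w (g h : Emb K) : window_ok w ->
  (forall i, emb_fun g (@win_pts w i) = emb_fun h (@win_pts w i)) ->
  win_in w (emb_act x0 g) -> win_out w (emb_act x0 h).
Proof.
move=> [oV cO VO] gh Vg.
have Fg := aut_near_proper uK g; have Fh := aut_near_proper uK h.
have near (e : Emb K) : aut_near e [set u | forall i, aut_fun u (@win_pts w i) = emb_fun e (@win_pts w i)].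
  apply/aut_nearP; exists [seq @win_pts w i | i <- enum 'I_(win_size w)] => u uD i.
  by apply: uD; apply: map_f; rewrite mem_enum.
have gV : aut_near g [set u | win_in w (flow_act x0 u)].
  by apply: (emb_act_cvg uK (x := x0) (e := g)); exact: open_nbhs_nbhs.
have [v [vg vV]] := filter_ex (filterI (near g) gV).
apply: (closed_cvg _ cO _ _ (emb_act_cvg uK (x := x0) (e := h))).
apply: filterS (near h) => u uh /=.
have [|t tD ->] := @flow_act_shift _ _ _ X x0 v u [seq @win_pts w i | i <- enum 'I_(win_size w)].
  by move=> _ /mapP[i _ ->]; rewrite uh vg gh.
apply: VO => // i; apply: tD; apply: map_f; by rewrite mem_enum.
Qed.

(** The colour of [ρ] says whether some embedding with the values [η0] after [ρ] on the window hits
    [win_in]. Any other embedding with these values then ends in [win_out]. *)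
Lemma tame_ex w η0 : window_ok w -> exists θ, canonical θ /\ tame w (η0 * θ)%g.
Proof.
move=> ok; have [θ [cθ θP]] := @ramsey_canonical (win_size w) bool (fun ρ =>
  `[< exists g : Emb K, (forall i, emb_fun g (@win_pts w i) = emb_fun η0 (ρ i)) /\
      win_in w (emb_act x0 g) >]).
exists θ; split=> // ζ ζ' ζζ Vζ.
have := θP (emb_fun ζ \o @win_pts w) (emb_fun ζ' \o @win_pts w) ζζ.
rewrite asboolT; last by exists (η0 * θ * ζ)%g.
by move=> /esym/asboolP[g [ga Vg]]; apply: emb_act_window Vg.
Qed.

Lemma tame_mul w η θ : tame w η -> canonical θ -> tame w (η * θ)%g.
Proof.
move=> tη [φ φP] ζ ζ' ζζ; rewrite -!mulgA; apply: tη => σ.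
by rewrite [LHS](φP (emb_fun ζ \o (@win_pts w \o σ))) ζζ -φP.
Qed.

(** Right multiplication by a canonical embedding preserves tameness, so finitely many windows can
    be treated in turn. *)
Lemma tame_filter : ProperFilter (filter_from
  [set l : seq window | forall w, List.In w l -> window_ok w]
  (fun l => [set η | forall w, List.In w l -> tame w η])).
Proof.
apply: filter_from_proper.
  apply: filter_from_filter; first by exists [::].
  move=> l l' lok l'ok; exists (l ++ l').
    by move=> w /List.in_app_iff[/lok|/l'ok].
  by move=> η H; split=> w wl; apply: H; apply/List.in_app_iff; [left|right].
elim=> [_|w l IH lok]; first by exists 1%g.
have [η ηP] := IH (fun w' w'l => lok w' (or_intror w'l)).
have [θ [cθ θP]] := tame_ex η (lok w (or_introl erefl)).
by exists (η * θ)%g => w' [<-//|/ηP t]; exact: tame_mul.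
Qed.

Lemma limit_point : completion_point x0 -> exists y : X,
  (forall ζ ζ' : Emb K, (forall ρ, χ (emb_fun ζ \o ρ) = χ (emb_fun ζ' \o ρ)) ->
     emb_act y ζ = emb_act y ζ') /\
  forall e : Emb K, dense_orbit (emb_act y e).
Proof.
move=> cx0; have [G [GU tG]] := ultraFilterLemma tame_filter.
have Gtame w : window_ok w -> G (tame w).
  move=> ok; apply: tG; exists [:: w] => [w' [<-//|//]|η]; by apply; left.
have GP : ProperFilter G by exact: ultra_proper.
have [|y [_ cy]] := @flow_compact _ _ _ X (emb_act x0 @ G) _; first exact: filterT.
have Gy W : nbhs y W -> G [set η | W (emb_act x0 η)].
  move=> yW; have [//|GC] := in_ultra_setVsetC [set η | W (emb_act x0 η)] GU.
  have [|z [nz Wz]] := cy (~` W) W _ yW; last by case: nz.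
  exact: GC.
have yζ ζ W : nbhs (emb_act y ζ) W -> G [set η | W (emb_act x0 (η * ζ)%g)].
  move=> yW; have := emb_act_continuous uK (x := (y, ζ)) yW.
  move=> [[A B] [/= yA ζB] AB].
  apply: filterS (Gy A yA) => η Aη /=; rewrite emb_actM //.
  by apply: (AB (_, ζ)); split=> //=; exact: nbhs_singleton ζB.
have win p W : nbhs p W -> exists w, [/\ window_ok w, win_in w p & win_out w `<=` W].
  move=> pW; have [W1 pW1 [cW1 W1W]] := flow_regular pW.
  have [V pV [D VD]] := flow_act_near1 pW1.
  exists (Window (interior V) W1 (tnth (in_tuple D))); split=> //=.
  split=> //=; first exact: open_interior.
  move=> z u zV uD; apply: VD; first exact: interior_subset zV.
  move=> a /(nthP a)[i iD <-]; have := uD (Ordinal iD).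
  by rewrite (tnth_nth a).
have lim_out w ζ : window_ok w -> G [set η | win_out w (emb_act x0 (η * ζ)%g)] ->
    win_out w (emb_act y ζ).
  move=> [_ cO _] GO; apply: contrapT => nO.
  have [|η [/= nη Oη]] := filter_ex (filterI (yζ ζ (~` win_out w) _) GO).
    by apply: open_nbhs_nbhs; split=> //; exact: closed_openC.
  by [].
exists y; split.
  move=> ζ ζ' ζζ; apply: (@flow_hausdorff _ _ _ X) => A B yA yB.
  exists (emb_act y ζ'); split; last exact: nbhs_singleton yB.
  have [w [ok wp wA]] := win _ _ yA; apply/wA/lim_out => //.
  have [oV _ _] := ok.
  have GV := yζ ζ (win_in w) (open_nbhs_nbhs (conj oV wp)).
  by apply: filterS2 (Gtame w ok) GV => η tη; apply: tη => σ; exact: ζζ.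
move=> e O [p Op] oO.
have [w [ok wp wO]] := win p O (open_nbhs_nbhs (conj oO Op)).
have [oV _ _] := ok.
have hit (η : Emb K) : exists g : Aut K, win_in w (emb_act x0 (η * (e * aut_emb g))%g).
  have [|z [Vz [g _ gz]]] := cx0 (η * e)%g (win_in w) _ oV; first by exists p.
  rewrite -gz in Vz.
  by exists g; rewrite mulgA emb_actM // emb_act_aut.
have [g gP] := choice hit.
(* The automorphism [g η] that leads into the window varies with [η], but the ultrafilter fixes the
   colours of [e * g η] on the window. Tameness then lets the single [g η0] serve almost all [η],
   hence also the limit. *)
pose pattern (η : Emb K) := [ffun σ : {ffun 'I_r -> 'I_(win_size w)} =>
  χ (emb_fun (e * aut_emb (g η))%g \o (@win_pts w \o σ))].
have [c Gc] := ultra_colour pattern GU.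
have [η0 η0c] := filter_ex Gc.
exists (flow_act (emb_act y e) (g η0)); split; last by exists (g η0).
rewrite -emb_act_aut // -emb_actM //; apply/wO/lim_out => //.
apply: filterS2 (Gtame w ok) Gc => η tη ηc; apply: tη (gP η) => σ.
have /ffunP/(_ (finfun σ)) : pattern η = pattern η0 by rewrite ηc.
rewrite !ffunE; have -> : @win_pts w \o finfun σ = @win_pts w \o σ; last by [].
by apply: funext => i /=; rewrite ffunE.
Qed.

Definition image (e : Emb K) : {set C} :=
  [set c | `[< exists ρ, χ (emb_fun e \o ρ) = c >]]%SET.

Lemma mem_image e ρ : χ (emb_fun e \o ρ) \in image e.
Proof. by rewrite inE; apply/asboolP; exists ρ. Qed.

Lemma image_mul e f : image (e * f)%g \subset image e.
Proof.
apply/fintype.subsetP => c; rewrite inE => /asboolP[ρ <-].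
exact: (mem_image e (emb_fun f \o ρ)).
Qed.

Lemma canonical_strong (y : X) :
  (forall ζ ζ' : Emb K, (forall ρ, χ (emb_fun ζ \o ρ) = χ (emb_fun ζ' \o ρ)) ->
     emb_act y ζ = emb_act y ζ') ->
  exists e : Emb K, forall θ : Emb K, exists ψ : Emb K,
    emb_act (emb_act (emb_act y e) θ) ψ = emb_act y e.
Proof.
move=> yP.
have ex : exists n, `[< exists2 e, canonical e & #|image e| = n >].
  by exists #|image 1%g|; apply/asboolP; exists 1%g => //; exists id.
case: (ex_minnP ex) => n /asboolP[e ce en] nmin.
have emin f : canonical f -> image f \subset image e -> image f = image e.
  move=> cf fe; apply/eqP; rewrite eqEcard fe en; apply: nmin.
  by apply/asboolP; exists f.
exists e => θ.
have [η [_ ηP]] := ramsey_canonical (fun ρ => χ (emb_fun (e * θ)%g \o ρ)).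
pose f := (e * (θ * η))%g.
have cf : canonical f.
  apply: canonicalP => ρ ρ' ρρ; apply: (ηP ρ ρ') => σ; exact: χ_reindex.
have [φ φP] := cf.
have fe : image f = image e by apply: emin; rewrite ?image_mul.
(* [f * e] is canonical with image inside that of [e], so by minimality it has the same image; this
   image is obtained by applying [φ] to that of [e]. *)
have φI : [set φ c | c in image e]%SET = image e.
  rewrite -[RHS](_ : image (f * e)%g = _); last first.
    by apply: emin; [exact: canonical_mul|rewrite -fe image_mul].
  apply/setP => c; apply/imsetP/idP.
    move=> [c']; rewrite inE => /asboolP[ρ <-] ->.
    by rewrite -φP; exact: (mem_image (f * e)%g ρ).
  rewrite inE => /asboolP[ρ <-]; exists (χ (emb_fun e \o ρ)); first exact: mem_image.
  by rewrite -φP.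
have [k kP] := iter_fixed_on φI.
pose fe_ k := iter k (fun h => f * h)%g e.
have feP j ρ : χ (emb_fun (fe_ j) \o ρ) = iter j φ (χ (emb_fun e \o ρ)).
  elim: j => [//|j IH] /=; rewrite -IH -φP //.
exists (η * fe_ k)%g.
rewrite -!emb_actM // (_ : (e * (θ * (η * fe_ k)))%g = fe_ k.+1); last first.
  by rewrite /= /f !mulgA.
by apply: yP => ρ; rewrite feP kP //; exact: mem_image.
Qed.

End Completion.

Lemma completion_strong (L : language) (T : countType) (K : lstructure L T)
    (X : flow K) r (C : finType) (χ : ('I_r -> T) -> C) :
  ultrahomogeneous K ->
  (forall m (D : finType) (γ : ('I_m -> T) -> D), exists η : Emb K,
    forall ρ ρ' : 'I_m -> T, (forall σ : 'I_r -> 'I_m, χ (ρ \o σ) = χ (ρ' \o σ)) ->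
    γ (emb_fun η \o ρ) = γ (emb_fun η \o ρ')) ->
  completion_flow X -> strong_completion_flow X.
Proof.
move=> uK ramsey [x0 cx0].
(* Recording [χ] on all reindexings makes the colour of a tuple determine the colours of its
   reindexings, which [canonical_strong] and [limit_point] rely on. *)
pose χ' (ρ : 'I_r -> T) := [ffun σ : {ffun 'I_r -> 'I_r} => χ (ρ \o σ)].
have χ'P ρ ρ' : χ' ρ = χ' ρ' -> forall σ : 'I_r -> 'I_r, χ (ρ \o σ) = χ (ρ' \o σ).
  move=> /ffunP E σ; have := E (finfun σ); rewrite !ffunE.
  by have -> : (finfun σ : 'I_r -> 'I_r) = σ by apply: funext => i; rewrite ffunE.
have χ'_reindex ρ ρ' : χ' ρ = χ' ρ' -> forall σ : 'I_r -> 'I_r, χ' (ρ \o σ) = χ' (ρ' \o σ).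
  by move=> /χ'P E σ; apply/ffunP => τ; rewrite !ffunE; exact: (E (σ \o τ)).
have ramsey' m (D : finType) (γ : ('I_m -> T) -> D) : exists η : Emb K,
    forall ρ ρ' : 'I_m -> T, (forall σ : 'I_r -> 'I_m, χ' (ρ \o σ) = χ' (ρ' \o σ)) ->
    γ (emb_fun η \o ρ) = γ (emb_fun η \o ρ').
  have [η ηP] := ramsey m D γ; exists η => ρ ρ' E; apply: ηP => σ.
  exact: (χ'P _ _ (E σ) id).
have [y [yP yD]] := limit_point uK χ'_reindex ramsey' cx0.
have [e eP] := canonical_strong uK χ'_reindex ramsey' yP.
by exists (emb_act y e); split; [exact: yD|exact: eP].
Qed.

Unset Implicit Arguments.

Theorem theorem8p6 (L : language) (F : set (fin_structure L))
    (T : countType) (K : lstructure L T) :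
  finite_set F -> (forall A : fin_structure L, F A -> irreducible A) ->
  fraisse_limit K (Forb F) ->
  (forall X : flow K, universal_completion_flow X -> strong_completion_flow X) /\
  (forall X : flow K, completion_flow X -> strong_completion_flow X).
Proof.
move=> finF irrF KF; have [r [C [χ ramsey]]] := emb_ramsey finF irrF KF.
have strong (X : flow K) : completion_flow X -> strong_completion_flow X.
  exact: completion_strong KF.1 ramsey.
by split=> // X [cX _]; exact: strong.
Qed.
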